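(* Let $\{B^H(t),t\in[0,1]\}$ be a $d$-dimensional fractional Brownian motion with Hurst index $H\in(0,1)$, let $f\in C^H(\mathbf{I})$, let $E\subset\mathbf{I}$ be compact, and let $F$ be a $\gamma$-Ahlfors-David regular compact subset of $[-M,M]^d$ for some $\gamma\in(0,d]$ (and some $M>0$). Then there is a positive constant $\mathtt{c}_5$, depending on $E$, $F$, $H$, $\mathrm{K}_f$ and $\gamma$ only, such that $$\mathtt{c}_5^{-1}\,\mathcal{C}^{H(d-\gamma)}(E)\le\mathbb{P}\{(B^H+f)(E)\cap F\ne\emptyset\}\le\mathtt{c}_5\,\mathcal{H}^{H(d-\gamma)}(E).$$
   Context: $\mathbf{I}=[a,b]$ with fixed $0<a<b\le 1$. A real fractional Brownian motion $B_0^H$ is a centered Gaussian process with continuous paths and covariance $\frac12(|t|^{2H}+|s|^{2H}-|t-s|^{2H})$; $B^H$ has $d$ independent copies of $B_0^H$ as components and is defined on a complete probability space $(\Omega,\mathcal{F},\mathbb{P})$. $C^H(\mathbf{I})$ is the space of $H$-Hölder functions $f:\mathbf{I}\to\mathbb{R}^d$, with norm $\|f\|_H=\sup_{s\in\mathbf{I}}\|f(s)\|+\sup_{s\ne t}\|f(t)-f(s)\|/|t-s|^H$; $\mathrm{K}_f$ denotes $\|f\|_H$. A set $G$ in a metric space $(\mathscr{X},\rho)$ (here $\mathbb{R}^d$ with the Euclidean norm) is $\gamma$-Ahlfors-David regular ($\gamma>0$) if there exist a finite positive Borel measure $\mu$ supported on $G$ and a constant $\mathfrak{c}_\gamma>0$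 with $\mathfrak{c}_\gamma^{-1}r^\gamma\le\mu(B_\rho(a,r))\le\mathfrak{c}_\gamma r^\gamma$ for all $a\in G$, $0<r\le1$ (open balls). For $\alpha>0$, $\mathcal{H}^\alpha$ is the Euclidean Hausdorff measure $\mathcal{H}^\alpha(G)=\lim_{\delta\to0}\inf\{\sum_n(2r_n)^\alpha: G\subseteq\bigcup_n B(r_n),\ r_n\le\delta\}$ (open balls $B(r_n)$ of radius $r_n$); by convention $\mathcal{H}^\alpha=1$ for $\alpha\le0$. For $\alpha\ge0$, $\mathcal{C}^\alpha(G)=\big[\inf_{\mu\in\mathcal{P}(G)}\iint\varphi_\alpha(|u-v|)\mu(du)\mu(dv)\big]^{-1}$, with $\mathcal{P}(G)$ the probability measures carried by $G$, $\varphi_\alpha(r)=r^{-\alpha}$ if $\alpha>0$, $\varphi_0(r)=\log\left(\frac{e}{r\wedge1}\right)$ ($\varphi_\alpha(0)=\infty$, $1/\infty=0$, $\inf\emptyset=\infty$). *)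

(* Defs.v *)
From HB Require Import structures.
From mathcomp Require Import all_boot all_order all_algebra.
From mathcomp Require Import all_classical all_reals all_analysis.
Set Implicit Arguments.
Unset Strict Implicit.
Unset Printing Implicit Defensive.
Import Order.TTheory GRing.Theory Num.Theory.
Import numFieldNormedType.Exports.
Local Open Scope classical_set_scope.
Local Open Scope ring_scope.

Section euclidean.
Context {R : realType} {d : nat}.

(* MathComp-Analysis equips 'rV[R]_d with the max norm, which induces the same
   topology (hence the same compact and Borel sets) but not the same balls. *)
Definition enorm (x : 'rV[R]_d) : R := Num.sqrt (\sum_(i < d) x 0 i ^+ 2).

Definition eball (x : 'rV[R]_d) (r : R) : set 'rV[R]_d :=
  [set y | enorm (y - x) < r].

Definition borel_rV := g_sigma_algebraType (@open 'rV[R]_d).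

(* mu is required to have positive mass: with mu = 0 the empty set would be
   regular. *)
Definition ahlfors_regular (gam : R) (G : set 'rV[R]_d) : Prop :=
  exists (mu : {finite_measure set borel_rV -> \bar R}) (c : R),
    [/\ 0 < c,
        (0 < mu setT)%E,
        mu.-negligible (~` G) &
        forall x r, G x -> 0 < r <= 1 ->
          ((c^-1 * r `^ gam)%:E <= mu (eball x r) <= (c * r `^ gam)%:E)%E].

Definition hoelder_space (H : R) (I : set R) : set (R -> 'rV[R]_d) :=
  [set f | exists L : R, forall s t, I s -> I t ->
     enorm (f t - f s) <= L * `|t - s| `^ H].

Definition hoelder_norm (H : R) (I : set R) (f : R -> 'rV[R]_d) : \bar R :=
  (ereal_sup [set (enorm (f s))%:E | s in I] +
   ereal_sup [set (enorm (f st.2 - f st.1) / `|st.2 - st.1| `^ H)%:E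
             | st in [set st : R * R | [/\ I st.1, I st.2 & st.1 != st.2]]])%E.

End euclidean.

Section hausdorff_capacity.
Context {R : realType}.
Local Open Scope ereal_scope.

(* Radii may vanish, so that finite covers are included: ball x 0 = set0 and,
   for 0 < alpha, 0 `^ alpha = 0. *)
Definition hausdorff_premeasure (alpha delta : R) (E : set R) : \bar R :=
  ereal_inf
    [set \sum_(0 <= n <oo) ((2 * xr.2 n) `^ alpha)%R%:E
    | xr in [set xr : (nat -> R) * (nat -> R) |
        (forall n, (0 <= xr.2 n <= delta)%R) /\
        E `<=` \bigcup_n ball (xr.1 n) (xr.2 n)]].

Definition hausdorff_measure (alpha : R) (E : set R) : \bar R :=
  if (alpha <= 0)%R then 1
  else lim (hausdorff_premeasure alpha delta E @[delta --> 0^'+]).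

Definition riesz_kernel (alpha r : R) : \bar R :=
  if (r == 0)%R then +oo
  else if (alpha == 0)%R then (ln (expR 1 / Num.min r 1))%R%:E
  else (r `^ (- alpha))%R%:E.

Definition energy (alpha : R) (mu : probability R R) : \bar R :=
  \int[mu]_v \int[mu]_u riesz_kernel alpha `|u - v|%R.

Definition capacity (alpha : R) (E : set R) : \bar R :=
  (ereal_inf [set energy alpha mu
             | mu in [set mu : probability R R | mu.-negligible (~` E)]])^-1.

End hausdorff_capacity.

Section fractional_brownian_motion.
Context {dT : measure_display} {T : measurableType dT} {R : realType}.
Variable P : probability T R.

(* normal_prob takes the standard deviation and is not the Dirac mass when it
   vanishes. *)
Definition gaussian (X : T -> R) : Prop :=
  exists m s : R, forall A : set R, measurable A ->
    P (X @^-1` A) = if s == 0 then \d_m A else normal_prob m s A.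

Definition gaussian_process (I : set R) (X : R -> T -> R) : Prop :=
  forall (n : nat) (t c : 'I_n -> R), (forall i, I (t i)) ->
    gaussian (fun w => \sum_(i < n) c i * X (t i) w).

Definition fbm (H : R) (X : R -> T -> R) : Prop :=
  let I : set R := `[0, 1]%classic in
  [/\ (forall t, I t -> measurable_fun setT (X t)),
      gaussian_process I X,
      (forall t, I t -> ('E_P[X t] = 0)%E),
      (forall s t, I s -> I t -> covariance P (X s) (X t) =
         (2^-1 * (`|t| `^ (2 * H) + `|s| `^ (2 * H)
                  - `|t - s| `^ (2 * H)))%:E) &
      (forall w, {within I, continuous (fun t => X t w)})].

Definition process_sigma_algebra (I : set R) (X : R -> T -> R) : set (set T) :=
  <<s [set A | exists t (C : set R), [/\ I t, measurable C & A = X t @^-1` C]] >>.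

(* The factors A i may be setT, so this covers all subfamilies. *)
Definition independent_processes (I : set R) (d : nat)
    (B : 'I_d -> R -> T -> R) : Prop :=
  forall A : 'I_d -> set T,
    (forall i, process_sigma_algebra I (B i) (A i)) ->
    (P (\bigcap_i A i) = \prod_(i < d) P (A i))%E.

Definition fbm_vec (H : R) (d : nat) (B : 'I_d -> R -> T -> R) : Prop :=
  (forall i, fbm H (B i)) /\ independent_processes `[0, 1]%classic B.

Definition hitting_event (d : nat) (B : 'I_d -> R -> T -> R)
    (f : R -> 'rV[R]_d) (E : set R) (F : set 'rV[R]_d) : set T :=
  [set w | (fun t => \row_i B i t w + f t) @` E `&` F !=set0].

End fractional_brownian_motion.

(* Main.v *)
(* Everything is reduced to finite sums over time cells of length h and cubes of
   side h^H, because at scale h the paths move by about h^H.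

   Lower bound. Let J be the sum of mu(I_k) nu(Q_z) over the pairs of a time cell
   I_k and a cube Q_z such that (B + f)(t_k) lies in Q_z, where nu is the measure
   making F regular, and apply the second moment method to J. The process is
   locally nondeterministic, so that given B(s) the variance of B(t) is still of
   order |t - s|^(2H); summing the resulting pair probabilities against nu turns
   the density |t - s|^(-Hd) into the Riesz kernel |t - s|^(-H(d - gam)), and the
   second moment is bounded by the energy of mu.

   Upper bound. On a time interval of length l, chaining over dyadic increments
   shows that the path stays within lam l^H of its starting point, outside an
   event whose probability is small in lam. A hit then forces the starting point
   to be near F, i.e. into one of O((lam l^H)^(-gam)) cubes, which has probability
   O((lam l^H)^(d - gam)). Hence intervals of length l are hit with probability
   O(l^(H(d - gam))), which is summed over a covering of E.

   All Gaussian estimates come from the kernels exp(-c x^2), which dominate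
   indicators of boxes and whose expectations are computed from characteristic
   functions; two components are only ever used through a X + b W being normal. *)

Require Import Defs.
From HB Require Import structures.
From mathcomp Require Import all_boot all_order all_algebra.
From mathcomp Require Import all_classical all_reals all_analysis.
From mathcomp Require Import measurable_realfun.
From mathcomp Require Import ring lra.
Import Order.TTheory GRing.Theory Num.Theory.
Import numFieldNormedType.Exports.
Local Open Scope classical_set_scope.
Local Open Scope ring_scope.
Set Implicit Arguments.
Unset Strict Implicit.

(** * Gaussian integrals *)

(** Two things shape the proof. The constant must be found before the probability space, the process
    and the function are given, so each process estimate is stated with its constant first, and f
    enters only through K. And [gaussian_process] speaks of one linear combination at a time, so no
    joint density is at hand: for an uncorrelated pair the mean of a product of cosines factors,
    mixing the cosines over Gaussian frequencies makes the means of products of kernels factor, and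
    this replaces independence. In the upper bound the starting point and the later increments of a
    component are correlated; they are decoupled by regressing the increment on the starting point.
    A box of side of order 2^j l^H costs a factor 2^(jd), and tails of order 2m of the increments
    return 2^(-2jm), which is summable once 2m >= d + 1. Polynomial tails thus suffice, and they
    come from (1 - exp(-c x^2))^m, which expands into kernels. That a > 0 keeps the variances away
    from 0 and gives |t^H - s^H| <= q |t - s|^H with q < 1, the source of the nondeterminism. *)

Section gaussian_function.
Context {R : realType}.
Notation mu := (@lebesgue_measure R).

Lemma integral_shift_ge0 (h : R) (g : R -> R) : continuous g -> (forall x, 0 <= g x) ->
  (\int[mu]_x (g x)%:E = \int[mu]_x (g (x + h))%:E)%E.
Proof.
move=> cg g0.
have dE : (fun x : R => x + h)^`()%classic = cst 1.
  by apply/funext => x; rewrite derive1E deriveD// derive_id derive_cst addr0.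
rewrite (@increasing_ge0_integration_by_substitutionT _ (fun x => x + h) g) ?dE//.
- by apply: eq_integral => x _; rewrite !fctE/= mulr1.
- by move=> x y; rewrite ltrD2r.
- by move=> x; exact: cvg_cst.
- exact: is_cvg_cst.
- exact: is_cvg_cst.
- exact: cvg_addrr_Ny.
- exact: cvg_addrr.
Qed.

Lemma integral_shift (h : R) (g : R -> R) : continuous g ->
  (\int[mu]_x (g x)%:E = \int[mu]_x (g (x + h))%:E)%E.
Proof.
move=> cg; rewrite integralE [RHS]integralE.
rewrite (_ : (fun x => (g x)%:E)^\+%E = (fun x => (Num.max (g x) 0)%:E)); last first.
  by apply/funext => x; rewrite funeposE EFin_max.
rewrite (_ : (fun x => (g x)%:E)^\-%E = (fun x => (Num.max (- g x) 0)%:E)); last first.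
  by apply/funext => x; rewrite funenegE EFin_max.
rewrite (@integral_shift_ge0 h (fun x => Num.max (g x) 0)); last 2 first.
- by move=> x; apply: (@continuous_max R R g (cst 0)); [exact: cg|exact: cvg_cst].
- by move=> x; rewrite le_max lexx orbT.
rewrite (@integral_shift_ge0 h (fun x => Num.max (- g x) 0)); last 2 first.
- move=> x; apply: (@continuous_max R R (fun x => - g x) (cst 0)); last exact: cvg_cst.
  by apply: continuousN; exact: cg.
- by move=> x; rewrite le_max lexx orbT.
by congr (_ - _)%E; apply: eq_integral => x _; rewrite (funeposE,funenegE) EFin_max.
Qed.

(** Up to normalization the normal density of variance 1 / (2 c). Without the factor, kernels with
    parameters c and c' multiply to the kernel with parameter c + c', on which the splittings of
    exponents below rest. *)
Definition gaussf (c x : R) := expR (- (c * x ^+ 2)).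

Lemma continuous_gaussf c : continuous (gaussf c).
Proof.
move=> x; apply: (@continuous_comp _ _ _ (fun x : R => - (c * x ^+ 2)) expR); last exact: continuous_expR.
apply: continuousN; apply: continuousM; first exact: cvg_cst.
exact: exprn_continuous.
Qed.

Lemma measurable_gaussf c D : measurable_fun D (gaussf c).
Proof. by apply: measurable_funTS; apply: continuous_measurable_fun; exact: continuous_gaussf. Qed.

Lemma integral_gaussf (c : R) : 0 < c ->
  (\int[mu]_x (gaussf c x)%:E = (Num.sqrt (pi / c))%:E)%E.
Proof.
move=> c0; have c20 : 0 < (2 * c)^-1 by rewrite invr_gt0 mulr_gt0.
have s0 : Num.sqrt (2 * c)^-1 != 0 by rewrite gt_eqF// sqrtr_gt0.
have s2 : (Num.sqrt (2 * c)^-1) ^+ 2 = (2 * c)^-1 by rewrite sqr_sqrtr// ltW.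
have pi0 := @pi_gt0 R.
have pE x : (normal_pdf 0 (Num.sqrt (2 * c)^-1) x)%:E = ((Num.sqrt (pi / c))^-1%:E * (gaussf c x)%:E)%E.
  rewrite normal_pdfE//= /normal_peak /normal_fun s2 -EFinM /gaussf.
  have -> : ((2 * c)^-1 * pi *+ 2) = pi / c :> R by field; lra.
  by congr (_ * expR _)%:E; field; lra.
have := @integral_normal_pdf R 0 (Num.sqrt (2 * c)^-1).
under eq_integral do rewrite pE.
rewrite ge0_integralZl//=; last 2 first.
- by apply/measurable_EFinP; exact: measurable_gaussf.
- by move=> x _; rewrite lee_fin expR_ge0.
have p0 : 0 < Num.sqrt (pi / c) by rewrite sqrtr_gt0 divr_gt0// pi_gt0.
move=> /(congr1 (fun y => (Num.sqrt (pi / c))%:E * y)%E).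
by rewrite muleA -EFinM divff ?mule1 ?mul1e// gt_eqF.
Qed.

Lemma integrable_gaussf c : 0 < c -> mu.-integrable setT (EFin \o gaussf c).
Proof.
move=> c0; apply/integrableP; split; first by apply/measurable_EFinP; exact: measurable_gaussf.
under eq_integral do rewrite /= ger0_norm ?expR_ge0//.
by rewrite /= integral_gaussf// ltry.
Qed.

(** Half of the exponent absorbs the polynomial, since 1 + y <= exp y at y = c x^2 / 2. *)
Lemma sqr_gaussf c x : 0 < c -> (1 + x ^+ 2) * gaussf c x <= (1 + 2 / c) * gaussf (c / 2) x.
Proof.
move=> c0.
have -> : gaussf c x = gaussf (c / 2) x * gaussf (c / 2) x.
  by rewrite /gaussf -expRD; congr expR; field.
rewrite mulrA ler_pM2r ?expR_gt0//.
have h : 1 + c / 2 * x ^+ 2 <= expR (c / 2 * x ^+ 2) by exact: expR_ge1Dx.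
rewrite /gaussf expRN ler_pdivrMr ?expR_gt0//.
apply: (@le_trans _ _ ((1 + 2 / c) * (1 + c / 2 * x ^+ 2))); last first.
  by rewrite ler_wpM2l// addr_ge0// divr_ge0// ltW.
have -> : (1 + 2 / c) * (1 + c / 2 * x ^+ 2) = 1 + x ^+ 2 + (2 / c + c / 2 * x ^+ 2) by field; lra.
have c2 : 0 <= 2 / c by rewrite divr_ge0// ltW.
have c2' : 0 <= c / 2 by rewrite divr_ge0// ltW.
by rewrite lerDl addr_ge0// mulr_ge0// sqr_ge0.
Qed.

Lemma integrable_gaussfM c (K : R) (g : R -> R) : 0 < c -> measurable_fun setT g ->
  (forall x, `|g x| <= K * (1 + x ^+ 2)) ->
  mu.-integrable setT (fun x => (g x * gaussf c x)%:E).
Proof.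
move=> c0 mg gK.
have K0 : 0 <= K by have := gK 0; rewrite expr0n addr0 mulr1; exact: le_trans.
apply: (@le_integrable _ _ _ mu _ measurableT _ (fun x => (K * (1 + 2 / c))%:E * (gaussf (c / 2) x)%:E)%E).
- apply/measurable_EFinP; apply: measurable_funM => //; exact: measurable_gaussf.
- move=> x _ /=; rewrite lee_fin normrM [`|gaussf c x|]ger0_norm ?expR_ge0//.
  apply: le_trans (ler_norm _); rewrite -mulrA.
  apply: le_trans (ler_wpM2l K0 (sqr_gaussf x c0)).
  by rewrite mulrA ler_wpM2r// expR_ge0.
- by apply: integrableZl => //; apply: integrable_gaussf; rewrite divr_gt0.
Qed.

End gaussian_function.

Section gaussian_translates.
Context {R : realType}.
Notation mu := (@lebesgue_measure R).

(** From (x - 2h)^2 >= 0 one gets (x - h)^2 >= x^2 / 2 - h^2, so all translates by |h| < 1 share one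
    integrable bound. *)
Lemma gaussf_shift_le (c x h : R) : 0 < c -> `|h| < 1 ->
  gaussf c (x - h) <= expR c * gaussf (c / 2) x.
Proof.
move=> c0 h1; rewrite /gaussf -expRD ler_expR.
have : h ^+ 2 <= 1 by rewrite -(real_normK (num_real h)) exprn_ile1// ltW.
have := sqr_ge0 (x - 2 * h); nra.
Qed.

Lemma is_derive_gaussf_shift (c x h : R) :
  is_derive h (1 : R) (fun h : R => gaussf c (x - h)) (2 * c * (x - h) * gaussf c (x - h)).
Proof.
rewrite /gaussf.
have := @is_derive1_comp R expR (fun h : R => - (c * (x - h) ^+ 2)) h
  (expR (- (c * (x - h) ^+ 2))) (2 * c * (x - h)) (is_derive_expR _).
rewrite [in X in _ -> X]mulrC; apply.
apply: is_derive_eq; rewrite ?scaler0 ?add0r ?addr0 ?scaler1 /GRing.scale/=.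
by ring.
Qed.

(** This stands in for integration by parts. The integral also equals that of
    [g (x + h) * gaussf c x]; when the dependence on h can be computed in that form, comparing
    derivatives at 0 gives a moment identity. *)
Lemma derive_Rintegral_shift (c K : R) (g : R -> R) : 0 < c -> continuous g ->
  (forall x, `|g x| <= K * (1 + `|x|)) ->
  is_derive (0 : R) (1 : R) (fun h => \int[mu]_x (g x * gaussf c (x - h)))
    (2 * c * \int[mu]_x (g x * x * gaussf c x)).
Proof.
move=> c0 cg gK.
have mg : measurable_fun setT g by exact: continuous_measurable_fun.
have K0 : 0 <= K by have := gK 0; rewrite normr0 addr0 mulr1; exact: le_trans.
have K1 x : K * (1 + `|x|) <= 2 * K * (1 + x ^+ 2).
  rewrite -(real_normK (num_real x)) [2 * K]mulrC -mulrA ler_wpM2l//.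
  by have := sqr_ge0 (`|x| - 1); nra.
pose f (h x : R) := g x * gaussf c (x - h).
have mf h : measurable_fun setT (f h).
  apply: measurable_funM => //; apply: continuous_measurable_fun => x.
  apply: (@continuous_comp _ _ _ (fun x : R => x - h)); last exact: continuous_gaussf.
  by apply: continuousB; [exact: cvg_id|exact: cvg_cst].
have d1 (h x : R) : is_derive h (1 : R) (f ^~ x) (g x * (2 * c * (x - h) * gaussf c (x - h))).
  rewrite /f.
  have := is_derive_gaussf_shift c x h => dd.
  by apply: is_derive_eq.
(* In the derivative 2 c g(x) (x - h) times the kernel, 2 K (1 + x^2) bounds [|g x|] times |x - h|,
   and exp c pays for the translation. *)
pose G x := (4 * c * K * expR c) * ((1 + x ^+ 2) * gaussf (c / 2) x).
have c20 : 0 < c / 2 by rewrite divr_gt0.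
have mG2 : measurable_fun setT (fun x : R => 1 + x ^+ 2).
  by apply: measurable_funD => //; exact: measurable_funX.
have iG0 (C : R) : mu.-integrable setT (fun x => (C * ((1 + x ^+ 2) * gaussf (c / 2) x))%:E).
  under eq_fun do rewrite EFinM.
  apply: integrableZl => //; apply: (@integrable_gaussfM _ _ 1) => // x.
  by rewrite mul1r ger0_norm// addr_ge0 ?ler01 ?sqr_ge0.
have intf h : `]-1, 1[%classic h -> mu.-integrable setT (EFin \o f h).
  rewrite /= in_itv/= => hI.
  have h1 : `|h| < 1 by rewrite ltr_norml.
  apply: (@le_integrable _ _ _ mu _ measurableT _ _ _ _ (iG0 (2 * K * expR c))).
    by apply/measurable_EFinP; exact: mf.
  move=> x _ /=; rewrite lee_fin; apply: le_trans (ler_norm _).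
  rewrite /f normrM [`|gaussf _ _|]ger0_norm ?expR_ge0//.
  rewrite (_ : _ * (_ * _) = (2 * K * (1 + x ^+ 2)) * (expR c * gaussf (c / 2) x)); last by ring.
  apply: ler_pM => //; first by rewrite expR_ge0.
    exact: le_trans (K1 x).
  exact: gaussf_shift_le.
have dom x y : `]-1, 1[%classic x -> setT y -> `|partial1of2 f x y| <= G y.
  rewrite /= in_itv/= => hI _.
  have h1 : `|x| < 1 by rewrite ltr_norml.
  rewrite partial1of2E; have [_ ->] := d1 x y.
  rewrite !normrM [`|gaussf _ _|]ger0_norm ?expR_ge0// (gtr0_norm c0) (gtr0_norm (@ltr0n R 2)).
  have A : `|g y| * `|y - x| <= 2 * K * (1 + y ^+ 2).
    apply: (@le_trans _ _ (K * (1 + `|y|) * (1 + `|y|))).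
      apply: ler_pM => //; rewrite (le_trans (ler_normB _ _))// addrC lerD2r; exact: ltW.
    rewrite -(real_normK (num_real y)) [2 * K]mulrC -!mulrA ler_wpM2l//.
    by have := sqr_ge0 (`|y| - 1); nra.
  have B := gaussf_shift_le y c0 h1.
  have -> : `|g y| * (2 * c * `|y - x| * gaussf c (y - x)) =
    2 * c * ((`|g y| * `|y - x|) * gaussf c (y - x)) by ring.
  have -> : G y = 2 * c * ((2 * K * (1 + y ^+ 2)) * (expR c * gaussf (c / 2) y)) by rewrite /G; ring.
  rewrite ler_wpM2l//; first by rewrite mulr_ge0// ltW.
  by apply: ler_pM => //; rewrite ?mulr_ge0 ?expR_ge0.
have I0 : `]-1, 1[%classic (0 : R) by rewrite /= in_itv/= ltrN10 ltr01.
have G0 y : 0 <= G y.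
  by rewrite /G; do ?apply: mulr_ge0; rewrite ?expR_ge0 ?addr_ge0 ?sqr_ge0 ?(ltW c0).
have df x y : `]-1, 1[%classic x -> setT y -> derivable (f^~ y) x 1 by [].
have dd := @derivable_under_integral R _ _ mu f setT measurableT 0 (-1) 1 I0 intf df G G0 (iG0 _) dom.
have d2 := @differentiation_under_integral R _ _ mu f setT measurableT 0 (-1) 1 I0 intf df G G0 (iG0 _) dom.
apply: DeriveDef => //.
rewrite -derive1E d2 -RintegralZl//; last first.
  apply: (@integrable_gaussfM _ _ (4 * K)) => //.
    by apply: measurable_funM => //; exact: measurable_id.
  move=> x; rewrite normrM (le_trans (ler_wpM2r _ (gK x)))//.
  rewrite -(real_normK (num_real x)) [4 * K]mulrC -!mulrA ler_wpM2l//.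
  by have := sqr_ge0 (`|x| - 1); nra.
apply: eq_Rintegral => x _; rewrite partial1of2E; have [_ ->] := d1 0 x.
by rewrite subr0; ring.
Qed.
End gaussian_translates.

(** * Moments and cosine transform of the Gaussian function *)

Section gaussian_transform.
Context {R : realType}.
Notation mu := (@lebesgue_measure R).

Lemma Rintegral_gaussf (c : R) : 0 < c -> \int[mu]_x gaussf c x = Num.sqrt (pi / c).
Proof. by move=> c0; rewrite /Rintegral integral_gaussf. Qed.

Lemma Rintegral_shift (h : R) (g : R -> R) : continuous g ->
  \int[mu]_x g x = \int[mu]_x g (x + h).
Proof. by move=> cg; rewrite /Rintegral (integral_shift h cg). Qed.

Lemma continuous_gaussf_shift (c h : R) : continuous (fun x => gaussf c (x - h)).
Proof.
move=> x; apply: (@continuous_comp _ _ _ (fun x : R => x - h)); last exact: continuous_gaussf.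
by apply: continuousB; [exact: cvg_id|exact: cvg_cst].
Qed.

Lemma continuousM_gaussf_shift (c h : R) (g : R -> R) : continuous g ->
  continuous (fun x => g x * gaussf c (x - h)).
Proof. by move=> cg x; apply: (@continuousM _ _ g (fun x => gaussf c (x - h))); [exact: cg|exact: continuous_gaussf_shift]. Qed.

(** For g = 1 the translated integral does not depend on h, so its derivative, 2 c times this mean,
    vanishes. *)
Lemma gaussf_mean (c : R) : 0 < c -> \int[mu]_x ((x : R) * gaussf c x) = 0.
Proof.
move=> c0.
have := @derive_Rintegral_shift R c 1 (cst 1) c0 _ _ => /=.
under eq_fun => h.
  rewrite (_ : \int[mu]_x (1 * gaussf c (x - h)) = Num.sqrt (pi / c)); last first.
    rewrite -Rintegral_gaussf//.
    rewrite (@Rintegral_shift h (fun x => 1 * gaussf c (x - h))); last first.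
      by apply: (@continuousM_gaussf_shift c h (cst 1)) => x; exact: cvg_cst.
    by apply: eq_Rintegral => x _; rewrite mul1r addrK.
  over.
move=> /(_ _ _)/wrap[| |[_]].
- by move=> x; exact: cvg_cst.
- by move=> x; rewrite normr1 mul1r lerDl.
rewrite derive_cst => /esym/eqP; rewrite mulf_eq0 gt_eqF/= ?mulr_gt0// => /eqP <-.
by apply: eq_Rintegral => x _; rewrite mul1r.
Qed.

(** For g = id the translated integral is h times the total mass, and its slope is 2 c times the
    second moment. *)
Lemma gaussf_var (c : R) : 0 < c -> \int[mu]_x ((x : R) ^+ 2 * gaussf c x) = Num.sqrt (pi / c) / (2 * c).
Proof.
move=> c0.
have ig (h : R) : mu.-integrable setT (fun x => (h * gaussf c x)%:E).
  apply: (@integrable_gaussfM _ _ `|h|) => // x.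
  by rewrite ler_peMr// lerDl sqr_ge0.
have ix : mu.-integrable setT (fun x : R => (x * gaussf c x)%:E).
  apply: (@integrable_gaussfM _ _ 1) => // x.
  rewrite mul1r -(real_normK (num_real x)).
  by have := sqr_ge0 (`|x| - 1); have := normr_ge0 x; nra.
have E : (fun h => \int[mu]_x ((x : R) * gaussf c (x - h))) = (fun h => h * Num.sqrt (pi / c)).
  apply/funext => h.
  rewrite (@Rintegral_shift h (fun x => x * gaussf c (x - h))); last first.
    by apply: (@continuousM_gaussf_shift c h id) => x; exact: cvg_id.
  under eq_Rintegral do rewrite addrK mulrDl.
  rewrite RintegralD//; last exact: ig.
  transitivity (0 + h * \int[mu]_x gaussf c x); last by rewrite add0r Rintegral_gaussf.
  congr (_ + _); first exact: gaussf_mean.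
  by rewrite -RintegralZl//; exact: integrable_gaussf.
have D' : is_derive (0 : R) (1 : R) (fun h => h * Num.sqrt (pi / c)) (Num.sqrt (pi / c)).
  by apply: is_derive_eq; rewrite /GRing.scale/= ?(mulr0, mul0r, addr0, add0r, mulr1, mul1r).
have D : is_derive (0 : R) (1 : R) (fun h => h * Num.sqrt (pi / c))
    (2 * c * \int[mu]_x ((x : R) ^+ 2 * gaussf c x)).
  rewrite -E; apply: (@derive_Rintegral_shift R c 1 id c0) => x; first exact: cvg_id.
  by rewrite mul1r lerDr.
have [_ <-] := D'; have [_ ->] := D.
by rewrite mulrAC mulfV ?mul1r// gt_eqF ?mulr_gt0.
Qed.

(* As a function F of xi, the integral solves 2 c F' = - xi F: differentiate under
   the integral sign, then use the derivative at 0 of the integral translated in x. *)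
Lemma cos_gaussf (c xi th : R) : 0 < c ->
  \int[mu]_x (cos (xi * x + th) * gaussf c x) =
  cos th * Num.sqrt (pi / c) * expR (- (xi ^+ 2 / (4 * c))).
Proof.
move=> c0.
pose F (xi : R) := \int[mu]_x (cos (xi * x + th) * gaussf c x).
have ccos (a b : R) : continuous (fun x => cos (a * x + b)).
  move=> x; apply: (@continuous_comp _ _ _ (fun x => a * x + b) (@cos R)); last exact: continuous_cos.
  by apply: continuousD; [apply: continuousM; [exact: cvg_cst|exact: cvg_id]|exact: cvg_cst].
have csin (a b : R) : continuous (fun x => sin (a * x + b)).
  move=> x; apply: (@continuous_comp _ _ _ (fun x => a * x + b) (@sin R)); last exact: continuous_sin.
  by apply: continuousD; [apply: continuousM; [exact: cvg_cst|exact: cvg_id]|exact: cvg_cst].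
have ib (g : R -> R) : continuous g -> (forall x, `|g x| <= 1) ->
    mu.-integrable setT (fun x => (g x * gaussf c x)%:E).
  move=> cg g1; apply: (@integrable_gaussfM _ _ 1) => //.
    exact: continuous_measurable_fun.
  by move=> x; rewrite mul1r (le_trans (g1 x))// lerDl sqr_ge0.
have ic a b := ib _ (ccos a b) (fun x => cos_max _).
have is_ a b := ib _ (csin a b) (fun x => sin_max _).
have ixs a b : mu.-integrable setT (fun x => (sin (a * x + b) * x * gaussf c x)%:E).
  apply: (@integrable_gaussfM _ _ 1) => //.
    by apply: measurable_funM => //; apply: continuous_measurable_fun; exact: csin.
  move=> x; rewrite mul1r normrM -(real_normK (num_real x)).
  have := sqr_ge0 (`|x| - 1); have := normr_ge0 x.
  have : `|sin (a * x + b)| * `|x| <= 1 * `|x| by rewrite ler_wpM2r ?sin_max.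
  nra.
have dF (a : R) : is_derive a (1 : R) F (- \int[mu]_x (sin (a * x + th) * x * gaussf c x)).
  pose f (h x : R) := cos (h * x + th) * gaussf c x.
  have d1 (h x : R) : is_derive h (1 : R) (f ^~ x) (- sin (h * x + th) * x * gaussf c x).
    rewrite /f.
    have dc : is_derive h (1 : R) (cos \o (fun h : R => h * x + th)) (- sin (h * x + th) * x).
      apply: is_derive1_comp; apply: is_derive_eq.
      by rewrite /GRing.scale/= ?(mulr0, mul0r, addr0, add0r, mulr1, mul1r).
    apply: is_derive_eq; rewrite /GRing.scale/= ?(mulr0, mul0r, addr0, add0r, mulr1, mul1r) mulrC//.
  pose G x : R := (1 + x ^+ 2) * gaussf c x.
  have G0 y : 0 <= G y by rewrite mulr_ge0 ?expR_ge0// addr_ge0 ?sqr_ge0.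
  have iG : mu.-integrable setT (EFin \o G).
    apply: (@integrable_gaussfM _ _ 1) => //.
      by apply: measurable_funD => //; exact: measurable_funX.
    by move=> x; rewrite mul1r ger0_norm// addr_ge0 ?ler01 ?sqr_ge0.
  have dom x y : `]a - 1, a + 1[%classic x -> setT y -> `|partial1of2 f x y| <= G y.
    move=> _ _; rewrite partial1of2E; have [_ ->] := d1 x y.
    rewrite normrM [`|gaussf _ _|]ger0_norm ?expR_ge0// ler_wpM2r ?expR_ge0//.
    rewrite normrM normrN -(real_normK (num_real y)).
    have := sqr_ge0 (`|y| - 1); have := normr_ge0 y.
    have : `|sin (x * y + th)| * `|y| <= 1 * `|y| by rewrite ler_wpM2r ?sin_max.
    nra.
  have Ia : `]a - 1, a + 1[%classic a by rewrite /= in_itv/= ltrBlDr ltrDl ltr01.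
  have intf h : `]a - 1, a + 1[%classic h -> mu.-integrable setT (EFin \o f h) by move=> _; exact: ic.
  have df x y : `]a - 1, a + 1[%classic x -> setT y -> derivable (f^~ y) x 1 by [].
  have dd := @derivable_under_integral R _ _ mu f setT measurableT a (a - 1) (a + 1) Ia intf df G G0 iG dom.
  have d2 := @differentiation_under_integral R _ _ mu f setT measurableT a (a - 1) (a + 1) Ia intf df G G0 iG dom.
  apply: DeriveDef => //.
  rewrite -derive1E d2 -mulN1r -RintegralZl//; last exact: ixs.
  apply: eq_Rintegral => x _; rewrite partial1of2E; have [_ ->] := d1 a x.
  by rewrite mulN1r !mulNr.
(* Expanding sin (a (x + h) + th) makes the translated integral a combination of sin (a h) and cos
   (a h), whose derivative at 0 is a F(a). *)
have ode (a : R) : 2 * c * \int[mu]_x (sin (a * x + th) * x * gaussf c x) = a * F a.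
  have := @derive_Rintegral_shift R c 1 (fun x => sin (a * x + th)) c0 (csin _ _) _.
  under eq_fun => h.
    rewrite (_ : \int[mu]_x (sin (a * x + th) * gaussf c (x - h)) =
       sin (a * h) * F a + cos (a * h) * \int[mu]_x (sin (a * x + th) * gaussf c x)); last first.
      rewrite (@Rintegral_shift h (fun x => sin (a * x + th) * gaussf c (x - h))); last first.
        by apply: (@continuousM_gaussf_shift c h (fun x => sin (a * x + th))); exact: csin.
      rewrite /F -(RintegralZl _ measurableT (ic a th)) -(RintegralZl _ measurableT (is_ a th)) -RintegralD//; last 2 first.
      + exact: (integrableZl measurableT (sin (a * h)) (ic a th)).
      + exact: (integrableZl measurableT (cos (a * h)) (is_ a th)).
      apply: eq_Rintegral => x _; rewrite addrK.
      rewrite (_ : a * (x + h) + th = a * h + (a * x + th)); last by ring.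
      by rewrite sinD; ring.
    over.
  move=> /(_ _)/wrap[|[_ <-]].
    move=> x; rewrite mul1r (le_trans (sin_max _))// lerDl//.
  have ds : is_derive (0 : R) (1 : R) (sin \o (fun h : R => a * h)) (cos (a * 0) * a).
    by apply: is_derive1_comp; apply: is_derive_eq; rewrite /GRing.scale/= ?(mulr0, mul0r, addr0, add0r, mulr1, mul1r).
  have dc : is_derive (0 : R) (1 : R) (cos \o (fun h : R => a * h)) (- sin (a * 0) * a).
    by apply: is_derive1_comp; apply: is_derive_eq; rewrite /GRing.scale/= ?(mulr0, mul0r, addr0, add0r, mulr1, mul1r).
  set S := \int[mu]_x (sin (a * x + th) * gaussf c x).
  have ddd : is_derive (0 : R) (1 : R) (fun h => sin (a * h) * F a + cos (a * h) * S)
      (cos (a * 0) * a * F a + - sin (a * 0) * a * S).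
    apply: is_derive_eq.
    by rewrite /GRing.scale/= ?(mulr0, mul0r, addr0, add0r, mulr1, mul1r) [F a * _]mulrC [S * _]mulrC.
  have [_ ->] := ddd.
  by rewrite mulr0 cos0 sin0 mul1r oppr0 !mul0r addr0.
(* Integrating factor of the equation: [Q] has derivative 0, and [Q 0] is [F 0]. *)
pose Q (a : R) := F a * expR (a ^+ 2 / (4 * c)).
have dQ (a : R) : is_derive a (1 : R) Q 0.
  have de : is_derive a (1 : R) (expR \o (fun a : R => a ^+ 2 / (4 * c))) (expR (a ^+ 2 / (4 * c)) * (a / (2 * c))).
    apply: is_derive1_comp; apply: is_derive_eq.
    by rewrite /GRing.scale/= ?(mulr0, mul0r, addr0, add0r, mulr1, mul1r); field; lra.
  have := dF a => dFa.
  rewrite /Q; apply: is_derive_eq; rewrite /GRing.scale/=.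
  have -> : \int[mu]_x (sin (a * x + th) * x * gaussf c x) = a * F a / (2 * c).
    by rewrite -ode; field; lra.
  ring.
have := is_derive_0_is_cst xi 0 dQ; rewrite /Q.
rewrite expr0n/= mul0r expR0 mulr1 => QE.
have -> : \int[mu]_x (cos (xi * x + th) * gaussf c x) = F 0 * expR (- (xi ^+ 2 / (4 * c))).
  by rewrite -QE -mulrA -expRD subrr expR0 mulr1.
congr (_ * _).
rewrite /F -Rintegral_gaussf// -RintegralZl//; last exact: integrable_gaussf.
by apply: eq_Rintegral => x _; rewrite mul0r add0r.
Qed.

End gaussian_transform.

(** * Gaussian laws and their identification by two moments *)

Section density.
Context {d} {T : measurableType d} {R : realType} (P : probability T R).
Notation mu := (@lebesgue_measure R).

(** The law is given on sets only. It is absolutely continuous, its Radon-Nikodym derivative agrees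
    with [p] almost everywhere because both have the same integrals over measurable sets, and the
    change of variables for that derivative does the rest. *)
Lemma ge0_integral_density (Z : T -> R) (p : R -> R) (g : R -> R) :
  measurable_fun setT Z -> measurable_fun setT p -> (forall x, 0 <= p x) ->
  (forall A, measurable A -> P (Z @^-1` A) = \int[mu]_(x in A) (p x)%:E)%E ->
  measurable_fun setT g -> (forall x, 0 <= g x) ->
  (\int[P]_w (g (Z w))%:E = \int[mu]_x (g x * p x)%:E)%E.
Proof.
move=> mZ mp p0 PZ mg g0.
pose Zm : {mfun T >-> measurableTypeR R} :=
  HB.pack (Z : T -> measurableTypeR R) (isMeasurableFun.Build _ _ T (measurableTypeR R) Z mZ).
pose nu : {finite_measure set (measurableTypeR R) -> \bar R} := distribution P Zm.
have numu : nu `<< mu.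
  apply/null_content_dominatesP => A mA A0.
  have -> : nu A = (\int[mu]_(x in A) (p x)%:E)%E by exact: PZ.
  apply: null_set_integral => //; first by apply: measurable_funTS; apply/measurable_EFinP.
have e1 : (\int[P]_w (g (Z w))%:E = \int[nu]_x (g x)%:E)%E.
  rewrite /nu (@ge0_integral_distribution _ _ _ (measurableTypeR R) _ P Zm (fun x => (g x)%:E))//.
  exact/measurable_EFinP.
have mgE : measurable_fun [set: measurableTypeR R] (fun x : measurableTypeR R => (g x)%:E).
  exact/measurable_EFinP.
rewrite e1.
have <- := @Radon_Nikodym_SigmaFinite.change_of_variables _ (measurableTypeR R) R nu mu numu
  (fun x => (g x)%:E) setT (fun x => g0 x) measurableT mgE.
apply: ae_eq_integral => //.
- apply: emeasurable_funM; first exact/measurable_EFinP.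
  exact: measurable_int (Radon_Nikodym_SigmaFinite.f_integrable numu).
- by apply/measurable_EFinP; apply: measurable_funM.
- under [X in ae_eq _ _ _ X]eq_fun do rewrite EFinM.
  apply: ae_eqe_mul2l; apply: integral_ae_eq => //.
  + exact: Radon_Nikodym_SigmaFinite.f_integrable numu.
  + exact/measurable_EFinP.
  + by move=> A _ mA; rewrite -Radon_Nikodym_SigmaFinite.f_integral// -PZ.
Qed.

Lemma integral_density (Z : T -> R) (p : R -> R) (g : R -> R) :
  measurable_fun setT Z -> measurable_fun setT p -> (forall x, 0 <= p x) ->
  (forall A, measurable A -> P (Z @^-1` A) = \int[mu]_(x in A) (p x)%:E)%E ->
  measurable_fun setT g ->
  (\int[P]_w (g (Z w))%:E = \int[mu]_x (g x * p x)%:E)%E.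
Proof.
move=> mZ mp p0 PZ mg; rewrite integralE [RHS]integralE; congr (_ - _)%E.
- rewrite (_ : (fun w => (g (Z w))%:E)^\+%E = (fun w => (Num.max (g (Z w)) 0)%:E)); last first.
    by apply/funext => w; rewrite funeposE EFin_max.
  rewrite (@ge0_integral_density Z p (fun x => Num.max (g x) 0))//.
  + apply: eq_integral => x _; rewrite funeposE -EFin_max; congr EFin.
    by rewrite maxr_pMl ?mul0r.
  + exact: measurable_maxr.
  + by move=> x; rewrite le_max lexx orbT.
- rewrite (_ : (fun w => (g (Z w))%:E)^\-%E = (fun w => (Num.max (- g (Z w)) 0)%:E)); last first.
    by apply/funext => w; rewrite funenegE EFin_max.
  rewrite (@ge0_integral_density Z p (fun x => Num.max (- g x) 0))//.
  + apply: eq_integral => x _; rewrite funenegE -EFinN -EFin_max; congr EFin.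
    by rewrite maxr_pMl ?mul0r ?mulNr.
  + by apply: measurable_maxr => //; exact: measurable_funN.
  + by move=> x; rewrite le_max lexx orbT.
Qed.

Lemma integral_dirac_law (Z : T -> R) (m : R) (g : R -> R) :
  measurable_fun setT Z ->
  (forall A, measurable A -> P (Z @^-1` A) = \d_m A) ->
  measurable_fun setT g ->
  (\int[P]_w (g (Z w))%:E = (g m)%:E)%E.
Proof.
move=> mZ PZ mg.
have ae : {ae P, forall w, setT w -> (g (Z w))%:E = (cst (g m)%:E) w}.
  exists (Z @^-1` (~` [set m])); split.
  - by rewrite -[X in measurable X]setTI; apply: mZ => //; apply: measurableC.
  - by rewrite PZ ?diracE ?memNset//; [move=> /(_ erefl)|apply: measurableC].
  - move=> w /= /not_implyP[_ h] Zm; apply: h; rewrite Zm//.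
transitivity (\int[P]_w (cst (g m)%:E) w)%E.
  apply: ae_eq_integral => //.
  by apply/measurable_EFinP; exact: measurableT_comp.
by rewrite integral_cst//= probability_setT mule1.
Qed.


(** The parameter is the variance, so that it is a quadratic form in the coefficients of a linear
    combination. Variance 0 must be allowed: such combinations, and residuals of regressions, may
    vanish. *)
Definition centered_normal (Z : T -> R) (v : R) :=
  [/\ measurable_fun setT Z, 0 <= v &
    forall A : set R, measurable A ->
      P (Z @^-1` A) = if v == 0 then \d_(0 : R) A else normal_prob 0 (Num.sqrt v) A].

Lemma normal_pdf_gaussf (m s x : R) : s != 0 ->
  normal_pdf m s x = (Num.sqrt (pi / (2 * s ^+ 2)^-1))^-1 * gaussf (2 * s ^+ 2)^-1 (x - m).
Proof.
move=> s0; rewrite normal_pdfE// /normal_peak /normal_fun /gaussf invrK.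
congr (_ * _); first by congr (Num.sqrt _)^-1; ring.
by congr expR; rewrite mulNr -mulr_natl mulrC.
Qed.

(** [gaussian] only asserts that some m and s exist; the first two moments identify them.
    Integrability of [Z] is deduced from the finite second moment through |z| <= 1 + z^2. *)
Lemma gaussian_normal_law (Z : T -> R) (v : R) : measurable_fun setT Z ->
  gaussian P Z -> (\int[P]_w (Z w)%:E = 0)%E -> (\int[P]_w (Z w ^+ 2)%:E = v%:E)%E ->
  centered_normal Z v.
Proof.
move=> mZ [m [s PZ]] EZ EZ2.
have mid : measurable_fun [set: R] (fun x : R => x) by exact: measurable_id.
have mX2 : measurable_fun [set: R] (fun x : R => x ^+ 2) by exact: measurable_funX.
have v0 : 0 <= v.
  by rewrite -lee_fin -EZ2; apply: integral_ge0 => w _; rewrite lee_fin sqr_ge0.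
split=> // A mA; have [s0|s0] := eqVneq s 0.
  have PZ' B : measurable B -> P (Z @^-1` B) = \d_m B by move=> mB; rewrite PZ// s0 eqxx.
  move: EZ EZ2.
  rewrite (@integral_dirac_law Z m (fun x => x))// => -[m0].
  rewrite (@integral_dirac_law Z m (fun x => x ^+ 2))// => -[].
  by rewrite m0 expr0n/= => <-; rewrite eqxx PZ' ?m0.
have s20 : 0 < s ^+ 2 by rewrite exprn_even_gt0.
pose c := (2 * s ^+ 2)^-1.
have c0 : 0 < c by rewrite invr_gt0 mulr_gt0.
have k0 : 0 < Num.sqrt (pi / c) by rewrite sqrtr_gt0 divr_gt0// pi_gt0.
have PZ' B : measurable B -> (P (Z @^-1` B) = \int[mu]_(x in B) (normal_pdf m s x)%:E)%E.
  by move=> mB; rewrite PZ// (negbTE s0).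
have mp := @measurable_normal_pdf R m s.
have p0 := @normal_pdf_ge0 R m s.
have cst0 (h : R -> R) : continuous h ->
  (\int[P]_w (h (Z w))%:E = \int[mu]_x ((Num.sqrt (pi / c))^-1 * (h (x + m) * gaussf c x))%:E)%E.
  move=> ch.
  rewrite (integral_density mZ mp p0 PZ'); last exact: continuous_measurable_fun.
  rewrite (@integral_shift R m (fun x => h x * normal_pdf m s x)); last first.
    move=> x; apply: (@continuousM _ _ h (normal_pdf m s)); first exact: ch.
    exact: continuous_normal_pdf.
  apply: eq_integral => x _; rewrite normal_pdf_gaussf// -/c addrK.
  by congr EFin; ring.
(* Means of functions of Z - m as integrals against the centered kernel; taking z and then z^2 for
   [h] gives m = 0 and v = s^2. *)
have R0 (h : R -> R) K r : continuous h -> (forall x, `|h x| <= K * (1 + x ^+ 2)) ->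
    (\int[P]_w (h (Z w - m))%:E = r%:E)%E ->
    r = (Num.sqrt (pi / c))^-1 * \int[mu]_x (h x * gaussf c x).
  move=> ch hK.
  rewrite (cst0 (fun x => h (x - m))); last first.
    move=> x; apply: (@continuous_comp _ _ _ (fun x : R => x - m)); last exact: ch.
    by apply: continuousB; [exact: cvg_id|exact: cvg_cst].
  move=> /(congr1 fine) /= <-; rewrite -RintegralZl//; last first.
    by apply: integrable_gaussfM hK => //; exact: continuous_measurable_fun.
  by apply: eq_Rintegral => x _; rewrite addrK.
have iZ2 : P.-integrable setT (EFin \o (fun w => Z w ^+ 2)).
  apply/integrableP; split.
    by apply/measurable_EFinP; exact: measurable_funX.
  under eq_integral do rewrite /= ger0_norm ?sqr_ge0//.
  by rewrite EZ2 ltry.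
have i1 : P.-integrable setT (EFin \o (fun w => (1 : R))).
  exact: finite_measure_integrable_cst.
have iZ : P.-integrable setT (EFin \o Z).
  apply: (@le_integrable _ _ _ P _ measurableT _ (fun w => (1 + Z w ^+ 2)%:E)).
  - exact/measurable_EFinP.
  - move=> w _ /=; rewrite lee_fin [leRHS]ger0_norm ?addr_ge0 ?sqr_ge0//.
    rewrite -(real_normK (num_real (Z w))).
    by have := sqr_ge0 (`|Z w| - 1); have := normr_ge0 (Z w); nra.
  - exact: (integrableD measurableT i1 iZ2).
have RZ : \int[P]_w Z w = 0 by rewrite /Rintegral EZ.
have RZ2 : \int[P]_w (Z w ^+ 2) = v by rewrite /Rintegral EZ2.
have m0 : m = 0.
  apply/eqP; rewrite -oppr_eq0; apply/eqP.
  rewrite (R0 (fun x => x) 1 (- m)).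
  - by rewrite gaussf_mean// mulr0.
  - by move=> x; exact: cvg_id.
  - move=> x; rewrite mul1r -(real_normK (num_real x)).
    by have := sqr_ge0 (`|x| - 1); have := normr_ge0 x; nra.
  - under eq_integral do rewrite EFinB.
    rewrite integralB//; last exact: (finite_measure_integrable_cst P m measurableT).
    have -> : (\int[P]_w m%:E = m%:E)%E by rewrite (@integral_cst _ _ _ P _ measurableT m%:E)//= probability_setT mule1.
    by rewrite EZ add0e.
have vs : v = s ^+ 2.
  rewrite (R0 (fun x => x ^+ 2) 1 v).
  - rewrite gaussf_var// mulrA mulVf ?gt_eqF// mul1r.
    by rewrite /c; field; rewrite s0.
  - by move=> x; exact: exprn_continuous.
  - by move=> x; rewrite mul1r ger0_norm ?sqr_ge0// lerDr.
  - by rewrite -EZ2; apply: eq_integral => w _; rewrite m0 subr0.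
rewrite vs gt_eqF// PZ// (negbTE s0) m0 sqrtr_sqr.
rewrite /normal_prob; apply: eq_integral => x _; congr EFin.
by rewrite !normal_pdf_gaussf ?normr_eq0// real_normK// num_real.
Qed.

End density.

Lemma EFin_Rintegral {d} {T : measurableType d} {R : realType}
    (m : {measure set T -> \bar R}) (f : T -> R) :
  m.-integrable setT (EFin \o f) -> (\int[m]_w (f w)%:E = (\int[m]_w f w)%:E)%E.
Proof. by move=> fi; rewrite /Rintegral fineK//; exact: integrable_fin_num. Qed.

(** * Expectations of cosines and of Gaussian kernels *)

Section kernel.
Context {d} {T : measurableType d} {R : realType} (P : probability T R).
Notation mu := (@lebesgue_measure R).

Lemma bounded_integrable (U : T -> R) (K : R) : measurable_fun setT U ->
  (forall w, `|U w| <= K) -> P.-integrable setT (EFin \o U).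
Proof.
move=> mU UK; apply: (@le_integrable _ _ _ P _ measurableT _ (fun w => K%:E)).
- exact/measurable_EFinP.
- by move=> w _ /=; rewrite lee_fin (le_trans (UK w))// ler_norm.
- exact: (finite_measure_integrable_cst P K measurableT).
Qed.

Lemma Rintegral_probability_cst (k : R) : \int[P]_w k = k.
Proof. by rewrite Rintegral_cst//= probability_setT/= mulr1. Qed.

Lemma normal_integral (Z : T -> R) (v K : R) (g : R -> R) :
  centered_normal P Z v -> 0 < v -> measurable_fun setT g ->
  (forall x, `|g x| <= K * (1 + x ^+ 2)) ->
  \int[P]_w g (Z w) = (Num.sqrt (2 * pi * v))^-1 * \int[mu]_x (g x * gaussf (2 * v)^-1 x).
Proof.
move=> [mZ _ PZ] v0 mg gK.
have s0 : Num.sqrt v != 0 by rewrite gt_eqF// sqrtr_gt0.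
have PZ' B : measurable B -> (P (Z @^-1` B) = \int[mu]_(x in B) (normal_pdf 0 (Num.sqrt v) x)%:E)%E.
  by move=> mB; rewrite PZ// gt_eqF.
rewrite /Rintegral (integral_density mZ (measurable_normal_pdf 0 (Num.sqrt v)) (normal_pdf_ge0 0 (Num.sqrt v)) PZ')//.
have v2 : 0 < (2 * v)^-1 by rewrite invr_gt0 mulr_gt0.
transitivity (\int[mu]_x ((Num.sqrt (2 * pi * v))^-1 * (g x * gaussf (2 * v)^-1 x))).
  congr fine; apply: eq_integral => x _; congr EFin.
  rewrite normal_pdf_gaussf// sqr_sqrtr ?ltW// subr0 mulrCA; congr ((Num.sqrt _)^-1 * _).
  by rewrite invrK; ring.
by rewrite RintegralZl//; exact: (integrable_gaussfM v2 mg gK).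
Qed.

Lemma measurable_cos_fun (X : T -> R) : measurable_fun setT X -> measurable_fun setT (fun w => cos (X w)).
Proof.
move=> mX; apply: (@measurableT_comp _ _ _ _ _ _ (@cos R)) => //.
by apply: continuous_measurable_fun; exact: continuous_cos.
Qed.

(** The phase th covers every centring xi (Z - z0). The Dirac case obeys the same formula, which
    spares later case distinctions on v. *)
Lemma normal_cos (Z : T -> R) (v xi th : R) : centered_normal P Z v ->
  \int[P]_w cos (xi * Z w + th) = cos th * expR (- (xi ^+ 2 * v / 2)).
Proof.
move=> nZ; have [mZ v0 PZ] := nZ.
have mc : measurable_fun [set: R] (fun x : R => cos (xi * x + th)).
  apply: continuous_measurable_fun => x.
  apply: (@continuous_comp _ _ _ (fun x => xi * x + th) (@cos R)); last exact: continuous_cos.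
  by apply: continuousD; [apply: continuousM; [exact: cvg_cst|exact: cvg_id]|exact: cvg_cst].
move: v0; rewrite le_eqVlt => /predU1P[v0|v0].
  rewrite -v0 in PZ *; rewrite mulr0 mul0r oppr0 expR0 mulr1.
  rewrite /Rintegral (@integral_dirac_law _ _ _ P Z 0 (fun x => cos (xi * x + th)) mZ _ mc) ?mulr0 ?add0r//.
  by move=> A mA; rewrite PZ// eqxx.
rewrite (normal_integral nZ v0 mc (K := 1)); last first.
  by move=> x; rewrite mul1r (le_trans (cos_max _))// lerDl sqr_ge0.
rewrite cos_gaussf ?invr_gt0 ?mulr_gt0// invrK.
have -> : pi * (2 * v) = 2 * pi * v by ring.
rewrite [cos th * _]mulrC !mulrA mulVf ?mul1r; last first.
  by rewrite gt_eqF// sqrtr_gt0 !mulr_gt0// pi_gt0.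
by congr (_ * expR (- _)); field; lra.
Qed.

(* exp(-c y^2) is a Gaussian average of cos(xi y): this trades a kernel in W for
   cosines of W. *)
Lemma kernel_Fubini (U W : T -> R) (K c w0 : R) : 0 < c -> 0 <= K ->
  measurable_fun setT U -> (forall w, `|U w| <= K) -> measurable_fun setT W ->
  \int[P]_w (U w * gaussf c (W w - w0)) =
  (Num.sqrt (pi * (4 * c)))^-1 *
    \int[mu]_xi ((\int[P]_w (U w * cos (xi * (W w - w0)))) * gaussf (4 * c)^-1 xi).
Proof.
move=> c0 K0 mU UK mW.
have c4 : 0 < (4 * c)^-1 by rewrite invr_gt0 mulr_gt0.
pose f (z : T * measurableTypeR R) : \bar R :=
  (U z.1 * cos ((z.2 : R) * (W z.1 - w0)) * gaussf (4 * c)^-1 z.2)%:E.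
have mf : measurable_fun setT f.
  apply/measurable_EFinP; apply: measurable_funM.
    apply: measurable_funM; first exact: measurableT_comp.
    apply: (@measurableT_comp _ _ _ _ _ _ (@cos R)).
      by apply: continuous_measurable_fun; exact: continuous_cos.
    apply: measurable_funM; first exact: measurable_snd.
    by apply: measurable_funB => //; exact: measurableT_comp.
  by apply: measurableT_comp; [exact: measurable_gaussf|exact: measurable_snd].
have fK w xi : `|U w * cos (xi * (W w - w0)) * gaussf (4 * c)^-1 xi| <= K * gaussf (4 * c)^-1 xi.
  rewrite normrM [`|gaussf _ _|]ger0_norm ?expR_ge0// ler_wpM2r ?expR_ge0// normrM.
  by rewrite -[K]mulr1; apply: ler_pM => //; exact: cos_max.
have mg : measurable_fun setT (fun z : T * measurableTypeR R => (K * gaussf (4 * c)^-1 z.2)%:E).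
  apply/measurable_EFinP; apply: measurable_funM => //.
  by apply: measurableT_comp; [exact: measurable_gaussf|exact: measurable_snd].
have gi : (P \x mu)%E.-integrable setT (fun z : T * measurableTypeR R => (K * gaussf (4 * c)^-1 z.2)%:E).
  apply/integrable12ltyP => //.
  rewrite (_ : (fun x => _) = (fun=> (K * Num.sqrt (pi / (4 * c)^-1))%:E)); last first.
    apply/funext => w /=; under eq_integral do rewrite ger0_norm ?mulr_ge0 ?expR_ge0//.
    under eq_integral do rewrite EFinM.
    rewrite ge0_integralZl//=; last 2 first.
      by apply/measurable_EFinP; exact: measurable_gaussf.
      by move=> x _; rewrite lee_fin expR_ge0.
    by rewrite integral_gaussf.
  by rewrite integral_cst//= probability_setT mule1 ltry.
have fi : (P \x mu)%E.-integrable setT f.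
  apply: (@le_integrable _ _ _ _ _ measurableT _ _ mf _ gi) => z _ /=.
  by rewrite lee_fin (le_trans (fK _ _))// ler_norm.
have E1 w : (\int[mu]_xi f (w, xi) = (Num.sqrt (pi * (4 * c)) * (U w * gaussf c (W w - w0)))%:E)%E.
  have ig : mu.-integrable setT (fun xi => (cos ((W w - w0) * xi + 0) * gaussf (4 * c)^-1 xi)%:E).
    apply: (@integrable_gaussfM _ _ 1) => //.
      apply: continuous_measurable_fun => x.
      apply: (@continuous_comp _ _ _ (fun x => (W w - w0) * x + 0) (@cos R)); last exact: continuous_cos.
      by apply: continuousD; [apply: continuousM; [exact: cvg_cst|exact: cvg_id]|exact: cvg_cst].
    by move=> x; rewrite mul1r (le_trans (cos_max _))// lerDl sqr_ge0.
  transitivity (\int[mu]_xi (U w * (cos ((W w - w0) * xi + 0) * gaussf (4 * c)^-1 xi))%:E)%E.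
    by apply: eq_integral => xi _; rewrite /f /= addr0 [xi * _]mulrC mulrA.
  rewrite EFin_Rintegral; last exact: (integrableZl measurableT (U w) ig).
  rewrite RintegralZl// cos_gaussf// cos0 mul1r invrK mulrCA; congr (_ * (_ * expR (- _)))%:E.
  by field; lra.
have E2 xi : (\int[P]_w f (w, xi) = ((\int[P]_w (U w * cos (xi * (W w - w0)))) * gaussf (4 * c)^-1 xi)%:E)%E.
  have iu : P.-integrable setT (EFin \o (fun w => U w * cos (xi * (W w - w0)))).
    apply: (@bounded_integrable _ K).
      apply: measurable_funM => //; apply: measurable_cos_fun.
      by apply: measurable_funM => //; exact: measurable_funB.
    by move=> w; rewrite normrM -[K]mulr1; apply: ler_pM => //; exact: cos_max.
  rewrite mulrC -RintegralZl// -EFin_Rintegral; last exact: (integrableZl measurableT _ iu).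
  by apply: eq_integral => w _; rewrite /f mulrC.
have := Fubini fi.
under eq_integral do rewrite E1.
under [in X in _ = X]eq_integral do rewrite E2.
move=> /(congr1 fine).
rewrite -[LHS]/(Rintegral P setT (fun w => Num.sqrt (pi * (4 * c)) * (U w * gaussf c (W w - w0)))) => h.
rewrite -[X in _ = _ * X]h RintegralZl//.
  by rewrite mulKf// gt_eqF// sqrtr_gt0 !mulr_gt0// pi_gt0.
apply: (@bounded_integrable _ K).
  apply: measurable_funM => //; apply: measurableT_comp; first exact: measurable_gaussf.
  exact: measurable_funB.
move=> w; rewrite normrM -[K]mulr1; apply: ler_pM => //.
by rewrite ger0_norm ?expR_ge0// -expR0 ler_expR oppr_le0 mulr_ge0 ?sqr_ge0 ?ltW.
Qed.

(** A product of cosines is half the sum of the cosines of the sum and of the difference. Both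
    involve combinations of the same variance, as b enters only through b^2, and this variance is a
    sum of a term in a and a term in b, so the exponential factors. *)
Lemma cos_product (X W : T -> R) (v1 v2 x w a b : R) :
  (forall a b, centered_normal P (fun t => a * X t + b * W t) (a ^+ 2 * v1 + b ^+ 2 * v2)) ->
  \int[P]_t (cos (a * (X t - x)) * cos (b * (W t - w))) =
  (\int[P]_t cos (a * (X t - x))) * (\int[P]_t cos (b * (W t - w))).
Proof.
move=> nXW.
have mXW a' b' : measurable_fun setT (fun t => a' * X t + b' * W t) by have [] := nXW a' b'.
have mc a' b' th : P.-integrable setT (EFin \o (fun t => cos (1 * (a' * X t + b' * W t) + th))).
  apply: (@bounded_integrable _ 1) => [|t]; last exact: cos_max.
  by apply: measurable_cos_fun; apply: measurable_funD => //; exact: measurable_funM.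
have c2 (p q : R) : cos p * cos q = 2^-1 * (cos (p + q) + cos (p - q)).
  by rewrite cosD cosB; field.
have -> : \int[P]_t (cos (a * (X t - x)) * cos (b * (W t - w))) =
    \int[P]_t (2^-1 * (cos (1 * (a * X t + b * W t) + (- (a * x + b * w))) +
                      cos (1 * (a * X t + (- b) * W t) + (- (a * x - b * w))))).
  apply: eq_Rintegral => t _; rewrite c2; congr (_ * (cos _ + cos _)); ring.
have -> : \int[P]_t cos (a * (X t - x)) = \int[P]_t cos (1 * (a * X t + 0 * W t) + (- (a * x))).
  by apply: eq_Rintegral => t _; congr cos; ring.
have -> : \int[P]_t cos (b * (W t - w)) = \int[P]_t cos (1 * (0 * X t + b * W t) + (- (b * w))).
  by apply: eq_Rintegral => t _; congr cos; ring.
rewrite RintegralZl//; last exact: (integrableD measurableT (mc _ _ _) (mc _ _ _)).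
rewrite (RintegralD measurableT (mc _ _ _) (mc _ _ _)).
rewrite !(normal_cos _ _ (nXW _ _)) !cosN expr1n !mul1r.
rewrite (_ : (- b) ^+ 2 = b ^+ 2); last by rewrite sqrrN.
rewrite expr0n/= !mul0r add0r addr0 -mulrDl mulrACA -expRD mulrA -c2; congr (_ * expR _).
by field.
Qed.

End kernel.

(** * Uncorrelated Gaussian pairs: boxes and tails *)

Section joint.
Context {d} {T : measurableType d} {R : realType} (P : probability T R).
Notation mu := (@lebesgue_measure R).

Lemma gaussf_le1 (c x : R) : 0 <= c -> gaussf c x <= 1.
Proof. by move=> c0; rewrite -expR0 ler_expR oppr_le0 mulr_ge0 ?sqr_ge0. Qed.

Lemma gaussf_ge0 (c x : R) : 0 <= gaussf c x.
Proof. exact: expR_ge0. Qed.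

Lemma measurable_gaussf_fun (c x : R) (W : T -> R) : measurable_fun setT W ->
  measurable_fun setT (fun w => gaussf c (W w - x)).
Proof.
by move=> mW; apply: measurableT_comp; [exact: measurable_gaussf|exact: measurable_funB].
Qed.

Lemma measurable_dist_le (X : T -> R) (x dl : R) : measurable_fun setT X ->
  measurable [set t | `|X t - x| <= dl].
Proof.
move=> mX; rewrite (_ : [set t | _] = X @^-1` `[x - dl, x + dl]%classic).
  by rewrite -[X in measurable X]setTI; apply: mX => //; exact: measurable_itv.
by apply/seteqP; split => t /=; rewrite in_itv/= ler_distl.
Qed.

Lemma measurable_norm_gt (W : T -> R) (la : R) : measurable_fun setT W ->
  measurable [set t | la < `|W t|].
Proof.
move=> mW; rewrite (_ : [set t | _] = ~` [set t | `|W t - 0| <= la]).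
  by apply: measurableC; exact: measurable_dist_le.
by apply/seteqP; split => t /=; rewrite subr0 ltNge; [move/negP|move=> /negP].
Qed.

Lemma prob_le_Rintegral (A : set T) (h : T -> R) : measurable A ->
  P.-integrable setT (EFin \o h) -> (forall w, 0 <= h w) -> (forall w, A w -> 1 <= h w) ->
  (P A <= (\int[P]_w h w)%:E)%E.
Proof.
move=> mA ih h0 hA; rewrite -EFin_Rintegral//.
have -> : (P A = \int[P]_w (\1_A w)%:E)%E by rewrite integral_indic// setIT.
have /integrableP[mh _] := ih.
apply: ge0_le_integral => //=.
- exact/measurable_EFinP/measurable_indic.
- move=> w _; rewrite lee_fin indicE; have [wA|wA] := boolP (w \in A); last exact: h0.
  by apply: hA; rewrite inE in wA.
Qed.

(** Computed on the frequency side, where the kernel and the law contribute Gaussian factors that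
    simply multiply; v = 0 needs no separate treatment. *)
Lemma normal_kernel (W : T -> R) (v c w0 : R) : 0 < c -> centered_normal P W v ->
  \int[P]_t gaussf c (W t - w0) =
  (Num.sqrt (1 + 2 * c * v))^-1 * expR (- (c * w0 ^+ 2 / (1 + 2 * c * v))).
Proof.
move=> c0 nW; have [mW v0 _] := nW.
have cv : 0 < 1 + 2 * c * v by rewrite ltr_pwDl// mulr_ge0// mulr_ge0// ltW.
transitivity (\int[P]_t (1 * gaussf c (W t - w0))).
  by apply: eq_Rintegral => t _; rewrite mul1r.
rewrite (@kernel_Fubini _ _ _ P (cst 1) W 1)//; last by move=> w; rewrite normr1.
have -> : \int[mu]_xi ((\int[P]_w (1 * cos (xi * (W w - w0)))) * gaussf (4 * c)^-1 xi) =
    \int[mu]_xi (cos (w0 * xi + 0) * gaussf ((1 + 2 * c * v) / (4 * c)) xi).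
  apply: eq_Rintegral => xi _.
  have -> : \int[P]_w (1 * cos (xi * (W w - w0))) = \int[P]_w cos (xi * W w + - (w0 * xi)).
    by apply: eq_Rintegral => w _; rewrite mul1r; congr cos; ring.
  rewrite (normal_cos _ _ nW) cosN addr0 -[LHS]mulrA /gaussf -expRD; congr (_ * expR _).
  by field; lra.
rewrite cos_gaussf ?divr_gt0 ?mulr_gt0// cos0 mul1r.
have -> : pi / ((1 + 2 * c * v) / (4 * c)) = pi * (4 * c) / (1 + 2 * c * v) :> R.
  by field; lra.
have pc : 0 < pi * (4 * c) :> R by rewrite !mulr_gt0// pi_gt0.
have -> : Num.sqrt (pi * (4 * c) / (1 + 2 * c * v)) =
    Num.sqrt (pi * (4 * c)) * (Num.sqrt (1 + 2 * c * v))^-1.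
  by rewrite sqrtrM ?(ltW pc)// sqrtrV// (ltW cv).
rewrite -[X in _ * X = _]mulrA mulKf ?gt_eqF ?sqrtr_gt0//.
by congr (_ * expR (- _)); field; lra.
Qed.

(** By [kernel_Fubini] the kernel in W is a mixture of cosines, so factoring against each cosine is
    enough. U is general because it is a kernel in X in one use and a cosine of W in the other. *)
Lemma kernel_indep (U W : T -> R) (K v c w0 : R) : 0 < c -> 0 <= K ->
  measurable_fun setT U -> (forall w, `|U w| <= K) -> centered_normal P W v ->
  (forall xi, \int[P]_t (U t * cos (xi * (W t - w0))) =
     (\int[P]_t U t) * (\int[P]_t cos (xi * (W t - w0)))) ->
  \int[P]_t (U t * gaussf c (W t - w0)) = (\int[P]_t U t) * \int[P]_t gaussf c (W t - w0).
Proof.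
move=> c0 K0 mU UK nW UW; have [mW v0 _] := nW.
have cv : 0 < 1 + 2 * c * v by rewrite ltr_pwDl// mulr_ge0// mulr_ge0// ltW.
(* Applied to U and to the constant 1, both bounded by K + 1; the two values differ only by the
   factor k. *)
have E (V : T -> R) (k : R) : measurable_fun setT V -> (forall w, `|V w| <= K + 1) ->
    (forall xi, \int[P]_t (V t * cos (xi * (W t - w0))) = k * (\int[P]_t cos (xi * (W t - w0)))) ->
    \int[P]_t (V t * gaussf c (W t - w0)) = k * ((Num.sqrt (pi * (4 * c)))^-1 *
    \int[mu]_xi (cos (w0 * xi + 0) * gaussf ((1 + 2 * c * v) / (4 * c)) xi)).
  move=> mV VK VW; rewrite (@kernel_Fubini _ _ _ P V W (K + 1))// ?addr_ge0//.
  rewrite [RHS]mulrCA; congr (_ * _); rewrite -RintegralZl//; last first.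
    apply: (@integrable_gaussfM _ _ 1) => //; first by rewrite divr_gt0// mulr_gt0.
      apply: continuous_measurable_fun => x.
      apply: (@continuous_comp _ _ _ (fun x => w0 * x + 0) (@cos R)); last exact: continuous_cos.
      by apply: continuousD; [apply: continuousM; [exact: cvg_cst|exact: cvg_id]|exact: cvg_cst].
    by move=> x; rewrite mul1r (le_trans (cos_max _))// lerDl sqr_ge0.
  apply: eq_Rintegral => xi _; rewrite VW.
  have -> : \int[P]_w (cos (xi * (W w - w0))) = \int[P]_w cos (xi * W w + - (w0 * xi)).
    by apply: eq_Rintegral => w _; congr cos; ring.
  rewrite (normal_cos _ _ nW) cosN addr0 -[LHS]mulrA; congr (_ * _); rewrite -[LHS]mulrA /gaussf -expRD; congr (_ * expR _).
  by field; lra.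
rewrite (E U (\int[P]_t U t))//; last by move=> w; rewrite (le_trans (UK w))// lerDl.
congr (_ * _); rewrite -[LHS]mul1r -(E (cst 1) 1)//.
- by apply: eq_Rintegral => t _; rewrite mul1r.
- by move=> w; rewrite normr1 lerDr.
- by move=> xi; rewrite mul1r; apply: eq_Rintegral => t _; rewrite mul1r.
Qed.

Lemma normal_kernel_le (W : T -> R) (v s w : R) : 0 < s -> 0 < v -> centered_normal P W v ->
  \int[P]_t gaussf (2 * s ^+ 2)^-1 (W t - w) <=
  s / Num.sqrt v * expR (- (w ^+ 2 / (2 * (s ^+ 2 + v)))).
Proof.
move=> s0 v0 nW; have s20 : 0 < s ^+ 2 by rewrite exprn_gt0.
have c0 : 0 < (2 * s ^+ 2)^-1 by rewrite invr_gt0 mulr_gt0.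
rewrite (normal_kernel _ c0 nW).
have -> : (2 * s ^+ 2)^-1 * w ^+ 2 / (1 + 2 * (2 * s ^+ 2)^-1 * v) = w ^+ 2 / (2 * (s ^+ 2 + v)).
  by field; rewrite !gt_eqF// addr_gt0.
rewrite ler_pM2r ?expR_gt0//.
have -> : s / Num.sqrt v = (Num.sqrt (v / s ^+ 2))^-1.
  by rewrite sqrtrM ?(ltW v0)// sqrtrV ?(ltW s20)// sqrtr_sqr gtr0_norm// invfM invrK mulrC.
have -> : 2 * (2 * s ^+ 2)^-1 * v = v / s ^+ 2 by field; rewrite gt_eqF.
have vs : 0 < v / s ^+ 2 by rewrite divr_gt0.
by rewrite lef_pV2 ?posrE ?sqrtr_gt0 ?ltr_wpDl// ler_wsqrtr// lerDr.
Qed.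

Lemma normal_kernel_le1 (W : T -> R) (v s w : R) : 0 < s -> 0 < v -> centered_normal P W v ->
  \int[P]_t gaussf (2 * s ^+ 2)^-1 (W t - w) <= s / Num.sqrt v.
Proof.
move=> s0 v0 nW; apply: le_trans (normal_kernel_le w s0 v0 nW) _.
rewrite ler_piMr ?divr_ge0 ?sqrtr_ge0 ?(ltW s0)// -[leRHS]expR0 ler_expR oppr_le0.
by rewrite divr_ge0 ?sqr_ge0// mulr_ge0// addr_ge0 ?sqr_ge0// ltW.
Qed.

Variables (X W : T -> R) (v1 v2 : R).
Hypothesis nXW : forall a b,
  centered_normal P (fun t => a * X t + b * W t) (a ^+ 2 * v1 + b ^+ 2 * v2).

Let nX : centered_normal P X v1.
Proof.
have := nXW 1 0; rewrite expr1n expr0n/= mul1r mul0r addr0.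
by congr centered_normal; apply/funext => t; rewrite mul1r mul0r addr0.
Qed.

Let nW : centered_normal P W v2.
Proof.
have := nXW 0 1; rewrite expr1n expr0n/= mul1r mul0r add0r.
by congr centered_normal; apply/funext => t; rewrite mul1r mul0r add0r.
Qed.

(** Cosines are replaced by kernels one variable at a time, with [cos_product] at the bottom. *)
Lemma joint_kernel (c c' x w : R) : 0 < c -> 0 < c' ->
  \int[P]_t (gaussf c (X t - x) * gaussf c' (W t - w)) =
  (\int[P]_t gaussf c (X t - x)) * (\int[P]_t gaussf c' (W t - w)).
Proof.
move=> c0 c'0; have [mX _ _] := nX; have [mW _ _] := nW.
apply: (@kernel_indep _ _ 1 v2) => //; first exact: measurable_gaussf_fun.
  by move=> t; rewrite ger0_norm ?gaussf_ge0// gaussf_le1// ltW.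
move=> xi.
have -> : \int[P]_t (gaussf c (X t - x) * cos (xi * (W t - w))) =
   \int[P]_t (cos (xi * (W t - w)) * gaussf c (X t - x)).
  by apply: eq_Rintegral => t _; rewrite mulrC.
rewrite mulrC; apply: (@kernel_indep _ _ 1 v1) => //.
- by apply: measurable_cos_fun; apply: measurable_funM => //; exact: measurable_funB.
- by move=> t; exact: cos_max.
move=> z; rewrite mulrC -(cos_product _ _ _ _ nXW).
by apply: eq_Rintegral => t _; rewrite mulrC.
Qed.

(** At |u| = dl the exponent is 1/2, and the factor 2 comes from exp (- 1/2) >= 1/2. *)
Lemma gaussf_box (dl u : R) : 0 < dl -> `|u| <= dl -> 1 <= 2 * gaussf (2 * dl ^+ 2)^-1 u.
Proof.
move=> d0 ud.
have h : (2 : R)^-1 <= gaussf (2 * dl ^+ 2)^-1 u.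
  apply: (@le_trans _ _ (expR (- 2^-1))).
    by apply: le_trans (expR_ge1Dx _); lra.
  rewrite ler_expR lerN2 -(real_normK (num_real u)) invfM -mulrA ler_piMr//.
  by rewrite mulrC ler_pdivrMr ?exprn_gt0// mul1r lerXn2r// nnegrE// ltW.
by rewrite -ler_pdivrMl// mulr1.
Qed.

(** The exponential is kept for W only: W will be a regression residual, whose decay away from 0 is
    what makes the sum over cubes converge. *)
Lemma box_le (dl ep x w : R) : 0 < dl -> 0 < ep -> 0 < v1 -> 0 < v2 ->
  (P [set t | (`|X t - x| <= dl)%R /\ (`|W t - w| <= ep)%R] <=
   (4 * (dl / Num.sqrt v1) * ((ep / Num.sqrt v2) *
      expR (- (w ^+ 2 / (2 * (ep ^+ 2 + v2))))))%:E)%E.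
Proof.
move=> d0 e0 v10 v20; have [mX _ _] := nX; have [mW _ _] := nW.
set c := (2 * dl ^+ 2)^-1; set c' := (2 * ep ^+ 2)^-1.
have c0 : 0 < c by rewrite invr_gt0 mulr_gt0// exprn_gt0.
have c'0 : 0 < c' by rewrite invr_gt0 mulr_gt0// exprn_gt0.
have mA : measurable [set t | `|X t - x| <= dl /\ `|W t - w| <= ep].
  by apply: measurableI; exact: measurable_dist_le.
have ig : P.-integrable setT (EFin \o (fun t => gaussf c (X t - x) * gaussf c' (W t - w))).
  apply: (@bounded_integrable _ _ _ _ _ 1).
    by apply: measurable_funM; exact: measurable_gaussf_fun.
  move=> t; rewrite normrM !ger0_norm ?gaussf_ge0//.
  by rewrite -[leRHS]mulr1 ler_pM ?gaussf_ge0 ?gaussf_le1 ?ltW.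
apply: le_trans (@prob_le_Rintegral _ (fun t => 4 * (gaussf c (X t - x) * gaussf c' (W t - w))) mA _ _ _) _.
- exact: (integrableZl measurableT 4 ig).
- by move=> t; rewrite !mulr_ge0 ?gaussf_ge0.
- move=> t [Xt Wt].
  have := gaussf_box d0 Xt; have := gaussf_box e0 Wt; rewrite -/c -/c'; nra.
rewrite lee_fin RintegralZl// joint_kernel// -[leRHS]mulrA ler_wpM2l//.
apply: ler_pM.
- by rewrite Rintegral_ge0// => t _; exact: gaussf_ge0.
- by rewrite Rintegral_ge0// => t _; exact: gaussf_ge0.
- exact: normal_kernel_le1 nX.
- exact: normal_kernel_le nW.
Qed.

(** Kernels in the same variable multiply to a kernel, so (1 - k)^(m + 1) k0 = (1 - k)^m k0 - (1 -
    k)^m k k0 reduces m + 1 to m with c0 or c0 + c' as last exponent. Hence the general c0, which is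
    0 in the application. *)
Lemma kernel_tail_indep (m : nat) (c c' c0 x : R) : 0 < c -> 0 < c' -> 0 <= c0 ->
  \int[P]_t (gaussf c (X t - x) * ((1 - gaussf c' (W t)) ^+ m * gaussf c0 (W t))) =
  (\int[P]_t gaussf c (X t - x)) * (\int[P]_t ((1 - gaussf c' (W t)) ^+ m * gaussf c0 (W t))).
Proof.
move=> cp c'p; have [mX _ _] := nX; have [mW _ _] := nW.
have mg a : measurable_fun setT (fun t => gaussf a (W t)).
  by apply: measurableT_comp => //; exact: measurable_gaussf.
have c'1 t : 0 <= 1 - gaussf c' (W t) <= 1.
  by rewrite subr_ge0 gaussf_le1 ?(ltW c'p)//= gerBl gaussf_ge0.
have b1 n a t : 0 <= a -> `|(1 - gaussf c' (W t)) ^+ n * gaussf a (W t)| <= 1.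
  move=> a0; have /andP[h0 h1] := c'1 t.
  rewrite ger0_norm ?mulr_ge0 ?gaussf_ge0 ?exprn_ge0//.
  by rewrite -[leRHS]mulr1 ler_pM ?gaussf_ge0 ?exprn_ge0 ?exprn_ile1 ?gaussf_le1.
have mb n a : measurable_fun setT (fun t => (1 - gaussf c' (W t)) ^+ n * gaussf a (W t)).
  by apply: measurable_funM => //; apply: measurable_funX; exact: measurable_funB.
have ib n a : 0 <= a -> P.-integrable setT (EFin \o (fun t => (1 - gaussf c' (W t)) ^+ n * gaussf a (W t))).
  by move=> a0; apply: (@bounded_integrable _ _ _ _ _ 1) => // t; exact: b1.
have ixb n a : 0 <= a -> P.-integrable setT (EFin \o (fun t => gaussf c (X t - x) * ((1 - gaussf c' (W t)) ^+ n * gaussf a (W t)))).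
  move=> a0; apply: (@bounded_integrable _ _ _ _ _ 1).
    by apply: measurable_funM => //; exact: measurable_gaussf_fun.
  move=> t; rewrite normrM -[leRHS]mulr1 ler_pM ?b1//.
  by rewrite ger0_norm ?gaussf_ge0 ?gaussf_le1 ?ltW.
elim: m c0 => [|m IH] c0 c00.
  move: c00; rewrite le_eqVlt => /predU1P[<-|c00].
    have g0 t : gaussf 0 (W t) = 1 by rewrite /gaussf mul0r oppr0 expR0.
    under eq_Rintegral do rewrite expr0 mul1r g0 mulr1.
    under [X in _ = _ * X]eq_Rintegral do rewrite expr0 mul1r g0.
    by rewrite Rintegral_probability_cst mulr1.
  have := @joint_kernel c c0 x 0 cp c00.
  under eq_Rintegral do rewrite subr0.
  under [X in _ = _ * X -> _]eq_Rintegral do rewrite subr0.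
  move=> h.
  under eq_Rintegral do rewrite expr0 mul1r.
  by under [X in _ = _ * X]eq_Rintegral do rewrite expr0 mul1r.
have gM t : (1 - gaussf c' (W t)) ^+ m.+1 * gaussf c0 (W t) =
    (1 - gaussf c' (W t)) ^+ m * gaussf c0 (W t) - (1 - gaussf c' (W t)) ^+ m * gaussf (c0 + c') (W t).
  have -> : gaussf (c0 + c') (W t) = gaussf c0 (W t) * gaussf c' (W t).
    by rewrite /gaussf -expRD; congr expR; ring.
  by rewrite exprS; ring.
have c0' : 0 <= c0 + c' by rewrite addr_ge0// ltW.
under eq_Rintegral do rewrite gM mulrBr.
under [X in _ = _ * X]eq_Rintegral do rewrite gM.
rewrite (RintegralB measurableT (ixb m _ c00) (ixb m _ c0')).
by rewrite (RintegralB measurableT (ib m _ c00) (ib m _ c0')) !IH// mulrBr.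
Qed.

(** High moments of W are not computed: 1 - exp (- c x^2) <= c x^2, and half of the Gaussian
    exponent absorbs the m-th power of this quadratic. *)
Lemma kernel_tail_le (m : nat) (la : R) : 0 < la -> (0 < m)%N ->
  \int[P]_t (1 - gaussf (2 * la ^+ 2)^-1 (W t)) ^+ m <=
   2 * (m%:R * 2) ^+ m * (v2 / la ^+ 2) ^+ m.
Proof.
move=> l0 m0; have [mW v20 PW] := nW.
set c := (2 * la ^+ 2)^-1.
have c0 : 0 < c by rewrite invr_gt0 mulr_gt0// exprn_gt0.
have g1 x : 0 <= 1 - gaussf c x <= 1.
  by rewrite subr_ge0 gaussf_le1 ?(ltW c0)//= gerBl gaussf_ge0.
have cg : continuous (fun x : R => (1 - gaussf c x) ^+ m).
  move=> x; apply: (@continuous_comp _ _ _ (fun x : R => 1 - gaussf c x) (fun x => x ^+ m)); last exact: exprn_continuous.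
  by apply: continuousB; [exact: cvg_cst|exact: continuous_gaussf].
have mg := continuous_measurable_fun cg.
move: v20; rewrite le_eqVlt => /predU1P[v20|v20].
  rewrite /Rintegral (@integral_dirac_law _ _ _ P W 0 (fun x => (1 - gaussf c x) ^+ m) mW _ mg); last first.
    by move=> A mA; rewrite PW// -v20 eqxx.
  by rewrite /= /gaussf expr0n/= mulr0 oppr0 expR0 subrr -v20 mul0r expr0n gtn_eqF// mulr0.
have gb x : `|(1 - gaussf c x) ^+ m| <= 1 * (1 + x ^+ 2).
  have /andP[h0 h1] := g1 x.
  rewrite mul1r ger0_norm ?exprn_ge0// (@le_trans _ _ 1)// ?exprn_ile1// lerDl sqr_ge0//.
have i2 : 0 < (2 * v2)^-1 by rewrite invr_gt0 mulr_gt0.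
have i4 : 0 < (4 * v2)^-1 by rewrite invr_gt0 mulr_gt0.
rewrite (normal_integral nW v20 mg gb).
have pv : 0 < Num.sqrt (2 * pi * v2) :> R by rewrite sqrtr_gt0 !mulr_gt0// pi_gt0.
rewrite ler_pdivrMl//.
apply: (@le_trans _ _ (\int[mu]_x (((m%:R * 2) ^+ m * (v2 / la ^+ 2) ^+ m) * gaussf (4 * v2)^-1 x))).
  apply: le_Rintegral => //.
  - exact: (integrable_gaussfM i2 mg gb).
  - exact: (integrableZl measurableT _ (integrable_gaussf i4)).
  - move=> x _; have -> : gaussf (2 * v2)^-1 x = gaussf (4 * v2)^-1 x * gaussf (4 * v2)^-1 x.
      by rewrite /gaussf -expRD; congr expR; field; rewrite gt_eqF.
    rewrite mulrA ler_pM2r ?expR_gt0// -exprMn.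
    (* That half is spread over the m factors, so that u exp (- u) <= 1 applies to each; expressing
       c x^2 through u produces 2 m v2 / la^2. *)
    have E : gaussf (4 * v2)^-1 x = expR (- (x ^+ 2 / (4 * v2) / m%:R)) ^+ m.
      rewrite -expRM_natl /gaussf; congr expR; field.
      by rewrite pnatr_eq0 -lt0n m0 gt_eqF.
    rewrite E -exprMn; apply: lerXn2r; rewrite ?nnegrE.
    + by rewrite mulr_ge0 ?expR_ge0//; have /andP[] := g1 x.
    + by rewrite !mulr_ge0// ?invr_ge0 ?sqr_ge0// ltW.
    set u := x ^+ 2 / (4 * v2) / m%:R.
    have u0 : 0 <= u by rewrite !divr_ge0 ?sqr_ge0 ?mulr_ge0 ?ler0n// ltW.
    have e1 : 1 - gaussf c x <= c * x ^+ 2.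
      by have := expR_ge1Dx (- (c * x ^+ 2)); rewrite /gaussf; lra.
    have e2 : c * x ^+ 2 = m%:R * 2 * (v2 / la ^+ 2) * u.
      rewrite /c /u; field.
      by rewrite pnatr_eq0 -lt0n m0 !gt_eqF.
    rewrite expRN ler_pdivrMr ?expR_gt0//; apply: (le_trans e1); rewrite e2.
    rewrite ler_wpM2l//; first by rewrite !mulr_ge0// ?invr_ge0 ?sqr_ge0// ltW.
    by apply: le_trans (expR_ge1Dx _); rewrite lerDr.
rewrite RintegralZl//; last exact: integrable_gaussf.
rewrite Rintegral_gaussf// invrK.
(* The surviving half of the exponent has doubled variance, which costs sqrt 2, bounded by 2. *)
have -> : pi * (4 * v2) = 2 * (2 * pi * v2) :> R by ring.
set A := (m%:R * 2) ^+ m; set B := (v2 / la ^+ 2) ^+ m.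
have A0 : 0 <= A by rewrite exprn_ge0// mulr_ge0.
have B0 : 0 <= B by rewrite exprn_ge0// divr_ge0 ?sqr_ge0// ltW.
have -> : Num.sqrt (2 * pi * v2) * (2 * A * B) = A * B * (2 * Num.sqrt (2 * pi * v2)) by ring.
rewrite ler_wpM2l ?mulr_ge0// sqrtrM// ler_pM2r//.
by rewrite -(@ler_pXn2r _ 2)// ?nnegrE ?sqrtr_ge0// sqr_sqrtr// expr2; lra.
Qed.

(** Beyond la the kernel is at most exp (- 1/2) <= 2/3, hence the factor 3. *)
Lemma gaussf_tail (la u : R) : 0 < la -> la < `|u| -> 1 <= 3 * (1 - gaussf (2 * la ^+ 2)^-1 u).
Proof.
move=> l0 ul.
have h : gaussf (2 * la ^+ 2)^-1 u <= 2 / 3.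
  apply: (@le_trans _ _ (expR (- 2^-1))).
    rewrite ler_expR lerN2 -(real_normK (num_real u)) invfM -mulrA ler_peMr//.
    by rewrite mulrC ler_pdivlMr ?exprn_gt0// mul1r ler_pXn2r ?nnegrE ?(ltW l0) ?(ltW ul).
  rewrite expRN; have := expR_ge1Dx (2^-1 : R) => h.
  by rewrite -[leLHS]mul1r ler_pdivrMr ?expR_gt0//; lra.
lra.
Qed.

Lemma tail_le (m : nat) (la : R) : 0 < la -> (0 < m)%N ->
  (P [set t | (la < `|W t|)%R] <= (2 * (m%:R * 6) ^+ m * (v2 / la ^+ 2) ^+ m)%:E)%E.
Proof.
move=> l0 m0; have [mW v20 PW] := nW.
have c0 : 0 < (2 * la ^+ 2)^-1 by rewrite invr_gt0 mulr_gt0// exprn_gt0.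
have mA : measurable [set t | la < `|W t|].
  exact: measurable_norm_gt.
have g1 t : 0 <= 1 - gaussf (2 * la ^+ 2)^-1 (W t) <= 1.
  by rewrite subr_ge0 gaussf_le1 ?(ltW c0)//= gerBl gaussf_ge0.
have ig : P.-integrable setT (EFin \o (fun t => (1 - gaussf (2 * la ^+ 2)^-1 (W t)) ^+ m)).
  apply: (@bounded_integrable _ _ _ _ _ 1).
    apply: measurable_funX; apply: measurable_funB => //.
    by apply: measurableT_comp => //; exact: measurable_gaussf.
  by move=> t; have /andP[h0 h1] := g1 t; rewrite ger0_norm ?exprn_ge0// exprn_ile1.
apply: le_trans (@prob_le_Rintegral _ (fun t => 3 ^+ m * (1 - gaussf (2 * la ^+ 2)^-1 (W t)) ^+ m) mA _ _ _) _.
- exact: (integrableZl measurableT _ ig).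
- by move=> t; have /andP[h0 h1] := g1 t; rewrite mulr_ge0 ?exprn_ge0.
- by move=> t Wt; rewrite -exprMn exprn_ege1// gaussf_tail.
rewrite lee_fin RintegralZl//.
apply: le_trans (ler_wpM2l _ (kernel_tail_le l0 m0)) _; first by rewrite exprn_ge0.
rewrite (_ : m%:R * 6 = 3 * (m%:R * 2)); last by ring.
by rewrite [(3 * _) ^+ m]exprMn le_eqVlt; apply/orP; left; apply/eqP; ring.
Qed.

Lemma box_tail_le (m : nat) (dl x la : R) : 0 < dl -> 0 < la -> 0 < v1 -> (0 < m)%N ->
  (P [set t | (`|X t - x| <= dl)%R /\ (la < `|W t|)%R] <=
   (4 * (m%:R * 6) ^+ m * (dl / Num.sqrt v1) * (v2 / la ^+ 2) ^+ m)%:E)%E.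
Proof.
move=> d0 l0 v10 m0; have [mX _ _] := nX; have [mW v20 _] := nW.
set c := (2 * dl ^+ 2)^-1; set c' := (2 * la ^+ 2)^-1.
have c0 : 0 < c by rewrite invr_gt0 mulr_gt0// exprn_gt0.
have c'0 : 0 < c' by rewrite invr_gt0 mulr_gt0// exprn_gt0.
have mA : measurable [set t | `|X t - x| <= dl /\ la < `|W t|].
  apply: measurableI; first exact: measurable_dist_le.
  exact: measurable_norm_gt.
have g1 t : 0 <= 1 - gaussf c' (W t) <= 1.
  by rewrite subr_ge0 gaussf_le1 ?(ltW c'0)//= gerBl gaussf_ge0.
have ig : P.-integrable setT (EFin \o (fun t => gaussf c (X t - x) * (1 - gaussf c' (W t)) ^+ m)).
  apply: (@bounded_integrable _ _ _ _ _ 1).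
    apply: measurable_funM; first exact: measurable_gaussf_fun.
    apply: measurable_funX; apply: measurable_funB => //.
    by apply: measurableT_comp => //; exact: measurable_gaussf.
  move=> t; have /andP[h0 h1] := g1 t; rewrite ger0_norm ?mulr_ge0 ?exprn_ge0 ?gaussf_ge0//.
  by rewrite -[leRHS]mulr1 ler_pM ?gaussf_ge0 ?exprn_ge0 ?exprn_ile1 ?gaussf_le1 ?(ltW c0).
apply: le_trans (@prob_le_Rintegral _ (fun t => 2 * 3 ^+ m * (gaussf c (X t - x) * (1 - gaussf c' (W t)) ^+ m)) mA _ _ _) _.
- exact: (integrableZl measurableT _ ig).
- by move=> t; have /andP[h0 h1] := g1 t; do !apply: mulr_ge0; rewrite ?exprn_ge0 ?gaussf_ge0.
- move=> t [Xt Wt]; rewrite mulrACA -exprMn.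
  rewrite -[leLHS]mulr1; apply: ler_pM => //; first exact: gaussf_box.
  by rewrite exprn_ege1// gaussf_tail.
rewrite lee_fin RintegralZl//.
have := @kernel_tail_indep m c c' 0 x c0 c'0 (lexx 0).
have g0 t : gaussf 0 (W t) = 1 by rewrite /gaussf mul0r oppr0 expR0.
under eq_Rintegral do rewrite g0 mulr1.
under [X in _ = _ * X -> _]eq_Rintegral do rewrite g0 mulr1.
move=> ->.
have h1 := kernel_tail_le l0 m0; rewrite -/c' in h1.
have h2 : \int[P]_t gaussf c (X t - x) <= dl / Num.sqrt v1 by exact: normal_kernel_le1 nX.
apply: (@le_trans _ _ (2 * 3 ^+ m * ((dl / Num.sqrt v1) * (2 * (m%:R * 2) ^+ m * (v2 / la ^+ 2) ^+ m)))).
  rewrite ler_wpM2l ?mulr_ge0 ?exprn_ge0//; apply: ler_pM => //.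
    by rewrite Rintegral_ge0// => t _; exact: gaussf_ge0.
  by rewrite Rintegral_ge0// => t _; have /andP[? ?] := g1 t; rewrite exprn_ge0.
rewrite (_ : m%:R * 6 = 3 * (m%:R * 2)); last by ring.
by rewrite [(3 * _) ^+ m]exprMn le_eqVlt; apply/orP; left; apply/eqP; ring.
Qed.

Lemma normal_box_le (dl x : R) : 0 < dl -> 0 < v1 ->
  (P [set t | (`|X t - x| <= dl)%R] <= (2 * (dl / Num.sqrt v1))%:E)%E.
Proof.
move=> d0 v10; have [mX _ _] := nX.
have c0 : 0 < (2 * dl ^+ 2)^-1 by rewrite invr_gt0 mulr_gt0// exprn_gt0.
have ig : P.-integrable setT (EFin \o (fun t => gaussf (2 * dl ^+ 2)^-1 (X t - x))).
  apply: (@bounded_integrable _ _ _ _ _ 1); first exact: measurable_gaussf_fun.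
  by move=> t; rewrite ger0_norm ?gaussf_ge0// gaussf_le1// ltW.
apply: le_trans (@prob_le_Rintegral _ (fun t => 2 * gaussf (2 * dl ^+ 2)^-1 (X t - x)) _ _ _ _) _.
- exact: measurable_dist_le.
- exact: (integrableZl measurableT _ ig).
- by move=> t; rewrite mulr_ge0 ?gaussf_ge0.
- by move=> t Xt; exact: gaussf_box.
by rewrite lee_fin RintegralZl// ler_wpM2l//; exact: normal_kernel_le1 nX.
Qed.

End joint.

(** * Fractional Brownian motion *)

Section fbm_law.
Context {d} {T : measurableType d} {R : realType} (P : probability T R).

Definition fbm_cov (H s t : R) : R :=
  2^-1 * (`|t| `^ (2 * H) + `|s| `^ (2 * H) - `|t - s| `^ (2 * H)).

(** The covariance formula at s = t makes the second moments finite, hence all products integrable,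
    so the variance of a combination can be expanded. *)
Lemma fbm_linear_comb (H : R) (X : R -> T -> R) (n : nat) (t c : 'I_n -> R) :
  fbm P H X -> (forall i, 0 <= t i <= 1) ->
  centered_normal P (fun w => \sum_(i < n) c i * X (t i) w)
    (\sum_(i < n) \sum_(j < n) c i * c j * fbm_cov H (t i) (t j)).
Proof.
move=> [mX gX EX covX _] t01.
have tI i : `[0, 1]%classic (t i) by rewrite /= in_itv/= t01.
have EX0 i : (\int[P]_w (X (t i) w)%:E = 0)%E by have := EX _ (tI i); rewrite unlock.
have cXX i j : (\int[P]_w (X (t i) w * X (t j) w)%:E = (fbm_cov H (t i) (t j))%:E)%E.
  rewrite -(covX _ _ (tI i) (tI j)) covariance.unlock (EX _ (tI i)) (EX _ (tI j)).
  by rewrite expectation.unlock; apply: eq_integral => w _; congr EFin;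
  by transitivity ((X (t i) w - 0) * (X (t j) w - 0)); first by rewrite !subr0.
have iX2 i : P.-integrable setT (EFin \o (fun w => X (t i) w ^+ 2)).
  apply/integrableP; split.
    by apply/measurable_EFinP; apply: measurable_funX; exact: mX.
  under eq_integral do rewrite /= ger0_norm ?sqr_ge0// expr2.
  by rewrite cXX ltry.
have i1 : P.-integrable setT (EFin \o (fun w => (1 : R))) by exact: finite_measure_integrable_cst.
have iX i : P.-integrable setT (EFin \o X (t i)).
  apply: (@le_integrable _ _ _ P _ measurableT _ (fun w => (1 + X (t i) w ^+ 2)%:E)).
  - by apply/measurable_EFinP; exact: mX.
  - move=> w _ /=; rewrite lee_fin [leRHS]ger0_norm ?addr_ge0 ?sqr_ge0//.
    rewrite -(real_normK (num_real (X (t i) w))).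
    by have := sqr_ge0 (`|X (t i) w| - 1); have := normr_ge0 (X (t i) w); nra.
  - exact: (integrableD measurableT i1 (iX2 i)).
have iXX i j : P.-integrable setT (EFin \o (fun w => X (t i) w * X (t j) w)).
  apply: (@le_integrable _ _ _ P _ measurableT _ (fun w => (X (t i) w ^+ 2 + X (t j) w ^+ 2)%:E)).
  - by apply/measurable_EFinP; apply: measurable_funM; exact: mX.
  - move=> w _ /=; rewrite lee_fin [leRHS]ger0_norm ?addr_ge0 ?sqr_ge0// normrM.
    rewrite -(real_normK (num_real (X (t i) w))) -(real_normK (num_real (X (t j) w))).
    have := sqr_ge0 (`|X (t i) w| - `|X (t j) w|).
    have := normr_ge0 (X (t i) w); have := normr_ge0 (X (t j) w); nra.
  - exact: (integrableD measurableT (iX2 i) (iX2 j)).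
apply: gaussian_normal_law.
- by apply: measurable_sum => i; apply: measurable_funM => //; exact: mX.
- exact: gX.
- under eq_integral do rewrite -sumEFin.
  rewrite integral_sum//=; last by move=> i; exact: (integrableZl measurableT (c i) (iX i)).
  rewrite big1// => i _.
  under eq_integral do rewrite EFinM.
  by rewrite integralZl// ?EX0 ?mule0//; exact: iX.
- transitivity (\int[P]_w (\sum_(i < n) \sum_(j < n) (c i * c j * (X (t i) w * X (t j) w))%:E))%E.
    apply: eq_integral => w _; rewrite expr2 big_distrlr/= -sumEFin; apply: eq_bigr => i _.
    by rewrite -sumEFin; apply: eq_bigr => j _; congr EFin; ring.
  have ic i j : P.-integrable setT (fun w => (c i * c j * (X (t i) w * X (t j) w))%:E).
    exact: (integrableZl measurableT (c i * c j) (iXX i j)).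
  rewrite integral_sum//=; last by move=> i; exact: integrable_sum.
  rewrite -sumEFin; apply: eq_bigr => i _.
  rewrite integral_sum//= -sumEFin; apply: eq_bigr => j _.
  under eq_integral do rewrite EFinM.
  by rewrite integralZl ?cXX//; exact: iXX.
Qed.

(** Three times cover both uses: two values of the process, and a value together with an
    increment. *)
Lemma fbm_comb3 (H : R) (X : R -> T -> R) (p u v a b c : R) :
  fbm P H X -> 0 <= p <= 1 -> 0 <= u <= 1 -> 0 <= v <= 1 ->
  centered_normal P (fun w => a * X p w + b * X u w + c * X v w)
    (a ^+ 2 * fbm_cov H p p + b ^+ 2 * fbm_cov H u u + c ^+ 2 * fbm_cov H v v +
     2 * a * b * fbm_cov H p u + 2 * a * c * fbm_cov H p v + 2 * b * c * fbm_cov H u v).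
Proof.
move=> fX p01 u01 v01.
have := @fbm_linear_comb H X 3 (fun i => nth 0 [:: p; u; v] i) (fun i => nth 0 [:: a; b; c] i) fX.
have h : forall i : 'I_3, 0 <= nth 0 [:: p; u; v] i <= 1 by case=> [[|[|[|]]]].
move=> /(_ h).
have covC s t : fbm_cov H s t = fbm_cov H t s.
  by rewrite /fbm_cov [`|t - s|]distrC [`|t| `^ _ + _]addrC.
congr centered_normal.
  by apply/funext => w; rewrite !big_ord_recl big_ord0/= addr0 addrA.
rewrite !big_ord_recl !big_ord0/= (covC u p) (covC v p) (covC v u); ring.
Qed.

Lemma measurable_fbm (H t : R) (X : R -> T -> R) : fbm P H X -> 0 <= t <= 1 ->
  measurable_fun setT (X t).
Proof. by move=> [mX _ _ _ _] t01; apply: mX; rewrite /= in_itv. Qed.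

End fbm_law.

(** * Regression of one Gaussian variable on another *)

Section residual.
Context {d} {T : measurableType d} {R : realType} (P : probability T R).
Variables (X V : T -> R) (vx vv c : R).
Hypothesis vx0 : 0 < vx.
Hypothesis nXV : forall a b,
  centered_normal P (fun t => a * X t + b * V t) (a ^+ 2 * vx + 2 * a * b * c + b ^+ 2 * vv).

(** The coefficient c / vx is the one that removes the term in a b from the variance, which is the
    form asked of the pairs above. *)
Lemma residual_indep a b :
  centered_normal P (fun t => a * X t + b * (V t - c / vx * X t))
    (a ^+ 2 * vx + b ^+ 2 * (vv - c ^+ 2 / vx)).
Proof.
have := nXV (a - b * (c / vx)) b; congr centered_normal.
  by apply/funext => t; ring.
by field; rewrite gt_eqF.
Qed.

(** The residual has nonnegative variance. *)
Lemma cov_sqr_le : c ^+ 2 <= vx * vv.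
Proof.
have [_ h _] := residual_indep 0 1; move: h.
rewrite expr0n/= mul0r add0r expr1n mul1r subr_ge0 ler_pdivrMr//.
by rewrite mulrC.
Qed.

(* The residual V - (c / vx) X is independent of X. When la is large, X is bounded
   on the box, so a large V forces a large residual; otherwise the factor
   (vv / la^2)^m is bounded below and the box alone suffices. *)
Lemma pair_tail_le (m : nat) (dl x la L : R) : (0 < m)%N -> 0 < dl -> dl <= 1 -> 0 < la ->
  `|x| <= L ->
  (P [set t | (`|X t - x| <= dl)%R /\ (la < `|V t|)%R] <=
   (4 * (m%:R * 24) ^+ m / Num.sqrt vx * (1 + (L + 1) ^+ 2 / vx) ^+ m
     * dl * (vv / la ^+ 2) ^+ m)%:E)%E.
Proof.
move=> m0 d0 d1 l0 xL.
have [mX _ _] : centered_normal P X vx.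
  have := nXV 1 0; congr centered_normal; last by ring.
  by apply/funext => t; ring.
have [mV vv0 _] : centered_normal P V vv.
  have := nXV 0 1; congr centered_normal; last by ring.
  by apply/funext => t; ring.
have mA : measurable [set t | `|X t - x| <= dl /\ la < `|V t|].
  by apply: measurableI; [exact: measurable_dist_le|exact: measurable_norm_gt].
have sx : 0 < Num.sqrt vx by rewrite sqrtr_gt0.
have L0 : 0 <= L by exact: le_trans xL.
have cvx : c ^+ 2 / vx <= vv by rewrite ler_pdivrMr// mulrC cov_sqr_le.
have q0 : 0 <= c ^+ 2 / vx by rewrite divr_ge0 ?sqr_ge0 ?(ltW vx0).
have Z0 : 0 <= (L + 1) ^+ 2 / vx by rewrite divr_ge0 ?sqr_ge0 ?(ltW vx0).
have M1 : 1 <= (m%:R * 24) ^+ m :> R.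
  by rewrite exprn_ege1//; have : (1 : R) <= m%:R by [rewrite ler1n]; lra.
(* Above this threshold, c^2 / vx <= vv and |X| <= L + 1 give |(c / vx) X| <= la / 2, so the
   residual exceeds la / 2. The 24 in the constant is the 6 of [box_tail_le] times the 4 lost by
   halving la. *)
have [la_big|la_small] := leP (4 * (L + 1) ^+ 2 / vx * vv) (la ^+ 2).
- have mB : measurable [set t | `|X t - x| <= dl /\ la / 2 < `|V t - c / vx * X t|].
    apply: measurableI; first exact: measurable_dist_le.
    apply: measurable_norm_gt; apply: measurable_funB => //; exact: measurable_funM.
  apply: le_trans (le_measure P _ _ _) _; rewrite ?inE; [exact: mA|exact: mB| | ].
    move=> t /= [Xt Vt]; split => //.
    have Xb : `|X t| <= L + 1.
      by rewrite -[X t](subrK x) (le_trans (ler_normD _ _))// addrC lerD// (le_trans Xt).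
    have cXb : `|c / vx * X t| <= la / 2.
      rewrite -(@ler_pXn2r _ 2)// ?nnegrE ?divr_ge0 ?(ltW l0)//.
      rewrite (real_normK (num_real _)) exprMn exprMn exprVn.
      have X2 : X t ^+ 2 <= (L + 1) ^+ 2.
        by rewrite -(real_normK (num_real (X t))) ler_pXn2r ?nnegrE// addr_ge0.
      have -> : c ^+ 2 / vx ^+ 2 * X t ^+ 2 = (c ^+ 2 / vx) * X t ^+ 2 / vx.
        by field; rewrite gt_eqF.
      rewrite ler_pdivrMr//.
      apply: (@le_trans _ _ (vv * (L + 1) ^+ 2)); first by apply: ler_pM => //; exact: sqr_ge0.
      have : 4 * (L + 1) ^+ 2 / vx * vv * vx <= la ^+ 2 * vx by rewrite ler_pM2r.
      have -> : 4 * (L + 1) ^+ 2 / vx * vv * vx = 4 * ((L + 1) ^+ 2 * vv) by field; rewrite gt_eqF.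
      rewrite exprMn exprVn; lra.
    have := ler_normD (V t - c / vx * X t) (c / vx * X t); rewrite subrK; lra.
  have la2 : 0 < la / 2 by rewrite divr_gt0.
  have h := @box_tail_le _ _ _ P X _ _ _ residual_indep m dl x (la / 2) d0 la2 vx0 m0.
  apply: (le_trans h); rewrite lee_fin.
  have -> : (m%:R * 24) = (m%:R * 6) * 4 :> R by ring.
  rewrite [(_ * 4) ^+ m]exprMn.
  have -> : 4 * ((m%:R * 6) ^+ m * 4 ^+ m) / Num.sqrt vx * (1 + (L + 1) ^+ 2 / vx) ^+ m * dl *
     (vv / la ^+ 2) ^+ m = (4 * (m%:R * 6) ^+ m * (dl / Num.sqrt vx)) *
     ((1 + (L + 1) ^+ 2 / vx) * (4 * (vv / la ^+ 2))) ^+ m by rewrite !exprMn; ring.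
  rewrite ler_wpM2l ?mulr_ge0 ?exprn_ge0 ?divr_ge0 ?mulr_ge0 ?(ltW d0) ?(ltW sx)//.
  rewrite lerXn2r// ?nnegrE.
  + by rewrite divr_ge0 ?sqr_ge0// subr_ge0.
  + by rewrite mulr_ge0// ?addr_ge0// mulr_ge0// divr_ge0// sqr_ge0.
  have -> : (vv - c ^+ 2 / vx) / (la / 2) ^+ 2 = 4 * ((vv - c ^+ 2 / vx) / la ^+ 2).
    by field; rewrite !gt_eqF.
  rewrite -[leLHS]mul1r; apply: ler_pM => //.
  + by rewrite mulr_ge0// divr_ge0 ?sqr_ge0// subr_ge0.
  + by rewrite lerDl.
  + by rewrite ler_wpM2l// ler_wpM2r ?invr_ge0 ?sqr_ge0// gerBl.
- have mB : measurable [set t | `|X t - x| <= dl] by exact: measurable_dist_le.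
  apply: le_trans (le_measure P _ _ _) _; rewrite ?inE; [exact: mA|exact: mB| | ].
    by move=> t [].
  have h := @normal_box_le _ _ _ P X _ _ _ residual_indep dl x d0 vx0.
  apply: (le_trans h); rewrite lee_fin.
  have -> : 4 * (m%:R * 24) ^+ m / Num.sqrt vx * (1 + (L + 1) ^+ 2 / vx) ^+ m * dl *
     (vv / la ^+ 2) ^+ m = (2 * (dl / Num.sqrt vx)) * (2 * (m%:R * 24) ^+ m *
     ((1 + (L + 1) ^+ 2 / vx) * (vv / la ^+ 2)) ^+ m) by rewrite !exprMn; ring.
  rewrite ler_peMr ?mulr_ge0 ?divr_ge0 ?(ltW d0) ?(ltW sx)//.
  have k1 : 1 <= 4 * ((1 + (L + 1) ^+ 2 / vx) * (vv / la ^+ 2)).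
    rewrite !mulrA ler_pdivlMr ?exprn_gt0// mul1r; apply: (le_trans (ltW la_small)).
    rewrite -!mulrA ler_wpM2l// !mulrA ler_wpM2r// lerDr//.
  have k4 : 1 <= m%:R * 24 / 4 :> R.
    by have : (1 : R) <= m%:R by [rewrite ler1n]; lra.
  rewrite -mulrA -exprMn.
  have -> : m%:R * 24 * ((1 + (L + 1) ^+ 2 / vx) * (vv / la ^+ 2)) =
     (m%:R * 24 / 4) * (4 * ((1 + (L + 1) ^+ 2 / vx) * (vv / la ^+ 2))) by field; rewrite !gt_eqF.
  have : 1 <= ((m%:R * 24 / 4) * (4 * ((1 + (L + 1) ^+ 2 / vx) * (vv / la ^+ 2)))) ^+ m.
    by rewrite exprn_ege1// -[leLHS]mulr1 ler_pM.
  by lra.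
Qed.

End residual.

(** * Local nondeterminism from the covariance alone *)

Section lnd.
Context {R : realType}.
Variables (H a : R).
Hypotheses (H0 : 0 < H) (H1 : H < 1) (a0 : 0 < a) (a1 : a < 1).

Lemma powR2H (x : R) : x `^ (2 * H) = (x `^ H) ^+ 2.
Proof. by rewrite mulrC powRrM powR_mulrn// powR_ge0. Qed.

Lemma fbm_covE (s t : R) :
  fbm_cov H s t = 2^-1 * ((`|t| `^ H) ^+ 2 + (`|s| `^ H) ^+ 2 - (`|t - s| `^ H) ^+ 2).
Proof. by rewrite /fbm_cov !powR2H. Qed.

Lemma fbm_cov_diag (s : R) : fbm_cov H s s = (`|s| `^ H) ^+ 2.
Proof.
by rewrite fbm_covE subrr normr0 powR0 ?gt_eqF// expr0n/= subr0; field.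
Qed.

Lemma powR_le1 (x : R) : 0 <= x -> x <= 1 -> x `^ H <= 1.
Proof.
move=> x0 x1; have e : 1 `^ H = 1 :> R by rewrite powR1.
by rewrite -[leRHS]e; apply: ge0_ler_powR; rewrite ?nnegrE ?(ltW H0)//.
Qed.

(* By homogeneity this is 1 - u^H <= 1 - u for u = s / t >= a. *)
Lemma powR_diff_le (s t : R) : a <= s -> s <= t -> t <= 1 ->
  0 <= t `^ H - s `^ H <= (1 - a) `^ (1 - H) * (t - s) `^ H.
Proof.
move=> sa st t1; have s0 : 0 < s by exact: lt_le_trans sa.
have t0 : 0 < t by exact: lt_le_trans st.
apply/andP; split.
  by rewrite subr_ge0 ge0_ler_powR ?nnegrE ?(ltW H0) ?(ltW s0) ?(ltW t0).
pose u := s / t.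
have u0 : 0 < u by rewrite divr_gt0.
have u1 : u <= 1 by rewrite ler_pdivrMr// mul1r.
have ua : a <= u by rewrite ler_pdivlMr// (le_trans _ sa)// ler_piMr// ltW.
have sE : s = t * u by rewrite /u mulrC divfK// gt_eqF.
have e1 : s `^ H = t `^ H * u `^ H by rewrite {1}sE powRM ?(ltW t0) ?(ltW u0).
have e2 : (t - s) `^ H = t `^ H * (1 - u) `^ H.
  by rewrite {1}sE -[X in X - _]mulr1 -mulrBr powRM ?(ltW t0)// subr_ge0.
rewrite e1 e2 -[X in X - _]mulr1 -mulrBr mulrCA ler_pM2l ?powR_gt0//.
have uH : u <= u `^ H by apply: ger1_powR; [rewrite u0 u1|exact: ltW].
apply: (@le_trans _ _ (1 - u)); first by rewrite lerB.
have E : 1 - u = (1 - u) `^ (1 - H) * (1 - u) `^ H.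
  rewrite -powRD; first by rewrite subrK powRr1// subr_ge0.
  by rewrite subrK oner_eq0.
rewrite [leLHS]E ler_wpM2r ?powR_ge0//; apply: ge0_ler_powR; rewrite ?nnegrE ?subr_ge0 ?(ltW H1) ?(ltW a1)//.
by rewrite lerB.
Qed.

(** Square of the constant of [powR_diff_le]. It is below 1 because a > 0 and H < 1, and 1 -
    [lnd_theta] measures the nondeterminism. *)
Definition lnd_theta := ((1 - a) `^ (1 - H)) ^+ 2.

Lemma lnd_theta_lt1 : 0 <= lnd_theta < 1.
Proof.
have e : 1 `^ (1 - H) = 1 :> R by rewrite powR1.
rewrite /lnd_theta sqr_ge0/= exprn_ilt1 ?powR_ge0// -[ltRHS]e.
apply: gt0_ltr_powR; rewrite ?nnegrE//; first by rewrite subr_gt0.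
- by rewrite subr_ge0 ltW.
- by rewrite gtrBl.
Qed.

(* With x = s^H, y = t^H and z = |t - s|^H, the conditional variance times x^2 is
   (z^2 - (x - y)^2) ((x + y)^2 - z^2) / 4. *)
Lemma lnd (s t : R) : a <= s <= 1 -> a <= t <= 1 ->
  fbm_cov H t t - fbm_cov H s t ^+ 2 / fbm_cov H s s >=
    (1 - lnd_theta) * (a `^ H) ^+ 2 / 2 * (`|t - s| `^ H) ^+ 2.
Proof.
move=> /andP[sa s1] /andP[ta t1].
have s0 : 0 < s by exact: lt_le_trans sa.
have t0 : 0 < t by exact: lt_le_trans ta.
have /andP[th0 th1] := lnd_theta_lt1.
have key : [/\ (t `^ H - s `^ H) ^+ 2 <= lnd_theta * (`|t - s| `^ H) ^+ 2 &
    (`|t - s| `^ H) <= t `^ H + s `^ H].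
  have [st|ts] := leP s t.
    have /andP[h0 h1] := powR_diff_le sa st t1.
    rewrite ger0_norm ?subr_ge0// /lnd_theta -exprMn; split.
      by rewrite ler_pXn2r// ?nnegrE// mulr_ge0 ?powR_ge0.
    apply: (@le_trans _ _ (t `^ H)); last by rewrite lerDl powR_ge0.
    by apply: ge0_ler_powR; rewrite ?nnegrE ?subr_ge0 ?(ltW H0) ?(ltW t0)// gerBl ltW.
  have /andP[h0 h1] := powR_diff_le ta (ltW ts) s1.
  rewrite distrC ger0_norm ?subr_ge0 ?(ltW ts)// /lnd_theta -exprMn; split.
    by rewrite -[t `^ H - _]opprB sqrrN ler_pXn2r// ?nnegrE// mulr_ge0 ?powR_ge0.
  apply: (@le_trans _ _ (s `^ H)); last by rewrite lerDr powR_ge0.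
  by apply: ge0_ler_powR; rewrite ?nnegrE ?subr_ge0 ?(ltW H0) ?(ltW s0) ?(ltW ts)// gerBl ltW.
rewrite !fbm_cov_diag fbm_covE (gtr0_norm s0) (gtr0_norm t0).
have ax : a `^ H <= s `^ H by apply: ge0_ler_powR; rewrite ?nnegrE ?(ltW H0) ?(ltW s0) ?(ltW a0).
have ay : a `^ H <= t `^ H by apply: ge0_ler_powR; rewrite ?nnegrE ?(ltW H0) ?(ltW t0) ?(ltW a0).
have aH : 0 < a `^ H by rewrite powR_gt0.
have x1 : s `^ H <= 1 by apply: powR_le1 => //; exact: ltW.
have z0 : 0 <= `|t - s| `^ H by exact: powR_ge0.
have zt : `|t - s| `^ H <= t `^ H \/ `|t - s| `^ H <= s `^ H.
  have [st|ts] := leP s t; [left|right].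
    rewrite ger0_norm ?subr_ge0//.
    by apply: ge0_ler_powR; rewrite ?nnegrE ?subr_ge0 ?(ltW H0) ?(ltW t0)// gerBl ltW.
  rewrite distrC ger0_norm ?subr_ge0 ?(ltW ts)//.
  by apply: ge0_ler_powR; rewrite ?nnegrE ?subr_ge0 ?(ltW H0) ?(ltW s0) ?(ltW ts)// gerBl ltW.
case: key.
move: (a `^ H) (s `^ H) (t `^ H) (`|t - s| `^ H) (lnd_theta) th0 th1 ax ay aH x1 z0 zt => al x y z th.
move=> th0 th1 ax ay aH x1 z0 zt k1 k2.
have x0 : 0 < x by exact: lt_le_trans ax.
have y0 : 0 < y by exact: lt_le_trans ay.
have B1 : (1 - th) * z ^+ 2 <= z ^+ 2 - (y - x) ^+ 2 by lra.
(* As z is at most the larger of x and y, (x + y)^2 - z^2 >= 2 x y. *)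
have B2 : 2 * al ^+ 2 <= (x + y) ^+ 2 - z ^+ 2 by case: zt => h; nra.
have D : x ^+ 2 * y ^+ 2 - (2^-1 * (y ^+ 2 + x ^+ 2 - z ^+ 2)) ^+ 2 =
   (z ^+ 2 - (y - x) ^+ 2) * ((x + y) ^+ 2 - z ^+ 2) / 4 by field.
have D1 : (1 - th) * al ^+ 2 / 2 * z ^+ 2 <= x ^+ 2 * y ^+ 2 - (2^-1 * (y ^+ 2 + x ^+ 2 - z ^+ 2)) ^+ 2.
  rewrite D.
  have -> : (1 - th) * al ^+ 2 / 2 * z ^+ 2 = ((1 - th) * z ^+ 2) * (2 * al ^+ 2) / 4 by field.
  rewrite ler_pM2r ?invr_gt0//; apply: ler_pM => //; first by rewrite mulr_ge0 ?sqr_ge0 ?subr_ge0 ?ltW.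
  by rewrite mulr_ge0 ?sqr_ge0.
apply: (le_trans D1); set cv := 2^-1 * _.
have x20 : 0 < x ^+ 2 by rewrite exprn_gt0.
have D0 : 0 <= x ^+ 2 * y ^+ 2 - cv ^+ 2.
  apply: (le_trans _ D1); apply: mulr_ge0; last exact: sqr_ge0.
  apply: divr_ge0 => //; apply: mulr_ge0; last exact: sqr_ge0.
  by rewrite subr_ge0 ltW.
have -> : y ^+ 2 - cv ^+ 2 / x ^+ 2 = (x ^+ 2 * y ^+ 2 - cv ^+ 2) / x ^+ 2 by field; rewrite gt_eqF.
by rewrite ler_pdivlMr// ler_piMr// exprn_ile1// ltW.
Qed.

(** Upper counterparts of [lnd]. The best linear prediction of X_t from X_s errs no more than X_s
    itself does, and its coefficient differs from 1 by O(|t - s|^H); so using y - x for the centre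
    of the residual costs only a shift of order |t - s|^H. *)
Lemma fbm_regr (s t : R) : a <= s <= 1 -> a <= t <= 1 ->
  `|1 - fbm_cov H s t / fbm_cov H s s| <= (`|t - s| `^ H) / a `^ H /\
  fbm_cov H t t - fbm_cov H s t ^+ 2 / fbm_cov H s s <= (`|t - s| `^ H) ^+ 2.
Proof.
move=> /andP[sa s1] /andP[ta t1].
have s0 : 0 < s by exact: lt_le_trans sa.
have t0 : 0 < t by exact: lt_le_trans ta.
have key : `|t `^ H - s `^ H| <= `|t - s| `^ H.
  have th1 : (1 - a) `^ (1 - H) <= 1.
    have /andP[_ h] := lnd_theta_lt1; rewrite -(@ler_pXn2r _ 2)// ?nnegrE ?powR_ge0// expr1n.
    exact: ltW.
  have [st|ts] := leP s t.
    have /andP[h0 h1] := powR_diff_le sa st t1.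
    rewrite ger0_norm// [`|t - s|]ger0_norm ?subr_ge0//; apply: (le_trans h1).
    by rewrite ler_piMl ?powR_ge0.
  have /andP[h0 h1] := powR_diff_le ta (ltW ts) s1.
  rewrite distrC ger0_norm// [`|t - s|]distrC [`|s - t|]ger0_norm ?subr_ge0 ?(ltW ts)//.
  by apply: (le_trans h1); rewrite ler_piMl ?powR_ge0.
have k3 : `|t - s| `^ H <= s `^ H + t `^ H.
  have [st|ts] := leP s t.
    rewrite ger0_norm ?subr_ge0// (@le_trans _ _ (t `^ H))// ?lerDr ?powR_ge0//.
    by apply: ge0_ler_powR; rewrite ?nnegrE ?subr_ge0 ?(ltW H0) ?(ltW t0)// gerBl ltW.
  rewrite distrC ger0_norm ?subr_ge0 ?(ltW ts)// (@le_trans _ _ (s `^ H))// ?lerDl ?powR_ge0//.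
  by apply: ge0_ler_powR; rewrite ?nnegrE ?subr_ge0 ?(ltW H0) ?(ltW s0) ?(ltW ts)// gerBl ltW.
rewrite !fbm_cov_diag fbm_covE (gtr0_norm s0) (gtr0_norm t0).
have ax : a `^ H <= s `^ H by apply: ge0_ler_powR; rewrite ?nnegrE ?(ltW H0) ?(ltW s0) ?(ltW a0).
have aH : 0 < a `^ H by rewrite powR_gt0.
have z0 : 0 <= `|t - s| `^ H by exact: powR_ge0.
have y0 : 0 <= t `^ H by exact: powR_ge0.
move: (a `^ H) (s `^ H) (t `^ H) (`|t - s| `^ H) key k3 ax aH z0 y0 => al x y z.
rewrite ler_norml => /andP[k1 k2] k3 ax aH z0 y0.
have x0 : 0 < x by exact: lt_le_trans ax.
have x20 : 0 < x ^+ 2 by rewrite exprn_gt0.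
set cv := 2^-1 * _; split.
  have -> : 1 - cv / x ^+ 2 = (x ^+ 2 - cv) / x ^+ 2 by field; rewrite gt_eqF.
  rewrite normrM normfV (gtr0_norm x20) ler_pdivrMr//.
  apply: (@le_trans _ _ (z * x)).
    have e1 : y ^+ 2 <= (x + z) ^+ 2 by rewrite ler_pXn2r ?nnegrE ?addr_ge0 ?(ltW x0)//; lra.
    have e2 : (x - z) ^+ 2 <= y ^+ 2.
      by rewrite -(real_normK (num_real (x - z))) ler_pXn2r ?nnegrE// ler_norml; lra.
    by rewrite ler_norml /cv; apply/andP; split; lra.
  rewrite expr2 mulrA ler_pM2r// -mulrA ler_peMr// ler_pdivlMl// mulr1//.
rewrite lerBlDr -lerBlDl ler_pdivlMr//.
have -> : cv = (x ^+ 2 + (y ^+ 2 - x ^+ 2 - z ^+ 2) / 2) by rewrite /cv; field.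
have := sqr_ge0 (y ^+ 2 - x ^+ 2 - z ^+ 2); nra.
Qed.

(** From 1 + q <= 2 D exp (q^2 / D), where D is chosen with p / D <= 1 / (2 A) so that p such
    exponentials are absorbed. *)
Lemma exp_poly_le (A : R) (p : nat) : 0 < A -> exists2 C : R, 0 < C &
  forall q, 0 <= q -> (1 + q) ^+ p * expR (- (q ^+ 2 / (2 * A))) <= C.
Proof.
move=> A0.
pose D := 1 + 2 * A * p%:R.
have D1 : 1 <= D by rewrite lerDl !mulr_ge0// ltW.
have A0' := ltW A0.
exists ((2 * D) ^+ p) => [|q q0]; first by rewrite exprn_gt0// mulr_gt0// (lt_le_trans _ D1).
have D0 : 0 < D by exact: lt_le_trans D1.
have h1 : 1 + q <= 2 * D * expR (q ^+ 2 / D).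
  have e1 := expR_ge1Dx (q ^+ 2 / D).
  apply: (@le_trans _ _ (2 * D * (1 + q ^+ 2 / D))); last by rewrite ler_wpM2l// mulr_ge0// ltW.
  have -> : 2 * D * (1 + q ^+ 2 / D) = 2 * D + 2 * q ^+ 2 by field; rewrite gt_eqF.
  have := sqr_ge0 (q - 1); nra.
apply: (@le_trans _ _ ((2 * D * expR (q ^+ 2 / D)) ^+ p * expR (- (q ^+ 2 / (2 * A))))).
  by rewrite ler_wpM2r ?expR_ge0// lerXn2r ?nnegrE ?addr_ge0// !mulr_ge0 ?expR_ge0 ?(ltW D0).
rewrite exprMn -mulrA ler_piMr ?exprn_ge0 ?mulr_ge0 ?(ltW D0)//.
rewrite -expRM_natl -expRD -[leRHS]expR0 ler_expR subr_le0.
have -> : p%:R * (q ^+ 2 / D) = q ^+ 2 * (p%:R / D) by ring.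
rewrite ler_wpM2l ?sqr_ge0// ler_pdivrMr// mulrC ler_pdivlMr ?mulr_gt0// /D; lra.
Qed.

End lnd.

(** * One-component estimates, uniform in the process *)

Section fbm_bounds.
Context {R : realType}.
Variables (H a : R).
Hypotheses (H0 : 0 < H) (H1 : H < 1) (a0 : 0 < a) (a1 : a < 1).

Let al := a `^ H.
Let al0 : 0 < al. Proof. by rewrite powR_gt0. Qed.

Lemma fbm_sd (t : R) : a <= t <= 1 -> al <= Num.sqrt (fbm_cov H t t) <= 1.
Proof.
move=> /andP[ta t1]; have t0 : 0 < t by exact: lt_le_trans ta.
rewrite fbm_cov_diag// sqrtr_sqr (gtr0_norm t0) ger0_norm ?powR_ge0//.
rewrite powR_le1// ?(ltW t0)// andbT.
by apply: ge0_ler_powR; rewrite ?nnegrE ?(ltW H0) ?(ltW a0) ?(ltW t0).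
Qed.

Lemma fbm_var_gt0 (t : R) : a <= t <= 1 -> 0 < fbm_cov H t t.
Proof.
move=> /fbm_sd /andP[h _]; have : 0 < Num.sqrt (fbm_cov H t t) by exact: lt_le_trans h.
by rewrite sqrtr_gt0.
Qed.

Lemma fbm_pair d (T : measurableType d) (P : probability T R) X s t a' b' :
  fbm P H X -> a <= s <= 1 -> a <= t <= 1 ->
  centered_normal P (fun w => a' * X s w + b' * X t w)
    (a' ^+ 2 * fbm_cov H s s + 2 * a' * b' * fbm_cov H s t + b' ^+ 2 * fbm_cov H t t).
Proof.
move=> fX /andP[sa s1] /andP[ta t1].
have := @fbm_comb3 _ _ _ P H X s t t a' b' 0 fX.
rewrite !(le_trans (ltW a0))// s1 t1 => /(_ isT isT isT).
congr centered_normal; first by apply/funext => w; rewrite mul0r addr0.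
by rewrite expr0n/=; ring.
Qed.

(** The covariance of X_p with the increment is not evaluated: [pair_tail_le] bounds its effect by
    Cauchy-Schwarz. *)
Lemma fbm_increment d (T : measurableType d) (P : probability T R) X p u v a' b' :
  fbm P H X -> 0 <= p <= 1 -> 0 <= u <= 1 -> 0 <= v <= 1 ->
  centered_normal P (fun w => a' * X p w + b' * (X u w - X v w))
    (a' ^+ 2 * fbm_cov H p p + 2 * a' * b' * (fbm_cov H p u - fbm_cov H p v)
     + b' ^+ 2 * (`|u - v| `^ H) ^+ 2).
Proof.
move=> fX p01 u01 v01.
have := @fbm_comb3 _ _ _ P H X p u v a' b' (- b') fX p01 u01 v01.
congr centered_normal; first by apply/funext => w; ring.
rewrite (fbm_cov_diag H0 u) (fbm_cov_diag H0 v) (fbm_covE H u v) [`|v - u|]distrC.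
by field.
Qed.

Lemma fbm_box_ub : exists2 C : R, 0 < C &
  forall d (T : measurableType d) (P : probability T R) (X : R -> T -> R) (t x dl : R),
    fbm P H X -> a <= t <= 1 -> 0 < dl ->
    (P [set w | (`|X t w - x| <= dl)%R] <= (C * dl)%:E)%E.
Proof.
exists (2 / al) => [|d T P X t x dl fX ta d0]; first by rewrite divr_gt0.
have vx0 := fbm_var_gt0 ta.
have nXV a' b' := @fbm_pair _ _ P X t t a' b' fX ta ta.
have h := @normal_box_le _ _ _ P (X t) _ _ _ (residual_indep vx0 nXV) dl x d0 vx0.
apply: (le_trans h); rewrite lee_fin.
have /andP[sd0 _] := fbm_sd ta.
have -> : 2 / al * dl = 2 * (dl / al) by ring.
by rewrite ler_wpM2l// ler_wpM2l ?(ltW d0)// lef_pV2 ?posrE// (lt_le_trans _ sd0).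
Qed.

Lemma fbm_box_lb (L : R) : exists2 c : R, 0 < c &
  forall d (T : measurableType d) (P : probability T R) (X : R -> T -> R) (t x ep : R),
    fbm P H X -> a <= t <= 1 -> `|x| <= L -> 0 < ep -> ep <= 1 ->
    ((c * ep)%:E <= P [set w | (x <= X t w < x + ep)%R])%E.
Proof.
(* Lower bound for the normal density at |y| <= L + 1 when the standard deviation lies between a^H
   and 1. *)
exists ((Num.sqrt (2 * pi))^-1 * expR (- ((L + 1) ^+ 2 / (2 * al ^+ 2)))).
  by rewrite mulr_gt0 ?expR_gt0// invr_gt0 sqrtr_gt0 mulr_gt0// pi_gt0.
move=> d T P X t x ep fX ta xL e0 e1.
have vx0 := fbm_var_gt0 ta; have /andP[sd0 sd1] := fbm_sd ta.
have [_ _ PX] : centered_normal P (X t) (fbm_cov H t t).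
  have := @fbm_pair _ _ P X t t 1 0 fX ta ta; congr centered_normal; last by ring.
  by apply/funext => w; ring.
move: (fbm_cov H t t) vx0 sd0 sd1 PX => v vx0 sd0 sd1 PX.
have -> : [set w | x <= X t w < x + ep] = X t @^-1` `[x, x + ep[%classic.
  by apply/seteqP; split => w; rewrite /= in_itv.
have mI : measurable `[x, x + ep[%classic by exact: measurable_itv.
rewrite (PX _ mI) (gt_eqF vx0).
set c := _ * expR _; rewrite /normal_prob.
have -> : (c * ep)%:E = (\int[lebesgue_measure]_(y in `[x, (x + ep)%R[%classic) (cst c%:E) y)%E.
  rewrite integral_cst//= lebesgue_measure_itv/= lte_fin ltrDl e0 -EFinD -EFinM.
  by congr EFin; ring.
have sd : 0 < Num.sqrt v by exact: lt_le_trans sd0.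
apply: ge0_le_integral => //.
- by move=> y yI; rewrite lee_fin /c mulr_ge0 ?expR_ge0// invr_ge0 sqrtr_ge0.
- by apply/measurable_EFinP; apply: measurable_funTS; exact: measurable_normal_pdf.
move=> y; rewrite /= in_itv/= => /andP[xy yx]; rewrite lee_fin.
rewrite normal_pdf_gaussf ?gt_eqF// sqr_sqrtr ?(ltW vx0)// invrK subr0.
have v1 : v <= 1.
  by rewrite -(sqr_sqrtr (ltW vx0)) exprn_ile1// sqrtr_ge0.
have alv : al ^+ 2 <= v.
  by rewrite -(sqr_sqrtr (ltW vx0)) ler_pXn2r// nnegrE ?(ltW al0)// sqrtr_ge0.
have p0 := @pi_gt0 R.
apply: ler_pM; rewrite ?invr_ge0 ?sqrtr_ge0 ?expR_ge0//.
  rewrite lef_pV2 ?posrE ?sqrtr_gt0 ?mulr_gt0//.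
  by rewrite ler_sqrt ?mulr_ge0 ?(ltW p0)// [2 * pi]mulrC ler_wpM2l ?(ltW p0)//; lra.
rewrite /gaussf ler_expR lerN2 [leLHS]mulrC.
have yL : y ^+ 2 <= (L + 1) ^+ 2.
  have L0 : 0 <= L by exact: le_trans xL.
  rewrite -(real_normK (num_real y)) ler_pXn2r ?nnegrE ?addr_ge0//.
  move: xL; rewrite !ler_norml => /andP[x1 x2]; apply/andP; split; lra.
apply: ler_pM => //; rewrite ?sqr_ge0 ?invr_ge0 ?mulr_ge0 ?(ltW vx0)//.
by rewrite lef_pV2 ?posrE ?mulr_gt0 ?exprn_gt0// ler_wpM2l.
Qed.

Lemma fbm_tail (m : nat) : (0 < m)%N -> exists2 C : R, 0 < C &
  forall d (T : measurableType d) (P : probability T R) (X : R -> T -> R) (u v la : R),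
    fbm P H X -> 0 <= u <= 1 -> 0 <= v <= 1 -> 0 < la ->
    (P [set w | (la < `|X u w - X v w|)%R] <=
     (C * ((`|u - v| `^ H) ^+ 2 / la ^+ 2) ^+ m)%:E)%E.
Proof.
move=> m0; exists (2 * (m%:R * 6) ^+ m).
  by rewrite mulr_gt0// exprn_gt0// mulr_gt0// ltr0n.
move=> d T P X u v la fX u01 v01 l0.
(* [tail_le] is about pairs, so the increment is paired with the constant 0, of variance 0. *)
have nXW a' b' : centered_normal P (fun t => a' * (cst 0 t : R) + b' * (X u t - X v t))
   (a' ^+ 2 * 0 + b' ^+ 2 * (`|u - v| `^ H) ^+ 2).
  have := @fbm_increment _ _ P X u u v 0 b' fX u01 u01 v01; congr centered_normal.
    by apply/funext => t /=; ring.
  by rewrite expr0n/=; ring.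
by apply: (@tail_le _ _ _ P _ _ _ _ nXW m la).
Qed.

Lemma fbm_box_tail (m : nat) (L : R) : (0 < m)%N -> 0 <= L -> exists2 C : R, 0 < C &
  forall d (T : measurableType d) (P : probability T R) (X : R -> T -> R) (p u v x dl la : R),
    fbm P H X -> a <= p <= 1 -> 0 <= u <= 1 -> 0 <= v <= 1 -> `|x| <= L ->
    0 < dl -> dl <= 1 -> 0 < la ->
    (P [set w | (`|X p w - x| <= dl)%R /\ (la < `|X u w - X v w|)%R] <=
     (C * dl * ((`|u - v| `^ H) ^+ 2 / la ^+ 2) ^+ m)%:E)%E.
Proof.
move=> m0 L0; exists (4 * (m%:R * 24) ^+ m / al * (1 + (L + 1) ^+ 2 / al ^+ 2) ^+ m).
  rewrite mulr_gt0//; first by rewrite divr_gt0// mulr_gt0// exprn_gt0// mulr_gt0// ltr0n.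
  by rewrite exprn_gt0// ltr_pwDl// divr_ge0 ?sqr_ge0.
move=> d T P X p u v x dl la fX pa u01 v01 xL d0 d1 l0.
have vx0 := fbm_var_gt0 pa; have /andP[sd0 sd1] := fbm_sd pa.
have p01 : 0 <= p <= 1.
  by have /andP[h1 h2] := pa; rewrite (le_trans _ h1)// ltW.
have nXV a' b' := @fbm_increment _ _ P X p u v a' b' fX p01 u01 v01.
have h := @pair_tail_le _ _ _ P _ _ _ _ _ vx0 nXV m dl x la L m0 d0 d1 l0 xL.
apply: (le_trans h); rewrite lee_fin.
move: (fbm_cov H p p) vx0 sd0 sd1 => v0 vx0 sd0 sd1.
have alv : al ^+ 2 <= v0.
  by rewrite -(sqr_sqrtr (ltW vx0)) ler_pXn2r// nnegrE ?(ltW al0)// sqrtr_ge0.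
have sd : 0 < Num.sqrt v0 by exact: lt_le_trans sd0.
rewrite ler_wpM2r ?exprn_ge0 ?divr_ge0 ?sqr_ge0// ler_wpM2r ?(ltW d0)//.
apply: ler_pM.
- by rewrite divr_ge0 ?(ltW sd)// mulr_ge0// exprn_ge0// mulr_ge0.
- by rewrite exprn_ge0// addr_ge0// divr_ge0 ?sqr_ge0// ltW.
- by rewrite ler_wpM2l ?mulr_ge0 ?exprn_ge0 ?mulr_ge0// lef_pV2.
rewrite lerXn2r ?nnegrE ?addr_ge0 ?divr_ge0 ?sqr_ge0 ?(ltW vx0)// lerD2l.
by rewrite ler_wpM2l ?sqr_ge0// lef_pV2 ?posrE ?exprn_gt0.
Qed.

(* The factor with exponent p is the Gaussian decay in (y - x) / |t - s|^H, needed
   to sum over the cubes met by F. *)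
Lemma fbm_box2 (p : nat) (L : R) : 0 <= L -> exists2 C : R, 0 < C &
  forall d (T : measurableType d) (P : probability T R) (X : R -> T -> R) (s t x y ep : R),
    fbm P H X -> a <= s <= 1 -> a <= t <= 1 -> s != t -> `|x| <= L ->
    0 < ep -> ep <= `|t - s| `^ H ->
    (P [set w | (`|X s w - x| <= ep)%R /\ (`|X t w - y| <= ep)%R] <=
     (C * ep ^+ 2 / (`|t - s| `^ H) *
       ((`|t - s| `^ H) / (`|t - s| `^ H + `|y - x|)) ^+ p)%:E)%E.
Proof.
move=> L0.
(* With be the regression coefficient and sg = |t - s|^H: b0 bounds 1 + |be|, so the residual lies
   in a box of half-width b0 ep; A sg^2 bounds (b0 ep)^2 plus the residual variance; C1 sg bounds
   the shift |(1 - be) x|. *)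
pose b0 := 2 + al^-1.
have b00 : 0 < b0 by rewrite addr_gt0// invr_gt0.
pose A := b0 ^+ 2 + 1.
have A0 : 0 < A by rewrite addr_gt0// exprn_gt0.
have [Cp Cp0 HCp] := exp_poly_le p A0.
pose ka := (1 - lnd_theta H a) * al ^+ 2 / 2.
have /andP[th0 th1] := lnd_theta_lt1 H1 a0 a1.
have ka0 : 0 < ka by rewrite divr_gt0// mulr_gt0 ?exprn_gt0// subr_gt0.
have ska : 0 < Num.sqrt ka by rewrite sqrtr_gt0.
pose C1 := L / al.
have C10 : 0 <= C1 by rewrite divr_ge0// ltW.
exists (4 * (b0 / (al * Num.sqrt ka)) * (Cp * (1 + C1) ^+ p)).
  by rewrite !mulr_gt0 ?invr_gt0 ?mulr_gt0 ?exprn_gt0// ltr_pwDl.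
move=> d T P X s t x y ep fX sa ta st xL e0 es.
set sg := `|t - s| `^ H in es *.
have sg0 : 0 < sg by exact: lt_le_trans es.
have vx0 := fbm_var_gt0 sa; have /andP[sd0 sd1] := fbm_sd sa.
have nXV a' b' := @fbm_pair _ _ P X s t a' b' fX sa ta.
have nW := residual_indep vx0 nXV.
have /= hl := lnd H0 H1 a0 a1 sa ta; rewrite -/al -/ka -/sg in hl.
have /= [hr1 hr2] := fbm_regr H0 H1 a0 a1 sa ta; rewrite -/al -/sg in hr1 hr2.
set be := fbm_cov H s t / fbm_cov H s s in nW hr1.
set v2 := fbm_cov H t t - _ in nW hl hr2.
clearbody v2.
have v20 : 0 < v2 by apply: lt_le_trans hl; rewrite mulr_gt0 ?exprn_gt0.
have sg1 : sg <= 1.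
  rewrite /sg powR_le1//; move: sa ta => /andP[h1 h2] /andP[h3 h4].
  have := a0; have := a1; move=> p1 p2; rewrite ler_norml; apply/andP; split; lra.
have beb : 1 + `|be| <= b0.
  have : `|be| <= 1 + sg / al.
    by rewrite -[be](subKr 1) (le_trans (ler_normB _ _))// normr1 lerD2l.
  have : sg / al <= al^-1 by rewrite ler_piMl// invr_ge0 ltW.
  rewrite /b0; lra.
have e20 : 0 < b0 * ep by rewrite mulr_gt0.
have [mX _ _] : centered_normal P (X s) (fbm_cov H s s).
  have := nXV 1 0; congr centered_normal; last by ring.
  by apply/funext => w; ring.
have [mY _ _] : centered_normal P (X t) (fbm_cov H t t).
  have := nXV 0 1; congr centered_normal; last by ring.
  by apply/funext => w; ring.
apply: (@le_trans _ _ (P [set w | (`|X s w - x| <= ep)%R /\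
    (`|(X t w - be * X s w) - (y - be * x)| <= b0 * ep)%R])).
  apply: le_measure; rewrite ?inE.
  - by apply: measurableI; exact: measurable_dist_le.
  - apply: measurableI; apply: measurable_dist_le => //.
    by apply: measurable_funB => //; exact: measurable_funM.
  move=> w /= [h1 h2]; split => //.
  have -> : X t w - be * X s w - (y - be * x) = (X t w - y) - be * (X s w - x) by ring.
  rewrite (le_trans (ler_normB _ _))// normrM.
  apply: (@le_trans _ _ (ep + `|be| * ep)); first by rewrite lerD// ler_wpM2l.
  by rewrite -[X in X + _]mul1r -mulrDl ler_wpM2r ?(ltW e0).
have h := @box_le _ _ _ P (X s) _ _ _ nW ep (b0 * ep) x (y - be * x) e0 e20 vx0 v20.
apply: (le_trans h); rewrite lee_fin.
set w := y - be * x.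
have q0 : 0 <= `|w| / sg by rewrite divr_ge0// ltW.
have E1 : expR (- (w ^+ 2 / (2 * ((b0 * ep) ^+ 2 + v2)))) <= Cp / (1 + `|w| / sg) ^+ p.
  rewrite ler_pdivlMr; last by rewrite exprn_gt0// ltr_pwDl.
  rewrite mulrC; apply: le_trans (HCp _ q0).
  apply: ler_wpM2l; first by rewrite exprn_ge0// addr_ge0.
  rewrite ler_expR lerN2 expr_div_n (real_normK (num_real w)).
  have -> : w ^+ 2 / sg ^+ 2 / (2 * A) = w ^+ 2 / (2 * (A * sg ^+ 2)).
    by field; rewrite !gt_eqF.
  rewrite ler_wpM2l ?sqr_ge0// lef_pV2 ?posrE ?mulr_gt0 ?addr_gt0 ?exprn_gt0//.
  rewrite ler_wpM2l// /A [leRHS]mulrDl mul1r lerD// exprMn ler_wpM2l ?sqr_ge0//.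
  by rewrite ler_pXn2r// nnegrE ltW.
have E2 : (1 + `|w| / sg)^-1 <= (1 + C1) * (sg / (sg + `|y - x|)).
  have D0 : 0 < sg + `|y - x| by rewrite ltr_pwDl.
  have D1 : 0 < sg + `|w| by rewrite ltr_pwDl.
  have -> : (1 + `|w| / sg)^-1 = sg / (sg + `|w|) by field; rewrite !gt_eqF// ltr_pwDl.
  rewrite mulrCA ler_wpM2l ?(ltW sg0)// -[leLHS]mul1r ler_pdivrMr//.
  rewrite mulrAC ler_pdivlMr// mul1r.
  have : `|y - x| <= `|w| + C1 * sg.
    have -> : y - x = w - (1 - be) * x by rewrite /w; ring.
    rewrite (le_trans (ler_normB _ _))// lerD2l normrM.
    apply: (@le_trans _ _ (sg / al * L)); first exact: ler_pM.
    by rewrite /C1 (_ : sg / al * L = L / al * sg)//; ring.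
  have : 0 <= C1 * `|w| by rewrite mulr_ge0.
  lra.
have E3 : ((1 + `|w| / sg) ^+ p)^-1 <= (1 + C1) ^+ p * (sg / (sg + `|y - x|)) ^+ p.
  rewrite -exprVn -exprMn lerXn2r ?nnegrE ?invr_ge0 ?addr_ge0//.
  by rewrite mulr_ge0 ?addr_ge0// divr_ge0 ?addr_ge0// ltW.
have F1 : ep / Num.sqrt (fbm_cov H s s) <= ep / al.
  by rewrite ler_wpM2l ?(ltW e0)// lef_pV2 ?posrE// (lt_le_trans _ sd0).
have F2 : b0 * ep / Num.sqrt v2 <= b0 * ep / (Num.sqrt ka * sg).
  have q1 : 0 < Num.sqrt ka * sg by rewrite mulr_gt0.
  rewrite ler_wpM2l ?(ltW e20)// lef_pV2 ?posrE ?sqrtr_gt0//.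
  have -> : Num.sqrt ka * sg = Num.sqrt (ka * sg ^+ 2).
    by rewrite [RHS]sqrtrM ?(ltW ka0)// sqrtr_sqr gtr0_norm.
  by rewrite ler_wsqrtr.
apply: (@le_trans _ _ (4 * (ep / al) * (b0 * ep / (Num.sqrt ka * sg) * (Cp * ((1 + C1) ^+ p * (sg / (sg + `|y - x|)) ^+ p))))).
  apply: ler_pM; rewrite ?mulr_ge0 ?divr_ge0 ?expR_ge0 ?sqrtr_ge0 ?(ltW e0) ?(ltW b00)//.
    by rewrite ler_wpM2l.
  apply: ler_pM; rewrite ?mulr_ge0 ?divr_ge0 ?expR_ge0 ?sqrtr_ge0 ?(ltW e0) ?(ltW b00)//.
  by apply: (le_trans E1); rewrite ler_wpM2l// ltW.
rewrite le_eqVlt; apply/orP; left; apply/eqP.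
by move: (_ ^+ p) => Z; field; rewrite !gt_eqF.
Qed.

End fbm_bounds.

(** * Grids and regular sets *)

Section finite_union.
Context {d} {T : measurableType d} {R : realType} (mu : {measure set T -> \bar R}).

Lemma exists_finE (I : finType) (Q : pred I) (A : I -> set T) :
  [set x | exists i, Q i /\ A i x] = \big[setU/set0]_(i | Q i) A i.
Proof.
apply/seteqP; split => [x [i [Qi Aix]]|x].
  by rewrite (bigD1 i)//=; left.
elim/big_ind : _ => [//|B C HB HC|i Qi Aix]; last by exists i.
by case; [exact: HB|exact: HC].
Qed.

Lemma measurable_exists_fin (I : finType) (Q : pred I) (A : I -> set T) :
  (forall i, Q i -> measurable (A i)) -> measurable [set x | exists i, Q i /\ A i x].
Proof. by move=> mA; rewrite exists_finE; exact: bigsetU_measurable. Qed.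

Lemma measure_exists_fin_le (I : finType) (Q : pred I) (A : I -> set T) :
  (forall i, measurable (A i)) ->
  (mu [set x | exists i, Q i /\ A i x] <= \sum_(i | Q i) mu (A i))%E.
Proof.
move=> mA; rewrite exists_finE.
suff [] : measurable (\big[setU/set0]_(i | Q i) A i) /\
  (mu (\big[setU/set0]_(i | Q i) A i) <= \sum_(i | Q i) mu (A i))%E by [].
apply: (big_ind2 (fun B r => measurable B /\ (mu B <= r)%E)) => [|B r C s [mB Br] [mC Cs]|i _] //.
- by rewrite measure0.
- split; first exact: measurableU.
  by rewrite (le_trans (measureU2 _ _ _))// leeD.
Qed.

Lemma measure_exists_fin (I : finType) (Q : pred I) (A : I -> set T) :
  (forall i, measurable (A i)) -> (forall i j, i != j -> A i `&` A j = set0) ->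
  (mu [set x | exists i, Q i /\ A i x] = \sum_(i | Q i) mu (A i))%E.
Proof.
move=> mA dA; rewrite exists_finE -!(big_filter (index_enum I)).
have : uniq (seq.filter Q (index_enum I)) by rewrite filter_uniq// index_enum_uniq.
elim: (seq.filter Q (index_enum I)) => [|i s IH] /=.
  by rewrite !big_nil measure0.
move=> /andP[nis us]; rewrite !big_cons measureU//.
- by congr (_ + _)%E; exact: IH.
- exact: bigsetU_measurable.
rewrite big_distrr/= big_seq big1// => j js; apply: dA.
by apply: contraNneq nis => ->.
Qed.

End finite_union.

Section enorm.
Context {R : realType} {d : nat}.

Lemma coord_le_enorm (u : 'rV[R]_d) i : `|u 0 i| <= enorm u.
Proof.
rewrite -sqrtr_sqr ler_wsqrtr// (bigD1 i)//= lerDl.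
by apply: sumr_ge0 => j _; exact: sqr_ge0.
Qed.

Lemma enorm_le (u : 'rV[R]_d) r : 0 <= r -> (forall i, `|u 0 i| <= r) -> enorm u <= d%:R * r.
Proof.
move=> r0 ur; have dr : 0 <= d%:R * r by rewrite mulr_ge0.
rewrite -[leRHS]ger0_norm// -sqrtr_sqr ler_wsqrtr//.
apply: (@le_trans _ _ (\sum_(i < d) r ^+ 2)).
  by apply: ler_sum => i _; rewrite -(real_normK (num_real (u 0 i))) ler_pXn2r ?nnegrE.
rewrite sumr_const card_ord -[leLHS]mulr_natl [leRHS]exprMn ler_wpM2r ?sqr_ge0//.
case: (d) => [|n]; first by rewrite expr0n.
by rewrite expr2 ler_peMl// ler1n.
Qed.

Lemma measurable_open_rV (A : set 'rV[R]_d) : open A -> measurable (A : set borel_rV).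
Proof. by move=> oA; apply: sub_gen_smallest. Qed.

Lemma measurable_coord (A : set R) i : open A ->
  measurable ([set y : 'rV[R]_d | A (y 0 i)] : set borel_rV).
Proof.
move=> oA; apply: measurable_open_rV.
by apply: (open_comp _ oA) => y _; exact: coord_continuous.
Qed.

Lemma measurable_coord_itv (x y : R) i :
  measurable ([set u : 'rV[R]_d | x <= u 0 i < y] : set borel_rV).
Proof.
rewrite (_ : [set u : 'rV[R]_d | _] =
  [set u | `]-oo, y[%classic (u 0 i)] `\` [set u | `]-oo, x[%classic (u 0 i)]).
  by apply: measurableD; apply: measurable_coord; exact: interval_open.
apply/seteqP; split => u /=; rewrite !in_itv/=.
  by move=> /andP[xu uy]; split => //; apply/negP; rewrite -leNgt.
by move=> [uy /negP]; rewrite -leNgt uy => ->.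
Qed.

Lemma measurable_eball (x : 'rV[R]_d) r : measurable (eball x r : set borel_rV).
Proof.
apply: measurable_open_rV.
have oI : open `]-oo, r[%classic by exact: interval_open.
rewrite (_ : eball x r = (fun y => enorm (y - x)) @^-1` `]-oo, r[%classic).
  apply: (open_comp _ oI) => y _.
  apply: (@continuous_comp _ _ _ (fun y : 'rV[R]_d => \sum_(i < d) (y - x) 0 i ^+ 2) Num.sqrt);
    last exact: sqrt_continuous.
  elim: (index_enum _) => [|i s IH].
    have -> : (fun z : 'rV[R]_d => \sum_(i <- [::]) (z - x) 0 i ^+ 2) = cst 0.
      by apply/funext => z; rewrite big_nil.
    exact: cst_continuous.
  have -> : (fun z : 'rV[R]_d => \sum_(j <- i :: s) (z - x) 0 j ^+ 2) =
    (fun z => (z - x) 0 i ^+ 2 + \sum_(j <- s) (z - x) 0 j ^+ 2).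
    by apply/funext => z; rewrite big_cons.
  apply: continuousD => //.
  apply: (@continuous_comp _ _ _ (fun y : 'rV[R]_d => (y - x) 0 i) (fun t => t ^+ 2));
    last exact: exprn_continuous.
  apply: (@continuous_comp _ _ _ (fun y : 'rV[R]_d => y - x) (fun y : 'rV[R]_d => y 0 i));
    last exact: coord_continuous.
  by apply: continuousB; [exact: cvg_id|exact: cst_continuous].
by apply/seteqP; split => y /=; rewrite in_itv.
Qed.

End enorm.

(** * Cubes and the discretization of a regular measure *)

Section grid.
Context {R : realType} {d : nat}.
Variables (M : R).

(* The cube [-M, M]^d is covered by the half-open cubes of side ep with lower
   corners in - M + ep N^d; each coordinate has gridN ep values. *)
Definition gridN (ep : R) : nat := (Num.truncn (2 * M / ep)).+1.

Definition corner (ep : R) (k : nat) : R := k%:R * ep - M.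

Definition cube (ep : R) (z : {ffun 'I_d -> 'I_(gridN ep)}) : set 'rV[R]_d :=
  [set y | forall i, corner ep (z i) <= y 0 i < corner ep (z i) + ep].

Lemma corner_bound (ep : R) (k : 'I_(gridN ep)) : 0 <= M -> 0 < ep -> `|corner ep k| <= M.
Proof.
move=> M0 e0; rewrite ler_norml /corner; apply/andP; split.
  by rewrite lerBrDr addrC subrr mulr_ge0// ltW.
suff : k%:R * ep <= 2 * M by lra.
rewrite -ler_pdivlMr//.
have := ltn_ord k; rewrite /gridN ltnS => kN.
apply: (@le_trans _ _ (Num.truncn (2 * M / ep))%:R); first by rewrite ler_nat.
by rewrite truncn_le divr_ge0 ?mulr_ge0// ltW.
Qed.

Lemma cube_cover (ep : R) (y : 'rV[R]_d) : 0 < ep -> (forall i, - M <= y 0 i <= M) ->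
  exists z : {ffun 'I_d -> 'I_(gridN ep)}, cube z y.
Proof.
move=> e0 yM.
exists [ffun i => inord (Num.truncn ((y 0 i + M) / ep))] => i; rewrite ffunE.
have /andP[y1 y2] := yM i.
have q0 : 0 <= (y 0 i + M) / ep by rewrite divr_ge0 ?(ltW e0)// addrC -lerBlDl sub0r.
rewrite inordK; last first.
  rewrite /gridN ltnS le_truncn// ler_wpM2r ?invr_ge0 ?(ltW e0)//; lra.
rewrite /corner; have /andP[t1 t2] := truncn_itv q0.
move: t1 t2; rewrite ler_pdivlMr// ltr_pdivrMr// => t1 t2.
rewrite -natr1 in t2; apply/andP; split; lra.
Qed.

Lemma cube_inj (ep : R) (z z' : {ffun 'I_d -> 'I_(gridN ep)}) y : 0 < ep ->
  cube z y -> cube z' y -> z = z'.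
Proof.
move=> e0 zy zy'; apply/ffunP => i; apply/val_inj => /=.
have := zy i; have := zy' i; rewrite /corner => /andP[a1 a2] /andP[b1 b2].
have h1 : (z i)%:R * ep < (z' i).+1%:R * ep by rewrite -natr1; lra.
have h2 : (z' i)%:R * ep < (z i).+1%:R * ep by rewrite -natr1; lra.
move: h1 h2; rewrite !ltr_pM2r// !ltr_nat !ltnS => h1 h2.
by apply/eqP; rewrite eqn_leq h1 h2.
Qed.

Lemma measurable_cube (ep : R) (z : {ffun 'I_d -> 'I_(gridN ep)}) :
  measurable (cube z : set borel_rV).
Proof.
rewrite (_ : cube z = ~` [set y | exists i : 'I_d, xpredT i /\
    ~ (corner ep (z i) <= y 0 i < corner ep (z i) + ep)]).
  apply: measurableC.
  apply: (@measurable_exists_fin _ borel_rV _ _ (fun i => [set y | ~ (corner ep (z i) <= y 0 i < corner ep (z i) + ep)])).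
  by move=> i _; apply: measurableC; exact: measurable_coord_itv.
apply/seteqP; split => y /=; first by move=> zy [i [_]]; apply; exact: zy.
by move=> h i; apply: contrapT => hi; apply: h; exists i.
Qed.

Definition near_index (ep : R) (z' : {ffun 'I_d -> 'I_(gridN ep)}) :=
  [pred z : {ffun 'I_d -> 'I_(gridN ep)} |
    [forall i, (z i <= (z' i).+1)%N && (z' i <= (z i).+1)%N]].

Lemma card_near_index (ep : R) (z' : {ffun 'I_d -> 'I_(gridN ep)}) :
  (#|near_index z'| <= 3 ^ d)%N.
Proof.
(* The added 1 keeps the subtraction of naturals from truncating: the values lie in {0, 1, 2} and
   determine z i. *)
pose f (z : {ffun 'I_d -> 'I_(gridN ep)}) : {ffun 'I_d -> 'I_3} :=
  [ffun i => inord ((z i).+1 - z' i)].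
have -> : (3 ^ d = #|{ffun 'I_d -> 'I_3}|)%N by rewrite card_ffun !card_ord.
rewrite -(@card_in_imset _ _ f (near_index z')); first exact: max_card.
move=> z1 z2 /forallP h1 /forallP h2 /ffunP fE.
apply/ffunP => i; apply/val_inj => /=.
have := fE i; rewrite !ffunE => /(congr1 val) /=.
have /andP[p1 p2] := h1 i; have /andP[q1 q2] := h2 i.
rewrite !inordK.
- move=> e; apply/eqP; rewrite -eqSS; apply/eqP.
  by rewrite -(subnK p2) -(subnK q2) e.
- by rewrite ltn_subLR ?(leq_trans q1)// ?addnS ?ltnS ?addn2 ?addn1//; rewrite (leq_trans q1)// addnC.
- by rewrite ltn_subLR ?(leq_trans p1)// ?addnS ?ltnS ?addn2 ?addn1//; rewrite (leq_trans p1)// addnC.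
Qed.

Variables (F : set 'rV[R]_d) (gam : R).
Hypothesis FM : forall x, F x -> forall i, - M <= x 0 i <= M.

(* w z is the mass of the cube z. *)
Lemma ahlfors_grid : 0 < gam -> ahlfors_regular gam F ->
  exists m0 C : R, [/\ 0 < m0, 0 < C & forall ep, 0 < ep -> ep <= 1 ->
    exists w : {ffun 'I_d -> 'I_(gridN ep)} -> R, [/\
      (forall z, 0 <= w z), \sum_z w z = m0,
      (forall z, 0 < w z -> exists x, F x /\ cube z x),
      (forall z rho, 0 < w z -> ep <= rho ->
        \sum_(z' : {ffun 'I_d -> 'I_(gridN ep)} | [forall i, `|corner ep (z' i) - corner ep (z i)| <= rho]) w z' <= C * rho `^ gam) &
      #|[pred z : {ffun 'I_d -> 'I_(gridN ep)} | `[< exists x, F x /\ cube z x >]]|%:R <= C * (ep `^ gam)^-1]].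
Proof.
move=> g0 [nu [c [c0 nuT [N0 [mN0 nuN0 FN0]] nuF]]].
have nuE A : measurable A -> (nu A = (fine (nu A))%:E)%E.
  by move=> mA; rewrite fineK//; exact: fin_num_measure.
(* The complement of F lies in the null set [N0], so inclusions only need to hold off [N0]. *)
have nuU A B : measurable A -> measurable B -> A `<=` B `|` N0 -> (nu A <= nu B)%E.
  move=> mA mB AB; apply: (@le_trans _ _ (nu (B `|` N0))).
    by apply: le_measure => //; rewrite inE//; exact: measurableU.
  apply: (le_trans (measureU2 nu mB mN0)).
  by rewrite [X in (_ + X)%E]nuN0 adde0.
pose m0 := fine (nu setT).
have m00 : 0 < m0 by rewrite -lte_fin -nuE.
(* Points of two cubes of side ep <= rho whose corners differ by at most rho differ by at most 2 rho
   per coordinate, hence by at most 2 d rho in [enorm]; the added 1 gives the strict inequality of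
   an open ball. *)
pose kap : R := 2 * d%:R + 1.
have kap0 : 0 < kap by rewrite ltr_wpDl// mulr_ge0.
(* m0 serves the radii kap rho > 1, where regularity says nothing; the last term is for the number
   of cubes meeting F. *)
pose C := (c + m0) * kap `^ gam + 3 ^+ d * m0 * c.
have C1 : 0 < (c + m0) * kap `^ gam by rewrite mulr_gt0 ?powR_gt0// addr_gt0.
have C2 : 0 <= 3 ^+ d * m0 * c by rewrite !mulr_ge0 ?exprn_ge0 ?(ltW m00) ?(ltW c0).
exists m0, C; split => //; first by rewrite ltr_pwDl.
move=> ep e0 e1; pose w (z : {ffun 'I_d -> 'I_(gridN ep)}) := fine (nu (cube z)).
have mc := @measurable_cube ep.
have wE z : (nu (cube z) = (w z)%:E)%E by exact: nuE.
have w0 z : 0 <= w z by rewrite -lee_fin -wE measure_ge0.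
have nuQ (Q : pred {ffun 'I_d -> 'I_(gridN ep)}) :
    (nu [set x | exists z, Q z /\ cube z x] = (\sum_(z | Q z) w z)%:E)%E.
  rewrite measure_exists_fin//.
    by rewrite -sumEFin; apply: eq_bigr => z _; exact: wE.
  move=> z z' zz'; apply/seteqP; split => // y [zy zy'].
  by move/eqP: zz'; apply; exact: (cube_inj e0 zy zy').
have mQ (Q : pred {ffun 'I_d -> 'I_(gridN ep)}) :
    measurable ([set x | exists z, Q z /\ cube z x] : set borel_rV).
  exact: (@measurable_exists_fin _ borel_rV).
have Fcov x : ~ N0 x -> exists z : {ffun 'I_d -> 'I_(gridN ep)}, F x /\ cube z x.
  move=> nx; have Fx : F x by apply: contrapT => nFx; apply: nx; apply: FN0.
  by have [z zx] := cube_cover e0 (FM Fx); exists z.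
have wm0 : \sum_z w z = m0.
  apply/eqP; rewrite eq_le -!lee_fin.
  have mT := nuE _ (@measurableT _ borel_rV); rewrite -/m0 in mT.
  rewrite -mT -(nuQ xpredT); apply/andP; split.
    by apply: le_measure => //; rewrite inE.
  apply: nuU => // x _; have [xN|xN] := pselect (N0 x); first by right.
  by left; have [z [_ zx]] := Fcov _ xN; exists z.
exists w; split => //.
- move=> z wz; apply: contrapT => nex.
  have : (nu (cube z) <= nu set0)%E.
    apply: nuU => // x zx; right; apply: FN0 => /= Fx.
    by apply: nex; exists x.
  by rewrite measure0 wE lee_fin leNgt wz.
- move=> z rho wz erho.
  have rho0 : 0 < rho by exact: lt_le_trans erho.
  have rg : 0 <= rho `^ gam by exact: powR_ge0.
  have [x [Fx zx]] : exists x, F x /\ cube z x.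
    apply: contrapT => nex.
    have : (nu (cube z) <= nu set0)%E.
      apply: nuU => // x zx; right; apply: FN0 => /= Fx.
      by apply: nex; exists x.
    by rewrite measure0 wE lee_fin leNgt wz.
  rewrite -lee_fin -nuQ.
  apply: (@le_trans _ _ ((c + m0) * kap `^ gam * rho `^ gam)%:E); last first.
    by rewrite lee_fin ler_wpM2r// lerDl.
  have -> : (c + m0) * kap `^ gam * rho `^ gam = (c + m0) * (kap * rho) `^ gam.
    by rewrite powRM ?(ltW kap0) ?(ltW rho0)// mulrA.
  have [kr|kr] := leP (kap * rho) 1.
    have kr0 : 0 < kap * rho <= 1 by rewrite mulr_gt0.
    have /andP[_ h] := nuF x (kap * rho) Fx kr0.
    apply: (@le_trans _ _ (nu (eball x (kap * rho)))).
      apply: le_measure; rewrite ?inE//; first exact: measurable_eball.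
      move=> y [z' [/forallP zz' zy']]; rewrite /eball /=.
      apply: (@le_lt_trans _ _ (d%:R * (2 * rho))).
        apply: enorm_le => [|i]; first by rewrite mulr_ge0// ltW.
        have := zz' i; have := zx i; have := zy' i.
        rewrite !mxE !ler_norml => /andP[a1 a2] /andP[b1 b2] /andP[c1' c2].
        by apply/andP; split; lra.
      by rewrite (_ : d%:R * (2 * rho) = kap * rho - rho) ?gtrBl// /kap; ring.
    apply: (le_trans h); rewrite lee_fin ler_wpM2r ?powR_ge0// lerDl ltW//.
  apply: (@le_trans _ _ (nu setT)); first by apply: le_measure; rewrite ?inE.
  rewrite (nuE _ (@measurableT _ borel_rV)) -/m0 lee_fin -[leLHS]mulr1.
  apply: ler_pM => //; [exact: ltW|by rewrite lerDr ltW|].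
  have e : 1 `^ gam = 1 :> R by rewrite powR1.
  by rewrite -[leLHS]e ge0_ler_powR ?nnegrE ?(ltW g0) ?(ltW kr) ?mulr_ge0 ?(ltW kap0) ?(ltW rho0).
- set Q := [pred z | _].
  have eg : 0 < ep `^ gam by exact: powR_gt0.
  rewrite ler_pdivlMr//.
  (* Counting: the ball of radius ep about a point of F in z is covered, up to a null set, by z and
     its neighbours, and each cube is a neighbour of at most 3^d cubes. *)
  have key z : Q z -> c^-1 * ep `^ gam <= \sum_(z' in near_index z) w z'.
    move=> /asboolP[x [Fx zx]].
    have e01 : 0 < ep <= 1 by rewrite e0.
    have /andP[h _] := nuF x ep Fx e01.
    rewrite -lee_fin -nuQ; apply: (le_trans h); apply: nuU => //; first exact: measurable_eball.
    move=> y xy; have [yN|yN] := pselect (N0 y); first by right.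
    left; have [z' [Fy zy']] := Fcov _ yN; exists z'; split => //.
    apply/forallP => i; have := zx i; have := zy' i; rewrite /corner => /andP[a1 a2] /andP[b1 b2].
    have := coord_le_enorm (y - x) i; rewrite !mxE => h1.
    have : `|y 0 i - x 0 i| < ep by exact: le_lt_trans h1 xy.
    rewrite ltr_norml => /andP[d1 d2].
    have k1 : (z' i)%:R * ep < (z i).+2%:R * ep by rewrite -!natr1; lra.
    have k2 : (z i)%:R * ep < (z' i).+2%:R * ep by rewrite -!natr1; lra.
    by move: k1 k2; rewrite !ltr_pM2r// !ltr_nat !ltnS => -> ->.
  have : \sum_(z | Q z) (c^-1 * ep `^ gam) <= \sum_(z | Q z) \sum_(z' in near_index z) w z'.
    exact: ler_sum.
  rewrite sumr_const -[leLHS]mulr_natl => le1.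
  have le2 : \sum_(z | Q z) \sum_(z' in near_index z) w z' <= 3 ^+ d * m0.
    apply: (@le_trans _ _ (\sum_z \sum_(z' in near_index z) w z')).
      rewrite big_mkcond/=; apply: ler_sum => z _; case: ifP => // _.
      by apply: sumr_ge0 => z' _.
    rewrite (exchange_big_dep xpredT)//=.
    rewrite -wm0 mulr_sumr; apply: ler_sum => z' _.
    rewrite sumr_const -[leLHS]mulr_natl ler_wpM2r// -natrX ler_nat.
    apply: leq_trans (card_near_index z'); apply: subset_leq_card; apply/fintype.subsetP => z.
    rewrite !inE => /forallP h; apply/forallP => i; have /andP[h1 h2] := h i.
    by rewrite h1 h2.
  have := le_trans le1 le2; rewrite mulrCA ler_pdivrMl//.
  move=> h; apply: (@le_trans _ _ (c * (3 ^+ d * m0))) => //.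
  by rewrite mulrC /C lerDr ltW.
Qed.

End grid.

(** * Approximation and measurability of the hitting event *)

Section near_hit.
Context {dT : measure_display} {T : measurableType dT} {R : realType} (P : probability T R).
Variables (d : nat) (g : 'I_d -> R -> T -> R) (a b M : R) (E : set R) (F : set 'rV[R]_d).
Hypotheses (EI : E `<=` `[a, b]) (cE : compact E) (cF : compact F).
Hypothesis a0 : 0 < a.
Hypothesis FM : forall x, F x -> forall i, - M <= x 0 i <= M.
Hypothesis mg : forall i t, E t -> measurable_fun setT (g i t).
Hypothesis cg : forall w i t, E t -> forall e, 0 < e -> exists2 dl, 0 < dl &
  forall s, E s -> `|s - t| < dl -> `|g i s w - g i t w| < e.

Definition near_hit (r : R) : set T :=
  [set w | exists t x, [/\ E t, F x & forall i, `|g i t w - x 0 i| < r]].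

Definition exact_hit : set T :=
  [set w | exists t x, [/\ E t, F x & forall i, g i t w = x 0 i]].

(** Pairs in E x F realizing ever closer approaches have a cluster point there by compactness, and
    continuity of the paths on E makes it an exact hit. *)
Lemma exact_hitE : exact_hit = \bigcap_n near_hit n.+1%:R^-1.
Proof.
apply/seteqP; split => [w [t [x [Et Fx tx]]] n _|w nw].
  by exists t, x; split => // i; rewrite tx subrr normr0.
have /choice[tx Htx] : forall n : nat, exists z : R * 'rV[R]_d,
    [/\ E z.1, F z.2 & forall i, `|g i z.1 w - z.2 0 i| < n.+1%:R^-1].
  by move=> n; have [t [x h]] := nw n I; exists (t, x).
have cEF : compact (E `*` F) by exact: compact_setX.
have [|[t x] [[/= Et Fx] cl]] := cEF (tx @ \oo) _ _.
  by exists 0%N => // n _; have [] := Htx n.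
exists t, x; split => // i; apply/eqP; rewrite -subr_eq0 -normr_le0.
apply/ler_addgt0Pl => e e0; rewrite addr0.
have e3 : 0 < e / 3 by rewrite divr_gt0.
have [dl d0 Hdl] := cg w i Et e3.
have /cl : (tx @ \oo) [set z | exists n : nat, z = tx n /\ n.+1%:R^-1 < e / 3].
  have [N _ HN] : \forall n \near \oo, n.+1%:R^-1 < e / 3 by exact: near_infty_natSinv_lt (PosNum e3).
  by exists N => // n Nn; exists n; split => //; exact: HN.
have nB : nbhs (t, x) (ball t dl `*` ball x (e / 3)).
  by exists (ball t dl, ball x (e / 3)) => //=; split; exact: nbhsx_ballx.
move=> /(_ _ nB)[z [[n [zE nE]] [/= z1 [_ z2]]]].
have [E1 F1 H1] := Htx n; rewrite -zE in E1 F1 H1.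
have h1 : `|g i z.1 w - g i t w| < e / 3.
  by apply: Hdl => //; rewrite distrC.
have h2 : `|x 0 i - z.2 0 i| < e / 3 by have := z2 0 i.
have h3 := lt_trans (H1 i) nE.
rewrite (_ : g i t w - x 0 i = (g i t w - g i z.1 w) + (g i z.1 w - z.2 0 i) + (z.2 0 i - x 0 i)); last by ring.
apply: (le_trans (ler_normD _ _)); apply: (le_trans (lerD (ler_normD _ _) (lexx _))).
rewrite [`|g i t w - _|]distrC [`|z.2 0 i - _|]distrC; lra.
Qed.

(* The default value 0 is not in E, so E (time_point n k) holds exactly when E meets
   the cell. *)
Definition time_point (n k : nat) : R :=
  xget 0 [set t | E t /\ k%:R / n.+1%:R <= t < k.+1%:R / n.+1%:R].

(** Unlike for times, the default 0 may lie in F, so F (space_point z) does not imply that F meets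
    the cube z. [near_hitE] only needs the point itself to be in F. *)
Definition space_point (ep : R) (z : {ffun 'I_d -> 'I_(gridN M ep)}) : 'rV[R]_d :=
  xget 0 [set x | F x /\ cube z x].

Lemma time_point_close t n : E t -> exists k, E (time_point n k) /\ `|time_point n k - t| < n.+1%:R^-1.
Proof.
move=> Et; have t0 : 0 < t by have := EI Et; rewrite /= in_itv/= => /andP[at_ _]; exact: lt_le_trans at_.
pose k := Num.truncn (t * n.+1%:R).
have n0 : 0 < n.+1%:R :> R by rewrite ltr0n.
have /andP[k1 k2] : k%:R <= t * n.+1%:R < k.+1%:R by apply: truncn_itv; rewrite mulr_ge0 ?(ltW t0).
have tk : [set t | E t /\ k%:R / n.+1%:R <= t < k.+1%:R / n.+1%:R] t.
  by split => //; rewrite ler_pdivrMr// ltr_pdivlMr// k1 k2.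
exists k; rewrite /time_point; case: xgetP => [s _ [Es /andP[s1 s2]]|/(_ t)//].
split => //; move: tk => [_ /andP[t1 t2]].
have e : k.+1%:R / n.+1%:R = k%:R / n.+1%:R + n.+1%:R^-1 :> R by rewrite -[k.+1%:R]natr1 mulrDl mul1r.
rewrite e in s2 t2; move: s1 s2 t1 t2; move: (k%:R / n.+1%:R) => p; move: (n.+1%:R^-1) => q s1 s2 t1 t2.
by rewrite ltr_norml; apply/andP; split; lra.
Qed.

Lemma space_point_close x (ep : R) : 0 < ep -> F x ->
  exists z : {ffun 'I_d -> 'I_(gridN M ep)}, F (space_point z) /\ forall i, `|space_point z 0 i - x 0 i| < ep.
Proof.
move=> e0 Fx; have [z zx] := cube_cover e0 (FM Fx); exists z.
rewrite /space_point; case: xgetP => [y _ [Fy zy]|/(_ x)[]//]; split => // i.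
have := zx i; have := zy i => /andP[h1 h2] /andP[h3 h4].
by rewrite ltr_norml; apply/andP; split; lra.
Qed.

(* Countably many times and points suffice, by continuity of the paths; this is
   where measurability of the hitting events comes from. *)
Lemma near_hitE r : 0 < r -> near_hit r = \bigcup_n \bigcup_k \bigcup_m
  [set w | exists z : {ffun 'I_d -> 'I_(gridN M (m.+1%:R^-1 : R))},
     `[< E (time_point n k) /\ F (space_point z) >] /\
     ~ exists i, xpredT i /\ ~ (`|g i (time_point n k) w - space_point z 0 i| < r)].
Proof.
move=> r0; apply/seteqP; split => w; last first.
  move=> [n _ [k _ [m _ [z [/asboolP[Et Fx] h]]]]].
  exists (time_point n k), (space_point z); split => // i.
  by apply: contrapT => hi; apply: h; exists i.
move=> [t [x [Et Fx tx]]].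
(* A slack common to all coordinates; the maximum starts from r / 2, which keeps it below r and
   defined for every d. *)
have [e e0 He] : exists2 e : R, 0 < e & forall i, `|g i t w - x 0 i| + 2 * e <= r.
  exists ((r - \big[Num.max/(r / 2)]_(i < d) `|g i t w - x 0 i|) / 2).
    rewrite divr_gt0// subr_gt0; elim/big_ind : _ => [|p q pr qr|i _].
    - by lra.
    - by rewrite gt_max pr.
    - exact: tx.
  move=> i; have : `|g i t w - x 0 i| <= \big[Num.max/(r / 2)]_(i < d) `|g i t w - x 0 i|.
    exact: (le_bigmax _ (fun i => `|g i t w - x 0 i|)).
  lra.
have [dl d0 Hdl] : exists2 dl, 0 < dl & forall i s, E s -> `|s - t| < dl -> `|g i s w - g i t w| < e.
  have /choice[h Hh] : forall i : 'I_d, exists dl : R, 0 < dl /\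
      forall s, E s -> `|s - t| < dl -> `|g i s w - g i t w| < e.
    by move=> i; have [dl] := cg w i Et e0; exists dl.
  exists (\big[Num.min/1]_(i < d) h i).
    by elim/big_ind : _ => // [p q p0 q0|i _]; [rewrite lt_min p0|have [] := Hh i].
  move=> i s Es st; have [_] := Hh i; apply => //; apply: (lt_le_trans st).
  exact: bigmin_le_cond.
have [n nd] : exists n : nat, n.+1%:R^-1 < dl.
  by have [N _ HN] := near_infty_natSinv_lt (PosNum d0); exists N; apply: HN => /=.
have [m me] : exists n : nat, n.+1%:R^-1 < e.
  by have [N _ HN] := near_infty_natSinv_lt (PosNum e0); exists N; apply: HN => /=.
have [k [Ek kt]] := time_point_close n Et.
have m0 : 0 < m.+1%:R^-1 :> R by rewrite invr_gt0 ltr0n.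
have [z [Fz zx]] := space_point_close m0 Fx.
exists n => //; exists k => //; exists m => //; exists z; split; first by apply/asboolP.
move=> [i [_]]; apply.
have h1 := Hdl i _ Ek (lt_trans kt nd).
have h2 := lt_trans (zx i) me.
rewrite (_ : _ - _ = (g i (time_point n k) w - g i t w) + (g i t w - x 0 i) + (x 0 i - space_point z 0 i)); last by ring.
apply: (le_lt_trans (ler_normD _ _)); apply: (le_lt_trans (lerD (ler_normD _ _) (lexx _))).
rewrite [`|x 0 i - _|]distrC; have := He i; lra.
Qed.

Lemma measurable_near_hit r : 0 < r -> measurable (near_hit r).
Proof.
move=> r0; rewrite near_hitE//; apply: bigcup_measurable => n _; apply: bigcup_measurable => k _.
apply: bigcup_measurable => m _.
apply: (@measurable_exists_fin _ _ _ _ (fun z => ~` [set w | exists i, xpredT i /\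
   ~ (`|g i (time_point n k) w - space_point z 0 i| < r)])) => z /asboolP[Et _].
apply: measurableC.
apply: (@measurable_exists_fin _ _ _ _ (fun i => [set w |
   ~ (`|g i (time_point n k) w - space_point z 0 i| < r)])) => i _.
rewrite (_ : [set w | _] = ~` (g i (time_point n k) @^-1`
    `]space_point z 0 i - r, space_point z 0 i + r[%classic)).
  apply: measurableC; rewrite -[X in measurable X]setTI; apply: mg => //.
by apply/seteqP; split => w /=; rewrite in_itv/= ltr_distl.
Qed.

Lemma measurable_exact_hit : measurable exact_hit.
Proof. by rewrite exact_hitE; apply: bigcapT_measurable => n; apply: measurable_near_hit; rewrite invr_gt0 ltr0n. Qed.

(** Continuity of P along decreasing events: a lower bound uniform in the tolerance survives in the
    limit. *)
Lemma exact_hit_ge (p : \bar R) :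
  (forall n : nat, (p <= P (near_hit n.+1%:R^-1))%E) -> (p <= P exact_hit)%E.
Proof.
move=> pn.
have cv : P \o (fun n : nat => near_hit n.+1%:R^-1) @ \oo --> P exact_hit.
  rewrite exact_hitE; apply: nonincreasing_cvg_mu.
  - by rewrite (le_lt_trans (probability_le1 P _)) ?ltry//; apply: measurable_near_hit; rewrite invr_gt0 ltr0n.
  - by move=> n; apply: measurable_near_hit; rewrite invr_gt0 ltr0n.
  - by rewrite -exact_hitE; exact: measurable_exact_hit.
  - move=> m n mn; apply/subsetPset => w [t [x [Et Fx tx]]]; exists t, x; split => // i.
    by apply: (lt_le_trans (tx i)); rewrite lef_pV2 ?posrE ?ltr0n// ler_nat.
apply: (cvge_ge _ cv) => //.
by apply: nearW => n; exact: pn.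
Qed.

End near_hit.

(** * Lower bound *)

Section second_moment.
Context {dT : measure_display} {T : measurableType dT} {R : realType} (P : probability T R).

Lemma probability_fineE (A : set T) : measurable A -> (P A = (fine (P A))%:E)%E.
Proof. by move=> mA; rewrite fineK//; exact: fin_num_measure. Qed.

Lemma fine_probability_ge0 (A : set T) : 0 <= fine (P A).
Proof. by apply: fine_ge0; exact: measure_ge0. Qed.

Lemma indic_integrable (A : set T) : measurable A -> P.-integrable setT (EFin \o (\1_A : T -> R)).
Proof.
move=> mA; apply: (@bounded_integrable _ _ _ _ _ 1); first exact: measurable_indic.
by move=> w; rewrite indicE; case: (_ \in _); rewrite ?normr1 ?normr0.
Qed.

Lemma Rintegral_indic_sum (I : finType) (Q : pred I) (c : I -> R) (A : I -> set T) :
  (forall i, Q i -> measurable (A i)) ->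
  P.-integrable setT (EFin \o (fun w => \sum_(i | Q i) c i * \1_(A i) w)) /\
  \int[P]_w (\sum_(i | Q i) c i * \1_(A i) w) = \sum_(i | Q i) c i * fine (P (A i)).
Proof.
move=> mA.
have ii i : Q i -> P.-integrable setT (fun w => (c i * \1_(A i) w)%:E).
  by move=> Qi; exact: (integrableZl measurableT (c i) (indic_integrable (mA _ Qi))).
split.
  rewrite (_ : _ \o _ = (fun w => \sum_(i | Q i) (c i * \1_(A i) w)%:E)%E).
    exact: integrable_sum.
  by apply/funext => w /=; rewrite sumEFin.
pose h i w := if Q i then c i * \1_(A i) w else 0.
have ih i : P.-integrable setT (fun w => (h i w)%:E).
  rewrite /h; case: (boolP (Q i)) => Qi; first exact: ii.
  exact: integrable0.
transitivity (fine (\int[P]_w (\sum_i (h i w)%:E))%E).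
  by congr fine; apply: eq_integral => w _; rewrite big_mkcond -sumEFin.
rewrite integral_sum// [RHS]big_mkcond.
transitivity (fine (\sum_i (if Q i then c i * fine (P (A i)) else 0)%:E)%E); last by rewrite sumEFin.
rewrite /h.
congr fine; apply: eq_bigr => i _; case: ifP => Qi; last by rewrite integral0.
under eq_integral do rewrite EFinM.
rewrite integralZl//; last exact: indic_integrable (mA _ Qi).
have mAi := mA _ Qi.
by rewrite integral_indic// setIT EFinM -(probability_fineE mAi).
Qed.

(** Cauchy-Schwarz for the weighted sum J of the indicators and the indicator of G: J vanishes off
    G, and the mean of (J - la)^2 over G is nonnegative for every la. *)
Lemma paley_zygmund (I : finType) (Q : pred I) (c : I -> R) (A : I -> set T) :
  (forall i, Q i -> measurable (A i)) ->
  (\sum_(i | Q i) c i * fine (P (A i))) ^+ 2 <=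
  (\sum_(i | Q i) \sum_(j | Q j) c i * c j * fine (P (A i `&` A j))) *
   fine (P [set w | exists i, Q i /\ A i w]).
Proof.
move=> mA; set G := [set w | _].
have mG : measurable G by exact: measurable_exists_fin.
set g := fine (P G).
pose S1 := \sum_(i | Q i) c i * fine (P (A i)).
pose S2 := \sum_(i | Q i) \sum_(j | Q j) c i * c j * fine (P (A i `&` A j)).
rewrite -/S1 -/S2.
have g0 : 0 <= g by exact: fine_probability_ge0.
have key (la : R) : 0 <= S2 - 2 * la * S1 + la ^+ 2 * g.
  have [i1 e1] := Rintegral_indic_sum c mA.
  have mAA (ij : I * I) : Q ij.1 && Q ij.2 -> measurable (A ij.1 `&` A ij.2).
    by move=> /andP[Qi Qj]; apply: measurableI; exact: mA.
  have [i2 e2] := Rintegral_indic_sum (fun ij : I * I => c ij.1 * c ij.2) mAA.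
  have iG := indic_integrable mG.
  have eG : \int[P]_w (\1_G w : R) = g by rewrite /Rintegral integral_indic// setIT.
  have eS2 : S2 = \sum_(ij : I * I | Q ij.1 && Q ij.2) c ij.1 * c ij.2 * fine (P (A ij.1 `&` A ij.2)).
    by rewrite /S2 (pair_big Q Q (fun i j => c i * c j * fine (P (A i `&` A j)))).
  rewrite eS2 -e2 /S1 -e1 -eG.
  rewrite -RintegralZl// -RintegralZl// -RintegralB//; last exact: (integrableZl measurableT _ i1).
  rewrite -RintegralD//; last 2 first.
  - exact: (integrableB measurableT i2 (integrableZl measurableT (2 * la) i1)).
  - exact: (integrableZl measurableT (la ^+ 2) iG).
  apply: Rintegral_ge0 => w _.
  set J := \sum_(i | Q i) c i * \1_(A i) w.
  have -> : \sum_(ij : I * I | Q ij.1 && Q ij.2) c ij.1 * c ij.2 * \1_(A ij.1 `&` A ij.2) w = J ^+ 2.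
    rewrite /J expr2 big_distrlr/= pair_big/=; apply: eq_bigr => -[i j] _ /=.
    by rewrite indicI /=; ring.
  have -> : J = J * \1_G w.
    rewrite /J mulr_suml; apply: eq_bigr => i Qi; rewrite !indicE.
    have [wA|wA] := boolP (w \in A i); last by rewrite mulr0 mul0r.
    by rewrite mulr1 mem_set ?mulr1//; exists i; split => //; rewrite inE in wA.
  have -> : (J * \1_G w) ^+ 2 - 2 * la * (J * \1_G w) + la ^+ 2 * \1_G w = (J - la) ^+ 2 * \1_G w.
    by rewrite indicE; case: (_ \in _) => /=; ring.
  by rewrite mulr_ge0 ?sqr_ge0.
have S20 : 0 <= S2 by have := key 0; rewrite expr0n/= mulr0 !mul0r subr0 addr0.
move: g0; rewrite le_eqVlt => /predU1P[g0|g0].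
  rewrite -g0 mulr0; have [->|S10] := eqVneq S1 0; first by rewrite expr0n.
  (* When G is null the expression is affine in la, which forces S1 = 0: this la would give the
     value - 1. *)
  have := key ((S2 + 1) / (2 * S1)); rewrite -g0 mulr0 addr0.
  have -> : 2 * ((S2 + 1) / (2 * S1)) * S1 = S2 + 1 by field.
  lra.
have := key (S1 / g).
have -> : S2 - 2 * (S1 / g) * S1 + (S1 / g) ^+ 2 * g = (S2 * g - S1 ^+ 2) / g.
  by field; rewrite gt_eqF.
by rewrite ler_pdivlMr// mul0r subr_ge0.
Qed.

End second_moment.

Section independence.
Context {dT : measure_display} {T : measurableType dT} {R : realType} (P : probability T R).
Variables (H : R) (d : nat) (B : 'I_d -> R -> T -> R).
Hypothesis fB : fbm_vec P H B.

Let I01 : set R := `[0, 1]%classic.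

Lemma process_generator i t (C : set R) : 0 <= t <= 1 -> measurable C ->
  process_sigma_algebra I01 (B i) (B i t @^-1` C).
Proof.
by move=> t01 mC; apply: sub_gen_smallest; exists t, C; split => //; rewrite /I01 /= in_itv.
Qed.

Lemma process_setI i (A A' : set T) : process_sigma_algebra I01 (B i) A ->
  process_sigma_algebra I01 (B i) A' -> process_sigma_algebra I01 (B i) (A `&` A').
Proof.
move=> hA hA'; rewrite -[A `&` A']setCK setCI; apply: sigma_algebraC; rewrite -bigcup2E.
apply: sigma_algebra_bigcup => -[|[|n]] /=; last exact: sigma_algebra0.
  exact: sigma_algebraC.
exact: sigma_algebraC.
Qed.

Lemma independent_prod (A : 'I_d -> set T) :
  (forall i, process_sigma_algebra I01 (B i) (A i)) -> (forall i, measurable (A i)) ->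
  fine (P [set w | forall i, A i w]) = \prod_(i < d) fine (P (A i)).
Proof.
move=> hA mA; have [_ /(_ A hA) h] := fB.
have -> : [set w | forall i, A i w] = \bigcap_i A i.
  by apply/seteqP; split => w h' i; [move=> _; exact: h'|exact: h'].
rewrite h (eq_bigr (fun i => (fine (P (A i)))%:E)); last by move=> i _; exact: probability_fineE.
by rewrite prodEFin.
Qed.

Lemma measurable_forall_fin (A : 'I_d -> set T) : (forall i, measurable (A i)) ->
  measurable [set w | forall i, A i w].
Proof.
move=> mA; have -> : [set w | forall i, A i w] = \bigcap_i A i.
  by apply/seteqP; split => w h' i; [move=> _; exact: h'|exact: h'].
by apply: fin_bigcap_measurable => //; exact: finite_finset.
Qed.

End independence.

(** * Probabilities that the path lies in given cubes *)

Section cell_events.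
Context {R : realType}.
Variables (H a b M K : R) (d : nat).
Hypotheses (H0 : 0 < H) (H1 : H < 1) (a0 : 0 < a) (ab : a < b) (b1 : b <= 1).
Hypotheses (M0 : 0 <= M) (K0 : 0 <= K).

Let a1 : a < 1. Proof. exact: lt_le_trans ab b1. Qed.

(** All that the estimates know about f, in coordinates, so that the constants depend on f only
    through K. *)
Definition drift (f : R -> 'rV[R]_d) :=
  (forall t, a <= t <= b -> forall i, `|f t 0 i| <= K) /\
  (forall s t, a <= s <= b -> a <= t <= b -> forall i,
    `|f t 0 i - f s 0 i| <= K * `|t - s| `^ H).

Definition cell_event {T : Type} (B : 'I_d -> R -> T -> R) (f : R -> 'rV[R]_d) (ep t : R)
    (z : {ffun 'I_d -> 'I_(gridN M ep)}) : set T :=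
  [set w | forall i, corner M ep (z i) <= B i t w + f t 0 i < corner M ep (z i) + ep].

Let tab1 t : a <= t <= b -> a <= t <= 1.
Proof. by move=> /andP[-> tb]; exact: le_trans b1. Qed.

Let tab01 t : a <= t <= b -> 0 <= t <= 1.
Proof. by move=> /tab1 /andP[ta ->]; rewrite (le_trans (ltW a0)). Qed.

Section one_process.
Context {dT : measure_display} {T : measurableType dT} (P : probability T R).
Variables (B : 'I_d -> R -> T -> R) (f : R -> 'rV[R]_d).
Hypotheses (fB : fbm_vec P H B) (hf : drift f).

(** The drift is moved into the interval, which leaves an event of the i-th component alone, as
    independence requires. *)
Definition coord_event ep t (z : {ffun 'I_d -> 'I_(gridN M ep)}) i : set T :=
  B i t @^-1` `[corner M ep (z i) - f t 0 i, corner M ep (z i) - f t 0 i + ep[%classic.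

Lemma cell_eventE ep t z : cell_event B f t z = [set w | forall i, @coord_event ep t z i w].
Proof.
by apply/seteqP; split => w h i; have := h i; rewrite /coord_event/= in_itv/= => /andP[h1 h2];
  apply/andP; split; lra.
Qed.

Lemma coord_event_alg ep t z i : a <= t <= b ->
  process_sigma_algebra `[0, 1]%classic (B i) (@coord_event ep t z i).
Proof. by move=> /tab01 t01; apply: process_generator => //; exact: measurable_itv. Qed.

Lemma measurable_coord_event ep t z i : a <= t <= b -> measurable (@coord_event ep t z i).
Proof.
move=> /tab01 t01; rewrite -[X in measurable X]setTI.
by apply: (measurable_fbm (fB.1 i) t01) => //; exact: measurable_itv.
Qed.

Lemma measurable_cell_event ep t (z : {ffun 'I_d -> 'I_(gridN M ep)}) : a <= t <= b ->
  measurable (cell_event B f t z).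
Proof.
by move=> tab; rewrite cell_eventE; apply: measurable_forall_fin => i; exact: measurable_coord_event.
Qed.

Lemma corner_drift ep t (k : 'I_(gridN M ep)) i : 0 < ep -> a <= t <= b ->
  `|corner M ep k - f t 0 i| <= M + K.
Proof.
move=> e0 tab; apply: (le_trans (ler_normB _ _)); apply: lerD; first exact: corner_bound.
exact: hf.1.
Qed.

End one_process.

Lemma cell_event_lb : exists2 c : R, 0 < c &
  forall dT (T : measurableType dT) (P : probability T R) (B : 'I_d -> R -> T -> R) f,
  fbm_vec P H B -> drift f -> forall (ep t : R) (z : {ffun 'I_d -> 'I_(gridN M ep)}),
  0 < ep -> ep <= 1 -> a <= t <= b ->
  c * ep ^+ d <= fine (P (cell_event B f t z)).
Proof.
have [c c0 Hc] := fbm_box_lb H0 a0 (M + K).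
exists (c ^+ d) => [|dT T P B f fB hf ep t z e0 e1 tab]; first by rewrite exprn_gt0.
rewrite cell_eventE (independent_prod fB); last 2 first.
- by move=> i; exact: coord_event_alg.
- by move=> i; exact: (measurable_coord_event _ fB).
rewrite -exprMn -[X in _ ^+ X]card_ord -prodr_const; apply: ler_prod => i _.
apply/andP; split; first by rewrite mulr_ge0 ?ltW.
rewrite -lee_fin -probability_fineE; last exact: (measurable_coord_event _ fB).
have := Hc _ _ _ _ _ (corner M ep (z i) - f t 0 i) _ (fB.1 i) (tab1 tab) (corner_drift hf _ _ e0 tab) e0 e1.
by congr (_ <= P _)%E; apply/seteqP; split => w; rewrite /coord_event/= in_itv.
Qed.

Lemma cell_event_ub : exists2 C : R, 0 < C &
  forall dT (T : measurableType dT) (P : probability T R) (B : 'I_d -> R -> T -> R) f,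
  fbm_vec P H B -> drift f -> forall (ep t : R) (z : {ffun 'I_d -> 'I_(gridN M ep)}),
  0 < ep -> a <= t <= b ->
  fine (P (cell_event B f t z)) <= C * ep ^+ d.
Proof.
have [C C0 HC] := fbm_box_ub H0 a0.
exists (C ^+ d) => [|dT T P B f fB hf ep t z e0 tab]; first by rewrite exprn_gt0.
rewrite cell_eventE (independent_prod fB); last 2 first.
- by move=> i; exact: coord_event_alg.
- by move=> i; exact: (measurable_coord_event _ fB).
rewrite -exprMn -[X in _ ^+ X]card_ord -prodr_const; apply: ler_prod => i _.
have mE : measurable (@coord_event _ _ B f ep t z i) by exact: (measurable_coord_event _ fB).
rewrite fine_probability_ge0/= -lee_fin -probability_fineE//.
apply: le_trans (HC _ _ _ _ _ (corner M ep (z i) - f t 0 i) _ (fB.1 i) (tab1 tab) e0).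
apply: le_measure; rewrite ?inE//.
  by apply: measurable_dist_le; exact: measurable_fbm (fB.1 i) (tab01 tab).
move=> w; rewrite /coord_event/= in_itv/= => /andP[h1 h2].
by rewrite ler_norml; apply/andP; split; lra.
Qed.

(** Independence turns [fbm_box2] into a product over coordinates. The decay factors are expressed
    through the corners, so that the later sum over z' no longer sees the drift. *)
Lemma cell_event_pair (p : nat) : exists2 C : R, 0 < C &
  forall dT (T : measurableType dT) (P : probability T R) (B : 'I_d -> R -> T -> R) f,
  fbm_vec P H B -> drift f -> forall (ep s t : R) (z z' : {ffun 'I_d -> 'I_(gridN M ep)}),
  0 < ep -> a <= s <= b -> a <= t <= b -> s != t -> ep <= `|t - s| `^ H ->
  fine (P (cell_event B f s z `&` cell_event B f t z')) <=
   C * (ep ^+ 2 / `|t - s| `^ H) ^+ d *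
   \prod_(i < d) (`|t - s| `^ H / (`|t - s| `^ H + `|corner M ep (z' i) - corner M ep (z i)|)) ^+ p.
Proof.
have MK0 : 0 <= M + K by rewrite addr_ge0.
have [C C0 HC] := fbm_box2 H0 H1 a0 a1 p MK0.
exists ((C * (1 + K) ^+ p) ^+ d) => [|dT T P B f fB hf ep s t z z' e0 sab tab st es].
  by rewrite exprn_gt0// mulr_gt0// exprn_gt0// ltr_pwDl.
set sg := `|t - s| `^ H in es *.
have sg0 : 0 < sg by exact: lt_le_trans es.
have mEs i : measurable (@coord_event _ _ B f ep s z i) by exact: (measurable_coord_event _ fB).
have mEt i : measurable (@coord_event _ _ B f ep t z' i) by exact: (measurable_coord_event _ fB).
have -> : cell_event B f s z `&` cell_event B f t z' =
    [set w | forall i, (@coord_event _ _ B f ep s z i `&` @coord_event _ _ B f ep t z' i) w].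
  rewrite !cell_eventE; apply/seteqP; split => [w [h1 h2] i|w h]; first by split.
  by split => i; have [] := h i.
rewrite (independent_prod fB); last 2 first.
- by move=> i; apply: process_setI; exact: coord_event_alg.
- by move=> i; exact: measurableI.
rewrite -exprMn -[X in _ ^+ X](card_ord d) -prodr_const -big_split/=; apply: ler_prod => i _.
rewrite fine_probability_ge0/= -lee_fin -probability_fineE//; last exact: measurableI.
pose x := corner M ep (z i) - f s 0 i; pose y := corner M ep (z' i) - f t 0 i.
apply: (@le_trans _ _ (P [set w | (`|B i s w - x| <= ep)%R /\ (`|B i t w - y| <= ep)%R])).
  apply: le_measure; rewrite ?inE//; first exact: measurableI.
    apply: measurableI; apply: measurable_dist_le.
      exact: measurable_fbm (fB.1 i) (tab01 sab).
    exact: measurable_fbm (fB.1 i) (tab01 tab).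
  move=> w; rewrite /coord_event/= !in_itv/= => -[/andP[h1 h2] /andP[h3 h4]].
  by rewrite !ler_norml; split; apply/andP; split; rewrite /x /y; lra.
have xL : `|x| <= M + K by rewrite /x; exact: (corner_drift hf _ _ e0 sab).
apply: (le_trans (HC _ _ _ _ _ _ x y _ (fB.1 i) (tab1 sab) (tab1 tab) st xL e0 es)).
rewrite lee_fin -/sg.
set D := `|corner M ep (z' i) - corner M ep (z i)|.
have D0 : 0 <= D by exact: normr_ge0.
(* Passing from y - x to the difference of the corners changes the distance by at most K sg, hence
   the factor 1 + K. *)
have k1 : sg / (sg + `|y - x|) <= (1 + K) * (sg / (sg + D)).
  rewrite mulrCA ler_wpM2l ?(ltW sg0)// -[leLHS]mul1r ler_pdivrMr; last by rewrite ltr_pwDl.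
  rewrite mulrAC ler_pdivlMr; last by rewrite ltr_pwDl.
  rewrite mul1r.
  have : D <= `|y - x| + K * sg.
    rewrite /D (_ : _ - _ = (y - x) + (f t 0 i - f s 0 i)); last by rewrite /x /y; ring.
    by apply: (le_trans (ler_normD _ _)); rewrite lerD2l; exact: hf.2.
  have : 0 <= K * `|y - x| by rewrite mulr_ge0.
  lra.
have k2 : (sg / (sg + `|y - x|)) ^+ p <= (1 + K) ^+ p * (sg / (sg + D)) ^+ p.
  rewrite -exprMn lerXn2r ?nnegrE//; first by rewrite divr_ge0 ?addr_ge0 ?(ltW sg0).
  by rewrite mulr_ge0 ?addr_ge0// divr_ge0 ?addr_ge0 ?(ltW sg0).
have -> : C * (1 + K) ^+ p * (ep ^+ 2 / sg) * (sg / (sg + D)) ^+ p =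
  C * ep ^+ 2 / sg * ((1 + K) ^+ p * (sg / (sg + D)) ^+ p) by ring.
by rewrite ler_wpM2l// divr_ge0 ?(ltW sg0)// mulr_ge0 ?sqr_ge0// ltW.
Qed.

End cell_events.

Lemma geometric_half_sum {R : realFieldType} (n : nat) : \sum_(j < n) (2^-1 : R) ^+ j <= 2.
Proof.
suff -> : \sum_(j < n) (2^-1 : R) ^+ j = 2 - 2 * 2^-1 ^+ n.
  by rewrite lerBlDr lerDl mulr_ge0// exprn_ge0.
elim: n => [|n IH]; first by rewrite big_ord0 expr0; ring.
by rewrite big_ord_recr/= IH exprS; field.
Qed.

(* Dyadic decomposition of the kernel: on the shell where the largest of the
   distances is about 2^j sg, the product is at most 2^(p - jp). *)
Lemma kernel_sum_le {R : realType} (d : nat) (Z : finType) (Q : pred Z) (w : Z -> R)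
    (D : 'I_d -> Z -> R) (sg C gam : R) :
  (forall z, 0 <= w z) -> (forall i z, 0 <= D i z) -> 0 < sg -> 0 <= C -> gam <= d%:R ->
  (forall rho, sg <= rho -> \sum_(z | [forall i, D i z <= rho]) w z <= C * rho `^ gam) ->
  \sum_(z | Q z) w z * \prod_(i < d) (sg / (sg + D i z)) ^+ d.+1 <=
    2 ^+ d.+2 * C * sg `^ gam.
Proof.
move=> w0 D0 sg0 C0 gd wC; set p := d.+1.
have [J HJ] : exists J : nat, forall i z, D i z <= 2 ^+ J * sg.
  pose L := \sum_(i < d) \sum_z D i z; exists (Num.truncn (L / sg)).+1 => i z.
  apply: (@le_trans _ _ L).
    rewrite /L (bigD1 i)//= (bigD1 z)//= -addrA lerDl.
    by rewrite addr_ge0// sumr_ge0// => j _; exact: sumr_ge0.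
  have L0 : 0 <= L / sg by rewrite divr_ge0 ?(ltW sg0)// sumr_ge0// => j _; exact: sumr_ge0.
  rewrite -ler_pdivrMr//; have /andP[_ /ltW h] := truncn_itv L0; apply: (le_trans h).
  by rewrite -natrX ler_nat ltnW// ltn_expl.
have pw z : \prod_(i < d) (sg / (sg + D i z)) ^+ p <=
    \sum_(j < J.+1) 2 ^+ p * (2^-1 ^+ j) ^+ p * [forall i, D i z <= 2 ^+ j * sg]%:R.
  have f0 i : 0 <= sg / (sg + D i z) by rewrite divr_ge0 ?addr_ge0 ?(ltW sg0).
  have f1 i : sg / (sg + D i z) <= 1 by rewrite ler_pdivrMr ?mul1r ?lerDl// ltr_pwDl.
  have exJ : exists j, [forall i, D i z <= 2 ^+ j * sg] by exists J; apply/forallP => i.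
  (* The least j locates the shell of z: unless j = 0, minimality yields a coordinate with D i z >
     2^(j - 1) sg. *)
  have [j /forallP Hj jmin] := ex_minnP exJ.
  have jJ : (j < J.+1)%N by rewrite ltnS; apply: jmin; apply/forallP.
  rewrite (bigD1 (Ordinal jJ))//= -[leLHS]addr0; apply: lerD; last first.
    apply: sumr_ge0 => k _; rewrite !mulr_ge0 ?exprn_ge0//; exact: exprn_ge0.
  have -> : [forall i, D i z <= 2 ^+ j * sg] by apply/forallP.
  rewrite mulr1; case: j Hj jmin {jJ} => [|j] Hj jmin.
    rewrite expr0 expr1n mulr1; apply: (@le_trans _ _ 1); last by rewrite exprn_ege1// ler1n.
    by apply: prodr_ile1 => i _; rewrite exprn_ge0// exprn_ile1.
  have /forallPn[i Hi] : ~~ [forall i, D i z <= 2 ^+ j * sg].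
    by apply/negP => /jmin; rewrite ltnn.
  rewrite -ltNge in Hi.
  rewrite (bigD1 i)//= -exprMn (_ : 2 * 2^-1 ^+ j.+1 = 2^-1 ^+ j :> R); last by rewrite exprS mulrA mulfV ?mul1r// pnatr_eq0.
  rewrite -[leRHS]mulr1; apply: ler_pM; rewrite ?exprn_ge0//.
  - by apply: prodr_ge0 => k _; rewrite exprn_ge0.
  - rewrite lerXn2r ?nnegrE ?exprn_ge0// ler_pdivrMr ?ltr_pwDl//.
    rewrite exprVn mulrC ler_pdivlMr ?exprn_gt0// mulrC.
    by apply: (le_trans (ltW Hi)); rewrite lerDr (ltW sg0).
  - by apply: prodr_ile1 => k _; rewrite exprn_ge0// exprn_ile1.
apply: (@le_trans _ _ (\sum_z \sum_(j < J.+1) 2 ^+ p * (2^-1 ^+ j) ^+ p *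
    (w z * [forall i, D i z <= 2 ^+ j * sg]%:R))).
  rewrite big_mkcond/=; apply: ler_sum => z _.
  apply: (@le_trans _ _ (w z * \prod_(i < d) (sg / (sg + D i z)) ^+ p)).
    case: ifP => // _; rewrite mulr_ge0// prodr_ge0// => i _.
    by rewrite exprn_ge0// divr_ge0 ?addr_ge0 ?(ltW sg0).
  apply: (le_trans (ler_wpM2l (w0 z) (pw z))); rewrite mulr_sumr; apply: ler_sum => j _.
  by rewrite mulrCA.
rewrite exchange_big/=.
apply: (@le_trans _ _ (\sum_(j < J.+1) 2 ^+ p * C * sg `^ gam * 2^-1 ^+ j)); last first.
  rewrite -mulr_sumr (exprS 2 d.+1) -/p -[2 * 2 ^+ p * C * sg `^ gam]mulrA -[2 * 2 ^+ p * _]mulrA [leRHS]mulrC [2 ^+ p * (C * _)]mulrA.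
  by rewrite ler_wpM2l ?geometric_half_sum// !mulr_ge0 ?exprn_ge0 ?powR_ge0.
apply: ler_sum => j _; rewrite -mulr_sumr.
have sj : sg <= 2 ^+ j * sg by rewrite ler_peMl ?(ltW sg0)// exprn_ege1// ler1n.
have -> : \sum_z w z * [forall i, D i z <= 2 ^+ j * sg]%:R =
    \sum_(z | [forall i, D i z <= 2 ^+ j * sg]) w z.
  by rewrite [RHS]big_mkcond/=; apply: eq_bigr => z _; case: ifP; rewrite ?mulr1 ?mulr0.
apply: (@le_trans _ _ (2 ^+ p * (2^-1 ^+ j) ^+ p * (C * (2 ^+ j * sg) `^ gam))).
  by rewrite ler_wpM2l ?wC// mulr_ge0 ?exprn_ge0//; apply: exprn_ge0.
rewrite powRM ?exprn_ge0 ?(ltW sg0)//.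
(* As gam <= d, the mass grows at most like 2^(jd); the exponent d + 1 of the product is chosen to
   leave 2^(-j). *)
have h : (2 ^+ j) `^ gam <= (2 ^+ j) ^+ d :> R.
  by rewrite -[leRHS]powR_mulrn ?exprn_ge0// ler_powR// exprn_ege1// ler1n.
have -> : 2 ^+ p * C * sg `^ gam * 2^-1 ^+ j =
    2 ^+ p * (2^-1 ^+ j) ^+ p * (C * ((2 ^+ j) ^+ d * sg `^ gam)).
  have e : (2^-1 ^+ j) ^+ p * (2 ^+ j) ^+ d = 2^-1 ^+ j :> R.
    by rewrite /p exprS -mulrA -exprMn -exprMn mulVf ?pnatr_eq0// !expr1n mulr1.
  by rewrite -[in LHS]e; ring.
rewrite ler_wpM2l ?mulr_ge0 ?exprn_ge0 ?invr_ge0//.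
by rewrite ler_wpM2l// ler_wpM2r// powR_ge0.
Qed.

(** * Energy of a measure and its discretization *)

Section energy.
Context {R : realType}.

(** True without measurability, the integral of a nonnegative function being a supremum over simple
    functions below it. This spares the measurability of the inner integral of the energy. *)
Lemma ge0_le_integralT {dT} {T : measurableType dT} (mu : {measure set T -> \bar R})
    (f1 f2 : T -> \bar R) : (forall x, (0 <= f1 x)%E) -> (forall x, (f1 x <= f2 x)%E) ->
  (\int[mu]_x f1 x <= \int[mu]_x f2 x)%E.
Proof.
move=> f10 f12.
rewrite !ge0_integralTE//; last by move=> x; exact: le_trans (f12 x).
apply: ge_ereal_sup => _ [h hf <-]; apply: ereal_sup_ubound; exists h => // x.
exact: le_trans (f12 x).
Qed.

Lemma indic_sum_le_integral {dT} {T : measurableType dT} (mu : probability T R) (I : finType)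
    (c : I -> R) (A : I -> set T) (f : T -> \bar R) :
  (forall i, 0 <= c i) -> (forall i, measurable (A i)) ->
  (forall i j, i != j -> A i `&` A j = set0) ->
  (forall x, (0 <= f x)%E) -> (forall i x, A i x -> ((c i)%:E <= f x)%E) ->
  ((\sum_i c i * fine (mu (A i)))%:E <= \int[mu]_x f x)%E.
Proof.
move=> c0 mA dA f0 cf.
have [ii <-] := @Rintegral_indic_sum _ _ _ mu _ xpredT c A (fun i _ => mA i).
rewrite -EFin_Rintegral//; apply: ge0_le_integralT => x.
  by rewrite lee_fin; apply: sumr_ge0 => i _; rewrite mulr_ge0// indicE.
have [[i Ai]|nA] := pselect (exists i, A i x); last first.
  rewrite big1// => i _; rewrite indicE memNset ?mulr0// => Ai; apply: nA; by exists i.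
rewrite (bigD1 i)//= big1 ?addr0 => [|j ji].
  by rewrite indicE mem_set// mulr1; exact: cf.
rewrite indicE memNset ?mulr0// => Aj.
have : (A j `&` A i) x by split.
by rewrite dA.
Qed.

(** For al = 0 the bound is 1, and log (e / min (r, 1)) >= log e = 1. *)
Lemma riesz_kernel_lb (al r m : R) : 0 <= al -> 0 < m -> 0 <= r -> r <= m ->
  ((m `^ (- al))%:E <= riesz_kernel al r)%E.
Proof.
move=> al0 m0 r0 rm; rewrite /riesz_kernel; case: (eqVneq r 0) => [_|rn0]; first exact: leey.
have r0' : 0 < r by rewrite lt_neqAle eq_sym rn0.
case: (eqVneq al 0) => [->|aln0]; rewrite lee_fin.
  rewrite oppr0 powRr0 -[leLHS](expRK 1) ler_ln ?posrE ?expR_gt0//.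
    rewrite ler_pdivlMr; last by rewrite lt_min r0' ltr01.
    by apply: ler_piMr; rewrite ?expR_ge0// ge_min lexx orbT.
  by rewrite divr_gt0 ?expR_gt0// lt_min r0' ltr01.
by rewrite !powRN lef_pV2 ?posrE ?powR_gt0//; apply: ge0_ler_powR; rewrite ?nnegrE ?(ltW m0).
Qed.

Lemma riesz_kernel_ge0 (al r : R) : 0 <= al -> 0 <= r -> (0 <= riesz_kernel al r)%E.
Proof.
move=> al0 r0; have h : 0 < r + 1 by rewrite ltr_wpDl.
by apply: le_trans (riesz_kernel_lb al0 h r0 _); rewrite ?lee_fin ?powR_ge0// lerDl.
Qed.

Definition time_cell (h : R) (k : nat) : set R := `[k%:R * h, k.+1%:R * h[%classic.

Lemma time_cell_disjoint (h : R) (j k : nat) : 0 < h -> j != k ->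
  time_cell h j `&` time_cell h k = set0.
Proof.
move=> h0 jk; apply/seteqP; split => // x [].
rewrite /time_cell/= !in_itv/= => /andP[a1 a2] /andP[b1 b2]; move/eqP: jk; apply.
have := le_lt_trans a1 b2; have := le_lt_trans b1 a2.
rewrite !ltr_pM2r// !ltr_nat !ltnS => c1 c2.
by apply/eqP; rewrite eqn_leq c1 c2.
Qed.

(** For u in cell l and v in cell k, |u - v| <= |t_l - t_k| + 2 h, which is at most 3 times the
    maximum of h and |t_l - t_k|. The two integrals are minorized by step functions, first in v,
    then in u. *)
Lemma energy_lb (al h : R) (N : nat) (mu : probability R R) (t : 'I_N -> R) :
  0 <= al -> 0 < h ->
  (forall k : 'I_N, 0 < fine (mu (time_cell h k)) -> time_cell h k (t k)) ->
  ((3 `^ (- al) * \sum_(k < N) \sum_(l < N) fine (mu (time_cell h k)) * fine (mu (time_cell h l)) *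
     (Num.max h `|t l - t k|) `^ (- al))%:E <= energy al mu)%E.
Proof.
move=> al0 h0 tk; set m := fun k : nat => fine (mu (time_cell h k)).
have m0 k : 0 <= m k by exact: fine_probability_ge0.
have mI k : measurable (time_cell h k) by exact: measurable_itv.
pose q k l : R := (3 * Num.max h `|t l - t k|) `^ (- al).
(* Cells of zero mass get the value 0, since [t] is controlled on the other cells only. *)
pose c (k : 'I_N) := if 0 < m k then \sum_(l < N) (if 0 < m l then q k l else 0) * m l else 0.
have -> : 3 `^ (- al) * \sum_(k < N) \sum_(l < N) m k * m l * (Num.max h `|t l - t k|) `^ (- al) =
    \sum_(k < N) c k * m k.
  rewrite mulr_sumr; apply: eq_bigr => k _; rewrite /c; case: ltP => [mk|mk]; last first.
    have -> : m k = 0 by apply/le_anti; rewrite mk m0.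
    by rewrite mulr0 big1 ?mulr0// => l _; rewrite !mul0r.
  rewrite mulr_sumr mulr_suml; apply: eq_bigr => l _; case: ltP => [ml|ml]; last first.
    have -> : m l = 0 by apply/le_anti; rewrite ml m0.
    by rewrite !(mulr0, mul0r).
  rewrite /q powRM//; first by ring.
  by rewrite le_max (ltW h0).
have dI (k l : 'I_N) : k != l -> time_cell h k `&` time_cell h l = set0.
  by move=> kl; apply: time_cell_disjoint.
have K0 (u v : R) : (0 <= riesz_kernel al `|u - v|%R)%E by exact: riesz_kernel_ge0.
apply: indic_sum_le_integral => //.
- move=> k; rewrite /c; case: ifP => // _; apply: sumr_ge0 => l _; rewrite mulr_ge0//.
  by case: ifP => // _; rewrite powR_ge0.
- by move=> v; exact: integral_ge0.
move=> k v kv; rewrite /c; case: ltP => [mk|_]; last by exact: integral_ge0.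
apply: indic_sum_le_integral => //.
  by move=> l; case: ifP => // _; rewrite powR_ge0.
move=> l u lu; case: ltP => // ml.
have M0 : 0 < Num.max h `|t l - t k| by rewrite lt_max h0.
apply: riesz_kernel_lb => //; first by rewrite mulr_gt0.
have := tk k mk; have := tk l ml; move: kv lu; rewrite /time_cell/= !in_itv/=.
rewrite -!natr1 !mulrDl !mul1r; move: (k%:R * h) (l%:R * h) => x y.
move=> /andP[v1 v2] /andP[u1 u2] /andP[tl1 tl2] /andP[tk1 tk2].
have h1 : h <= Num.max h `|t l - t k| by rewrite le_max lexx.
have h2 : `|t l - t k| <= Num.max h `|t l - t k| by rewrite le_max lexx orbT.
rewrite ler_norml in h2; have /andP[h3 h4] := h2.
by rewrite ler_norml; apply/andP; split; lra.
Qed.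

End energy.

Lemma sum_positive_weight {R : realDomainType} (I : finType) (m g : I -> R) : (forall i, 0 <= m i) ->
  \sum_(i | 0 < m i) m i * g i = \sum_i m i * g i.
Proof.
move=> m0; rewrite big_mkcond/=; apply: eq_bigr => i _; case: ltP => // mi.
have -> : m i = 0 by apply/le_anti; rewrite mi m0.
by rewrite mul0r.
Qed.

(** Here e is the order of the probability of one cell. It cancels between the squared mean, at
    least (c e m0)^2, and the second moment, at most C e^2 m0 times the sum of the [ka k l]. Only
    positive weights enter, because cells without mass may miss E or F. *)
Lemma second_moment {R : realType} {dT} {T : measurableType dT} (P : probability T R)
    (I Z : finType) (m : I -> R) (w : Z -> R) (A : I * Z -> set T) (ka : I -> I -> R)
    (c C m0 e : R) :
  (forall k, 0 <= m k) -> (forall z, 0 <= w z) -> \sum_k m k = 1 -> \sum_z w z = m0 ->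
  0 < c -> 0 < C -> 0 < m0 -> 0 < e ->
  (forall k z, 0 < m k -> measurable (A (k, z))) ->
  (forall k z, 0 < m k -> 0 < w z -> c * e <= fine (P (A (k, z)))) ->
  (forall k l z, 0 < m k -> 0 < m l -> 0 < w z ->
    \sum_(z' | 0 < w z') w z' * fine (P (A (k, z) `&` A (l, z'))) <= C * e ^+ 2 * ka k l) ->
  c ^+ 2 * m0 / C <=
    fine (P [set x | exists i, ((0 < m i.1) && (0 < w i.2)) /\ A i x]) *
    \sum_k \sum_l m k * m l * ka k l.
Proof.
move=> mp wp ms ws c0 C0 m00 e0 mA lb ub.
pose Q (i : I * Z) := (0 < m i.1) && (0 < w i.2).
have mA' i : Q i -> measurable (A i) by case: i => k z /andP[/= mk _]; exact: mA.
have := @paley_zygmund _ _ _ P _ Q (fun i => m i.1 * w i.2) A mA'.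
set pr := fine _; set S1 := (X in X ^+ 2 <= _); set S2 := \sum_(i | Q i) _; set S := \sum_k _ => pz.
have pr0 : 0 <= pr by exact: fine_probability_ge0.
have h1 : c * e * m0 <= S1.
  have -> : c * e * m0 = \sum_(i | Q i) m i.1 * w i.2 * (c * e).
    rewrite -mulr_suml mulrC; congr (_ * _).
    rewrite -(pair_big (fun k => 0 < m k) (fun z => 0 < w z) (fun k z => m k * w z))/=.
    under eq_bigr do rewrite -mulr_sumr.
    rewrite (sum_positive_weight (fun=> \sum_(z | 0 < w z) w z) mp) -mulr_suml ms mul1r -ws.
    have := sum_positive_weight (fun=> 1) wp.
    by under eq_bigr do rewrite mulr1; move=> ->; apply: eq_bigr => z _; rewrite mulr1.
  by apply: ler_sum => -[k z] /andP[/= mk wz]; rewrite ler_wpM2l ?mulr_ge0 ?lb.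
have h2 : S2 <= C * e ^+ 2 * m0 * S.
  have pE (F : I * Z -> R) : \sum_(i | Q i) F i = \sum_(k | 0 < m k) \sum_(z | 0 < w z) F (k, z).
    rewrite [RHS](pair_big (fun k => 0 < m k) (fun z => 0 < w z) (fun k z => F (k, z)))/=.
    by apply: eq_bigr => -[].
  rewrite /S2 pE/=.
  rewrite /S mulr_sumr.
  apply: (@le_trans _ _ (\sum_(k | 0 < m k) m k * (C * e ^+ 2 * m0 * \sum_(l | 0 < m l) m l * ka k l))).
    apply: ler_sum => k mk.
    apply: (@le_trans _ _ (\sum_(z | 0 < w z) w z * (m k * \sum_(l | 0 < m l) m l * (C * e ^+ 2 * ka k l)))).
      apply: ler_sum => z wz.
      rewrite pE/=.
      rewrite !mulr_sumr; apply: ler_sum => l ml.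
      apply: (@le_trans _ _ (m k * w z * m l * \sum_(z' | 0 < w z') w z' * fine (P (A (k, z) `&` A (l, z'))))).
        rewrite mulr_sumr le_eqVlt; apply/orP; left; apply/eqP; apply: eq_bigr => z' _; ring.
      rewrite [leRHS](_ : _ = m k * w z * m l * (C * e ^+ 2 * ka k l)); last by ring.
      by apply: ler_wpM2l; rewrite ?ub// !mulr_ge0.
    rewrite (sum_positive_weight (fun=> _) wp) -mulr_suml ws.
    rewrite le_eqVlt; apply/orP; left; apply/eqP.
    by rewrite !mulr_sumr; apply: eq_bigr => l _; ring.
  rewrite (sum_positive_weight _ mp) le_eqVlt; apply/orP; left; apply/eqP.
  apply: eq_bigr => k _; rewrite (sum_positive_weight _ mp) !mulr_sumr.
  by apply: eq_bigr => l _; ring.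
rewrite ler_pdivrMr// -(ler_pM2r (_ : 0 < e ^+ 2 * m0)); last by rewrite mulr_gt0 ?exprn_gt0.
apply: (@le_trans _ _ (S1 ^+ 2)).
  rewrite (_ : c ^+ 2 * m0 * (e ^+ 2 * m0) = (c * e * m0) ^+ 2); last by ring.
  by rewrite lerXn2r ?nnegrE// ?(le_trans _ h1)// !mulr_ge0 ?ltW.
apply: (le_trans pz); apply: (le_trans (ler_wpM2r pr0 h2)).
by rewrite le_eqVlt; apply/orP; left; apply/eqP; ring.
Qed.

Section time_cells.
Context {R : realType}.
Variables (E : set R) (mu : probability R R).
Hypotheses (E01 : E `<=` `[0, 1]) (muE : mu.-negligible (~` E)).

Lemma time_cell_point n k : 0 < fine (mu (time_cell n.+1%:R^-1 k)) ->
  E (time_point E n k) /\ time_cell n.+1%:R^-1 k (time_point E n k).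
Proof.
move=> mk; rewrite /time_point; case: xgetP => [t _ [Et tk]|nE].
  by split => //; rewrite /time_cell/= in_itv.
exfalso; have [N [mN N0 EN]] := muE.
have : (mu (time_cell n.+1%:R^-1 k) <= mu N)%E.
  apply: le_measure; rewrite ?inE//; first exact: measurable_itv.
  move=> t tk; apply: EN => Et; exact: (nE t).
rewrite N0 probability_fineE; last exact: measurable_itv.
by rewrite lee_fin leNgt mk.
Qed.

(** The n + 1 first cells of length 1 / (n + 1) cover [0, 1[; the cells are half-open, so one more
    is needed for the point 1. *)
Lemma time_cell_mass n : \sum_(k < n.+2) fine (mu (time_cell n.+1%:R^-1 k)) = 1.
Proof.
have h0 : 0 < n.+1%:R^-1 :> R by rewrite invr_gt0 ltr0n.
have mI k : measurable (time_cell (n.+1%:R^-1 : R) k) by exact: measurable_itv.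
have dI (k l : 'I_n.+2) : k != l -> time_cell (n.+1%:R^-1 : R) k `&` time_cell n.+1%:R^-1 l = set0.
  by move=> kl; apply: time_cell_disjoint.
have sE := measure_exists_fin mu xpredT (fun k : 'I_n.+2 => mI k) dI.
set U := [set x | _] in sE.
have mU : measurable U by apply: measurable_exists_fin.
apply/EFin_inj; rewrite -sumEFin.
under eq_bigr do rewrite -probability_fineE//.
rewrite -sE; apply/le_anti; rewrite probability_le1//=.
have [N [mN N0 EN]] := muE.
rewrite -(@probability_setT _ _ _ mu).
apply: (@le_trans _ _ (mu (U `|` N))); last first.
  by apply: (le_trans (measureU2 _ mU mN)); rewrite [X in (_ + X)%E](_ : _ = 0%E) ?adde0.
apply: le_measure; rewrite ?inE//; first exact: measurableU.
move=> t _; have [Et|nEt] := pselect (E t); last by right; exact: EN.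
left; have /E01 := Et; rewrite /= in_itv/= => /andP[t0 t1].
have tn0 : 0 <= t * n.+1%:R by rewrite mulr_ge0.
have kn : (Num.truncn (t * n.+1%:R) < n.+2)%N.
  by rewrite ltnS truncn_le_nat (le_lt_trans (_ : _ <= n.+1%:R))// ?ltr_nat// ler_piMl.
exists (Ordinal kn); split => //; rewrite /time_cell/= in_itv/=.
have /andP[h1 h2] := truncn_itv tn0.
by rewrite ler_pdivrMr// h1 ltr_pdivlMr.
Qed.

End time_cells.

(** Mass sg^gam times density sg^(-d), with sg = x^H, gives the Riesz exponent. *)
Lemma powR_codim {R : realType} (x H gam : R) (d : nat) : 0 < x ->
  (x `^ H) `^ gam / (x `^ H) ^+ d = x `^ (- (H * (d%:R - gam))).
Proof.
move=> x0; rewrite -powR_mulrn ?powR_ge0// -!powRrM -powRN -powRD; last by apply/implyP => _; rewrite gt_eqF.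
by congr (_ `^ _); ring.
Qed.

(* For |t - s| < h the cells at time t are disjoint and each has mass at most
   C4 (h^H)^gam; for |t - s| >= h local nondeterminism applies. *)
Lemma cell_sum_le {R : realType} (H a b M K gam C4 : R) (d : nat) :
  0 < H -> H < 1 -> 0 < a -> a < b -> b <= 1 -> 0 <= M -> 0 <= K -> gam <= d%:R -> 0 < C4 ->
  exists2 C : R, 0 < C &
  forall dT (T : measurableType dT) (P : probability T R) (B : 'I_d -> R -> T -> R) f,
  fbm_vec P H B -> drift H a b K f ->
  forall h (w : {ffun 'I_d -> 'I_(gridN M (h `^ H))} -> R) s t z,
  0 < h -> h <= 1 -> a <= s <= b -> a <= t <= b -> (forall z, 0 <= w z) ->
  (forall z rho, 0 < w z -> h `^ H <= rho ->
    \sum_(z' : {ffun 'I_d -> 'I_(gridN M (h `^ H))} |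
       [forall i, `|corner M (h `^ H) (z' i) - corner M (h `^ H) (z i)| <= rho]) w z' <=
    C4 * rho `^ gam) ->
  0 < w z ->
  \sum_(z' | 0 < w z') w z' * fine (P (cell_event B f s z `&` cell_event B f t z')) <=
    C * ((h `^ H) ^+ d) ^+ 2 * (Num.max h `|t - s|) `^ (- (H * (d%:R - gam))).
Proof.
move=> H0 H1 a0 ab b1 M0 K0 gd C40.
have [C2 C20 UB] := @cell_event_ub R H a b M K d H0 a0 b1.
have [C3 C30 PR] := @cell_event_pair R H a b M K d H0 H1 a0 ab b1 M0 K0 d.+1.
exists (C4 * C2 + C3 * (2 ^+ d.+2 * C4)).
  by apply: addr_gt0; apply: mulr_gt0 => //; apply: mulr_gt0 => //; apply: exprn_gt0.
move=> dT T P B f fB hf h w s t z h0 h1 sab tab.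
move: w z; set ep := h `^ H => w z w0 wC wz.
have e0 : 0 < ep by exact: powR_gt0.
have A0 (A : set T) : 0 <= fine (P A) by exact: fine_probability_ge0.
have me u z' : a <= u <= b -> measurable (@cell_event _ M d _ B f ep u z').
  by move=> uab; exact: (measurable_cell_event a0 b1 f fB z' uab).
have [ts|ts] := ltP `|t - s| h.
  rewrite -(powR_codim H gam d h0) -/ep.
  apply: (@le_trans _ _ (C4 * ep `^ gam * fine (P (cell_event B f s z)))).
    apply: (@le_trans _ _ (\sum_(z' | 0 < w z') C4 * ep `^ gam * fine (P (cell_event B f s z `&` cell_event B f t z')))).
      apply: ler_sum => z' wz'; rewrite ler_wpM2r//.
      apply: (le_trans _ (wC z' ep wz' (lexx _))).
      rewrite (bigD1 z')/=; last by apply/forallP => i; rewrite subrr normr0 ltW.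
      by rewrite lerDl sumr_ge0.
    rewrite -mulr_sumr ler_wpM2l ?mulr_ge0 ?powR_ge0 ?(ltW C40)//.
    have mA (z' : {ffun 'I_d -> 'I_(gridN M ep)}) : measurable (cell_event B f s z `&` cell_event B f t z').
      by apply: measurableI; exact: me.
    have dA (z1 z2 : {ffun 'I_d -> 'I_(gridN M ep)}) : z1 != z2 ->
        (cell_event B f s z `&` cell_event B f t z1) `&` (cell_event B f s z `&` cell_event B f t z2) = set0.
      move=> /eqP z12; apply/seteqP; split => // x [[_ x1] [_ x2]]; apply: z12.
      by apply: (@cube_inj _ _ _ _ _ _ (\row_i (B i t x + f t 0 i)) e0) => i; rewrite mxE.
    have := measure_exists_fin P (fun z' => 0 < w z') mA dA.
    rewrite (eq_bigr (fun z' => (fine (P (cell_event B f s z `&` cell_event B f t z')))%:E)) => [|z' _]; last exact: probability_fineE.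
    rewrite sumEFin => sE.
    rewrite -lee_fin -sE -probability_fineE; last exact: me.
    apply: le_measure; rewrite ?inE//; [exact: measurable_exists_fin|exact: me|].
    by move=> x [z' [_ []]].
  have h2 := ler_wpM2l (mulr_ge0 (ltW C40) (powR_ge0 ep gam)) (UB _ _ _ _ _ fB hf ep s z e0 sab).
  apply: (le_trans h2).
  rewrite (_ : _ * (ep `^ gam / ep ^+ d) = (C4 * C2 + C3 * (2 ^+ d.+2 * C4)) * (ep `^ gam * ep ^+ d)); last first.
    by field; rewrite ?expf_neq0 ?(gt_eqF e0) ?(gt_eqF sg0).
  rewrite (_ : C4 * _ * _ = (C4 * C2) * (ep `^ gam * ep ^+ d)); last by ring.
  rewrite ler_wpM2r ?mulr_ge0 ?powR_ge0 ?exprn_ge0 ?(ltW e0)// lerDl.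
  by apply: mulr_ge0; [exact: ltW|apply: mulr_ge0; [exact: exprn_ge0|exact: ltW]].
have ts0 : 0 < `|t - s| by exact: lt_le_trans h0 ts.
have st : s != t by rewrite eq_sym -subr_eq0 -normr_gt0.
rewrite -(powR_codim H gam d ts0).
have es : ep <= `|t - s| `^ H by apply: ge0_ler_powR => //; rewrite ?nnegrE ltW.
move: (PR _ _ _ _ _ fB hf ep s t z) => PR'; set sg := `|t - s| `^ H in es PR' *.
have sg0 : 0 < sg by exact: lt_le_trans e0 es.
pose D i (z' : {ffun 'I_d -> 'I_(gridN M ep)}) := `|corner M ep (z' i) - corner M ep (z i)|.
apply: (@le_trans _ _ (\sum_(z' | 0 < w z') C3 * (ep ^+ 2 / sg) ^+ d *
    (w z' * \prod_(i < d) (sg / (sg + D i z')) ^+ d.+1))).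
  apply: ler_sum => z' wz'; rewrite mulrCA ler_wpM2l//.
  exact: PR'.
rewrite -mulr_sumr.
have ks := @kernel_sum_le _ d _ (fun z' => 0 < w z') w D sg C4 gam w0 (fun _ _ => normr_ge0 _) sg0 (ltW C40) gd
   (fun rho h => wC z rho wz (le_trans es h)).
have q0 : 0 <= C3 * (ep ^+ 2 / sg) ^+ d.
  by rewrite mulr_ge0 ?exprn_ge0 ?divr_ge0 ?exprn_ge0 ?ltW.
apply: (le_trans (ler_wpM2l q0 ks)).
rewrite (_ : C3 * _ * _ = (C3 * (2 ^+ d.+2 * C4)) * ((ep ^+ d) ^+ 2 * (sg `^ gam / sg ^+ d))); last first.
  by rewrite expr_div_n [(ep ^+ d) ^+ 2]exprAC; field; rewrite ?expf_neq0 ?(gt_eqF e0) ?(gt_eqF sg0).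
rewrite -[leRHS]mulrA ler_wpM2r; last by rewrite lerDr mulr_ge0 ?ltW.
  by [].
by rewrite mulr_ge0 ?exprn_ge0 ?divr_ge0 ?powR_ge0 ?exprn_ge0 ?ltW.
Qed.

(** The constant does not depend on r, to which the meshes are adapted inside the proof; this is
    what lets r tend to 0 afterwards. *)
Lemma near_hit_energy {R : realType} (H a b M K gam : R) (d : nat) (F : set 'rV[R]_d) :
  0 < H -> H < 1 -> 0 < a -> a < b -> b <= 1 -> 0 <= M -> 0 <= K -> 0 < gam -> gam <= d%:R ->
  (forall x, F x -> forall i, - M <= x 0 i <= M) -> ahlfors_regular gam F ->
  exists2 c : R, 0 < c &
  forall dT (T : measurableType dT) (P : probability T R) (B : 'I_d -> R -> T -> R) f
    (E : set R) (mu : probability R R) e r,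
  fbm_vec P H B -> drift H a b K f -> E `<=` `[a, b] -> mu.-negligible (~` E) ->
  energy (H * (d%:R - gam)) mu = e%:E -> 0 < r ->
  measurable (near_hit (fun i t w => B i t w + f t 0 i) E F r) ->
  c <= fine (P (near_hit (fun i t w => B i t w + f t 0 i) E F r)) * e.
Proof.
move=> H0 H1 a0 ab b1 M0 K0 g0 gd FM aF.
have [m0 [C4 [m00 C40 grid]]] := ahlfors_grid FM g0 aF.
have [c c0 LB] := @cell_event_lb R H a b M K d H0 a0 b1 M0.
have [C C0 UB] := @cell_sum_le R H a b M K gam C4 d H0 H1 a0 ab b1 M0 K0 gd C40.
set al := H * (d%:R - gam) in UB *.
have al0 : 0 <= al by rewrite mulr_ge0 ?subr_ge0 ?(ltW H0).
have c30 : 0 < 3 `^ (- al) :> R by rewrite powR_gt0.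
exists (3 `^ (- al) * (c ^+ 2 * m0 / C)).
  by rewrite mulr_gt0 ?divr_gt0 ?mulr_gt0 ?exprn_gt0.
move=> dT T P B f E mu e r fB hf Eab muE en r0 mN.
(* With h = 1 / (n + 1), a point of the path and a point of F in one cube of side h^H differ by less
   than r in each coordinate. *)
have [n nr] : exists n : nat, n.+1%:R^-1 `^ H <= r.
  have [N _ HN] := near_infty_natSinv_lt (PosNum (powR_gt0 H^-1 r0)).
  exists N; have := HN N (leqnn N); set x := N.+1%:R^-1 => /= /ltW h.
  apply: (@le_trans _ _ ((r `^ H^-1) `^ H)).
    by apply: ge0_ler_powR => //; rewrite ?nnegrE ?powR_ge0 ?(ltW H0)// /x invr_ge0.
  by rewrite -powRrM mulVf ?gt_eqF// powRr1 ?(ltW r0).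
set h : R := n.+1%:R^-1 in nr.
have h0 : 0 < h by rewrite invr_gt0 ltr0n.
have h1 : h <= 1 by rewrite invf_le1 ?ltr0n// ler1n.
have e0 : 0 < h `^ H by rewrite powR_gt0.
have e1 : h `^ H <= 1.
  have -> : 1 = 1 `^ H :> R by rewrite powR1.
  by apply: ge0_ler_powR => //; rewrite ?nnegrE ?(ltW H0) ?(ltW h0).
have [w [w0 wm wF wC _]] := grid _ e0 e1.
have E01 : E `<=` `[0, 1].
  by move=> t /Eab; rewrite /= !in_itv/= => /andP[t1 t2]; rewrite (le_trans (ltW a0))//= (le_trans t2).
pose m (k : 'I_n.+2) := fine (mu (time_cell h k)).
pose t (k : 'I_n.+2) := time_point E n k.
have mt k : 0 < m k -> E (t k) /\ time_cell h k (t k) by move=> mk; exact: (time_cell_point muE mk).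
have tab k : 0 < m k -> a <= t k <= b.
  by move=> /mt[/Eab]; rewrite /= in_itv.
pose A (i : 'I_n.+2 * {ffun 'I_d -> 'I_(gridN M (h `^ H))}) := cell_event B f (t i.1) i.2.
have mA k z : 0 < m k -> measurable (A (k, z)).
  by move=> mk; apply: (measurable_cell_event a0 b1 f fB z); exact: tab.
have mp k : 0 <= m k by exact: fine_probability_ge0.
have ms : \sum_k m k = 1 by exact: (time_cell_mass E01 muE n).
have e0d : 0 < (h `^ H) ^+ d by rewrite exprn_gt0.
have lb k z : 0 < m k -> 0 < w z -> c * (h `^ H) ^+ d <= fine (P (A (k, z))).
  by move=> mk wz; apply: (LB _ _ _ _ _ fB hf _ _ z e0 e1); exact: tab.
have ub k l z : 0 < m k -> 0 < m l -> 0 < w z ->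
    \sum_(z' | 0 < w z') w z' * fine (P (A (k, z) `&` A (l, z'))) <=
    C * ((h `^ H) ^+ d) ^+ 2 * Num.max h `|t l - t k| `^ (- al).
  move=> mk ml wz; apply: (UB _ _ _ _ _ fB hf h w (t k) (t l) z h0 h1) => //; exact: tab.
have := second_moment mp w0 ms wm c0 C0 m00 e0d mA lb ub.
set p' := fine _ => sm.
have := energy_lb al0 h0 (fun k mk => (mt k mk).2); rewrite en lee_fin.
set S := \sum_k _ in sm * => Se.
have p'p : p' <= fine (P (near_hit (fun i t w => B i t w + f t 0 i) E F r)).
  have mU : measurable [set x | exists i, ((0 < m i.1) && (0 < w i.2)) /\ A i x].
    by apply: measurable_exists_fin => -[k z] /andP[/= mk _]; exact: mA.
  rewrite -lee_fin /p' -!probability_fineE//; apply: le_measure; rewrite ?inE//.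
  move=> x [[k z] [/andP[/= mk wz]]]; rewrite /A/= => Ax.
  have [y [Fy zy]] := wF _ wz.
  exists (t k), y; split => //; first by have [] := mt k mk.
  move=> i; have /andP[h2 h3] := Ax i; have /andP[h4 h5] := zy i.
  apply: (lt_le_trans _ nr); rewrite ltr_norml; apply/andP; split; lra.
have p'0 : 0 <= p' by exact: fine_probability_ge0.
have S0 : 0 <= S.
  by apply: sumr_ge0 => k _; apply: sumr_ge0 => l _; rewrite !mulr_ge0 ?mp ?powR_ge0.
apply: (@le_trans _ _ (p' * (3 `^ (- al) * S))).
  by rewrite [leRHS]mulrCA ler_wpM2l ?(ltW c30).
by apply: ler_pM => //; rewrite mulr_ge0 ?(ltW c30).
Qed.

(** * Upper bound *)

Definition dyadic {R : realType} (p l : R) (n k : nat) : R := p + l * (k%:R / 2 ^+ n).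

(** A dyadic point of level n + 1 is one of level n or the right neighbour of one, so reaching it
    from p costs at most one increment per level. The geometric series bounds the total, and
    continuity extends the bound to all t. *)
Lemma chaining_bound {R : realType} (g : R -> R) (p l la rho : R) :
  0 < l -> 0 <= la -> 0 < rho -> rho < 1 ->
  (forall t, p <= t <= p + l -> forall e, 0 < e -> exists2 dl, 0 < dl &
    forall s, p <= s <= p + l -> `|s - t| < dl -> `|g s - g t| < e) ->
  (forall n k, (k < 2 ^ n)%N -> `|g (dyadic p l n k.+1) - g (dyadic p l n k)| <= la * rho ^+ n) ->
  forall t, p <= t <= p + l -> `|g t - g p| <= la / (1 - rho).
Proof.
move=> l0 la0 r0 r1 cg inc.
have r10 : 0 < 1 - rho by rewrite subr_gt0.
have dy0 n : dyadic p l n 0 = p by rewrite /dyadic mul0r mulr0 addr0.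
have dyE n k : dyadic p l n.+1 k.*2 = dyadic p l n k.
  by rewrite /dyadic -mul2n natrM exprS invfM mulrACA mulfV ?mul1r.
have dyI n k : (k <= 2 ^ n)%N -> p <= dyadic p l n k <= p + l.
  move=> kn; rewrite /dyadic lerDl lerD2l mulr_ge0 ?divr_ge0 ?exprn_ge0 ?(ltW l0)//=.
  by rewrite ler_piMr ?(ltW l0)// ler_pdivrMr ?exprn_gt0// mul1r -natrX ler_nat.
have sumE n : \sum_(j < n) rho ^+ j <= (1 - rho)^-1.
  rewrite -[leRHS]mul1r ler_pdivlMr//.
  suff -> : (\sum_(j < n) rho ^+ j) * (1 - rho) = 1 - rho ^+ n by rewrite lerBlDr lerDl exprn_ge0 ?ltW.
  by elim: n => [|n IH]; rewrite ?big_ord0 ?big_ord_recr/= ?mulrDl ?IH ?exprS ?expr0; ring.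
have dyb n : forall k, (k <= 2 ^ n)%N -> `|g (dyadic p l n k) - g p| <= la * \sum_(j < n.+1) rho ^+ j.
  elim: n => [|n IH] k kn.
    rewrite big_ord1; case: k kn => [|[|//]] _; first by rewrite dy0 subrr normr0 mulr_ge0 ?expr0.
    by rewrite -{2}(dy0 0%N); exact: inc.
  have hk := odd_double_half k; rewrite big_ord_recr/= mulrDr.
  have kn' : (k./2 <= 2 ^ n)%N by rewrite -leq_double -[(2 ^ n).*2]mul2n -expnS (leq_trans _ kn)// -[leqRHS]hk leq_addl.
  case ok: (odd k) hk => hk; rewrite -hk.
    rewrite add1n (_ : _ - g p = (g (dyadic p l n.+1 (k./2).*2.+1) - g (dyadic p l n.+1 (k./2).*2)) +
      (g (dyadic p l n.+1 (k./2).*2) - g p)); last by ring.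
    apply: (le_trans (ler_normD _ _)); rewrite addrC; apply: lerD; first by rewrite dyE; exact: IH.
    by apply: inc; rewrite -add1n hk.
  by rewrite add0n dyE -[leLHS]addr0; apply: lerD; [exact: IH|rewrite mulr_ge0 ?exprn_ge0 ?(ltW r0)].
move=> t /[dup] tpl /andP[pt tl].
apply/ler_addgt0Pl => e e0; have [dl d0 Hd] := cg t tpl e e0.
have [n nd] : exists n : nat, l / 2 ^+ n < dl.
  have [N _ HN] := near_infty_natSinv_lt (PosNum (divr_gt0 d0 l0)).
  exists N; have /= := HN N (leqnn N); rewrite ltr_pdivlMr// mulrC; apply: le_lt_trans.
  by rewrite ler_wpM2l ?(ltW l0)// lef_pV2 ?posrE ?exprn_gt0 ?ltr0n// -natrX ler_nat ltn_expl.
(* The integer part of x is the index of the last dyadic point of level n not after t. *)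
pose x := (t - p) / l * 2 ^+ n.
have x0 : 0 <= x by rewrite mulr_ge0 ?exprn_ge0// divr_ge0 ?subr_ge0// ltW.
have /andP[k1 k2] := truncn_itv x0; set k := Num.truncn x in k1 k2.
have kn : (k <= 2 ^ n)%N.
  rewrite -(ler_nat R); apply: (le_trans k1); rewrite natrX ler_piMl ?exprn_ge0//.
  by rewrite ler_pdivrMr// mul1r lerBlDl.
have tn : `|dyadic p l n k - t| < dl.
  apply: le_lt_trans nd; rewrite /dyadic.
  have e2 : (0 : R) < 2 ^+ n by rewrite exprn_gt0.
  have -> : p + l * (k%:R / 2 ^+ n) - t = (l / 2 ^+ n) * (k%:R - x).
    by rewrite /x; field; rewrite ?gt_eqF ?expf_neq0.
  rewrite normrM ger0_norm ?divr_ge0 ?(ltW l0) ?(ltW e2)//.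
  rewrite ler_piMr ?divr_ge0 ?(ltW l0) ?(ltW e2)//.
  move: k2; rewrite -natr1 => k2; rewrite ler_norml; apply/andP; split; lra.
have h1 := Hd _ (dyI n k kn) tn.
have h2 : `|g (dyadic p l n k) - g p| <= la / (1 - rho).
  by apply: (le_trans (dyb n k kn)); rewrite ler_wpM2l.
rewrite (_ : g t - g p = (g (dyadic p l n k) - g p) - (g (dyadic p l n k) - g t)); last by ring.
apply: (le_trans (ler_normB _ _)); rewrite addrC; apply: lerD => //; exact: ltW.
Qed.

Section probability.
Context {dT : measure_display} {T : measurableType dT} {R : realType} (P : probability T R).

Lemma fine_probability_exists (I : finType) (Q : pred I) (A : I -> set T) :
  (forall i, measurable (A i)) ->
  fine (P [set x | exists i, Q i /\ A i x]) <= \sum_(i | Q i) fine (P (A i)).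
Proof.
move=> mA; rewrite -lee_fin -probability_fineE; last exact: measurable_exists_fin.
apply: (le_trans (measure_exists_fin_le P Q mA)).
rewrite -sumEFin le_eqVlt; apply/orP; left; apply/eqP; apply: eq_bigr => i _.
exact: probability_fineE.
Qed.

Lemma fine_probabilityU (A B : set T) : measurable A -> measurable B ->
  fine (P (A `|` B)) <= fine (P A) + fine (P B).
Proof.
move=> mA mB; rewrite -lee_fin EFinD -!probability_fineE//; last exact: measurableU.
exact: measureU2.
Qed.

Lemma fine_probability_bigcup_half (S : nat -> set T) (c : R) :
  (forall n, measurable (S n)) -> (forall n, fine (P (S n)) <= c * 2^-1 ^+ n) ->
  fine (P (\bigcup_n S n)) <= c * 2.
Proof.
move=> mS Sc; have mU : measurable (\bigcup_n S n) by exact: bigcup_measurable.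
have c0 : 0 <= c by have := Sc 0%N; rewrite expr0 mulr1; apply: le_trans; exact: fine_probability_ge0.
rewrite -lee_fin -probability_fineE//.
apply: (@le_trans _ _ (\sum_(0 <= n <oo) P (S n))%E).
  by apply: measure_sigma_subadditive => //.
apply: lime_le; first by apply: is_cvg_nneseries => n _ _; exact: measure_ge0.
apply: nearW => n; rewrite big_mkord.
apply: (@le_trans _ _ (\sum_(i < n) (c * 2^-1 ^+ i)%:E)%E).
  by apply: lee_sum => i _; rewrite probability_fineE// lee_fin.
by rewrite sumEFin lee_fin -mulr_sumr ler_wpM2l// geometric_half_sum.
Qed.

End probability.

(** An event involving two times is not a generator; its membership is needed to multiply it with
    boxes of the other components. *)
Lemma process_increment {dT} {T : measurableType dT} {R : realType} (X : R -> T -> R) (u v la : R) :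
  0 <= u <= 1 -> 0 <= v <= 1 ->
  process_sigma_algebra `[0, 1]%classic X [set w | la < `|X u w - X v w|].
Proof.
move=> u01 v01.
pose G : set (set T) := [set A | exists t (C : set R),
  [/\ `[0, 1]%classic t, measurable C & A = X t @^-1` C]].
have mX t : 0 <= t <= 1 -> measurable_fun (setT : set (g_sigma_algebraType G)) (X t).
  move=> t01 _ C mC; rewrite setTI; apply: sub_gen_smallest.
  by exists t, C; split => //; rewrite /= in_itv.
exact: (@measurable_norm_gt _ (g_sigma_algebraType G) R (fun w => X u w - X v w) la
  (measurable_funB (mX u u01) (mX v v01))).
Qed.

(** * Joint control of the starting point and of an increment *)

Section box_increment.
Context {R : realType}.
Variables (H a b M K : R) (d : nat).
Hypotheses (H0 : 0 < H) (H1 : H < 1) (a0 : 0 < a) (ab : a < b) (b1 : b <= 1).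
Hypotheses (M0 : 0 <= M) (K0 : 0 <= K).

(** The half-width dl is separate from the mesh ep: it will be a multiple of ep, large enough for
    the start of a path that enters the cube later. *)
Definition box_event {T : Type} (B : 'I_d -> R -> T -> R) (f : R -> 'rV[R]_d) (ep p dl : R)
    (z : {ffun 'I_d -> 'I_(gridN M ep)}) : set T :=
  [set w | forall i, `|B i p w - (corner M ep (z i) - f p 0 i)| <= dl].

Definition increment_event {T : Type} (B : 'I_d -> R -> T -> R) (u v la : R) (i : 'I_d) : set T :=
  [set w | la < `|B i u w - B i v w|].

Let in01 t : a <= t <= b -> 0 <= t <= 1.
Proof. by move=> /andP[at_ tb]; rewrite (le_trans (ltW a0))//= (le_trans tb). Qed.

Lemma measurable_box_event {dT} {T : measurableType dT} (P : probability T R)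
    (B : 'I_d -> R -> T -> R) f (ep p dl : R) (z : {ffun 'I_d -> 'I_(gridN M ep)}) :
  fbm_vec P H B -> a <= p <= b -> measurable (box_event B f p dl z).
Proof.
move=> fB pab; apply: measurable_forall_fin => i; apply: measurable_dist_le.
exact: measurable_fbm (fB.1 i) (in01 pab).
Qed.

Lemma measurable_increment_event {dT} {T : measurableType dT} (P : probability T R)
    (B : 'I_d -> R -> T -> R) (u v la : R) i :
  fbm_vec P H B -> a <= u <= b -> a <= v <= b -> measurable (increment_event B u v la i).
Proof.
move=> fB uab vab; apply: (@measurable_norm_gt _ _ _ (fun w => B i u w - B i v w)).
apply: measurable_funB; [exact: measurable_fbm (fB.1 i) (in01 uab)|exact: measurable_fbm (fB.1 i) (in01 vab)].
Qed.

(** The joint bound uses [fbm_box_tail] in coordinate i and the plain box bound in the d - 1 others,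
    so the full power dl^d is kept along with the gain from the increment. *)
Lemma box_increment_le (m : nat) : (0 < m)%N -> exists2 C : R, 0 < C &
  forall dT (T : measurableType dT) (P : probability T R) (B : 'I_d -> R -> T -> R) f
    (ep p u v dl la : R) (z : {ffun 'I_d -> 'I_(gridN M ep)}) (i : 'I_d),
  fbm_vec P H B -> drift H a b K f -> a <= p <= b -> a <= u <= b -> a <= v <= b ->
  0 < ep -> 0 < dl -> dl <= 1 -> 0 < la ->
  [/\ fine (P (box_event B f p dl z)) <= (C * dl) ^+ d,
      fine (P (increment_event B u v la i)) <= C * ((`|u - v| `^ H) ^+ 2 / la ^+ 2) ^+ m &
      fine (P (box_event B f p dl z `&` increment_event B u v la i)) <=
      (C * dl) ^+ d * ((`|u - v| `^ H) ^+ 2 / la ^+ 2) ^+ m].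
Proof.
move=> m0; have MK0 : 0 <= M + K by rewrite addr_ge0.
have [C1 C10 ub] := fbm_box_ub H0 a0.
have [C2 C20 tl] := fbm_tail H0 m0.
have [C3 C30 bt] := fbm_box_tail H0 a0 m0 MK0.
exists (C1 + C2 + C3); first by rewrite !addr_gt0.
move=> dT T P B f ep p u v dl la z i fB hf pab uab vab e0 d0 d1 l0.
set C := C1 + C2 + C3; set q := ((`|u - v| `^ H) ^+ 2 / la ^+ 2) ^+ m.
have q0 : 0 <= q by rewrite exprn_ge0// divr_ge0// sqr_ge0.
have [C1C C2C C3C] : [/\ C1 <= C, C2 <= C & C3 <= C] by rewrite /C; split; lra.
have pa1 : a <= p <= 1 by have /andP[-> pb] := pab; exact: le_trans b1.
pose x j := corner M ep (z j) - f p 0 j.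
have xL j : `|x j| <= M + K by rewrite /x; exact: (corner_drift M0 hf).
pose Bx j : set T := [set w | `|B j p w - x j| <= dl].
have mBx j : measurable (Bx j).
  by apply: measurable_dist_le; exact: measurable_fbm (fB.1 j) (in01 pab).
have mI : measurable (increment_event B u v la i) by exact: measurable_increment_event fB uab vab.
have aBx j : process_sigma_algebra `[0, 1]%classic (B j) (Bx j).
  rewrite (_ : Bx j = B j p @^-1` `[x j - dl, x j + dl]%classic).
    by apply: process_generator; [exact: in01|exact: measurable_itv].
  by apply/seteqP; split => w; rewrite /Bx/= in_itv/= ler_distl.
have boxE : box_event B f p dl z = [set w | forall j, Bx j w] by [].
have bj j : fine (P (Bx j)) <= C * dl.
  apply: (@le_trans _ _ (C1 * dl)); last by rewrite ler_wpM2r ?(ltW d0).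
  by rewrite -lee_fin -probability_fineE//; exact: (ub _ _ _ _ _ _ _ (fB.1 j) pa1 d0).
split.
- rewrite boxE (independent_prod fB)//.
  rewrite -[X in _ ^+ X](card_ord d) -prodr_const; apply: ler_prod => j _.
  by rewrite fine_probability_ge0 bj.
- apply: (@le_trans _ _ (C2 * q)); last by rewrite ler_wpM2r.
  rewrite -lee_fin -probability_fineE//.
  exact: (tl _ _ _ _ _ _ _ (fB.1 i) (in01 uab) (in01 vab) l0).
pose A j := if j == i then Bx j `&` increment_event B u v la i else Bx j.
have -> : box_event B f p dl z `&` increment_event B u v la i = [set w | forall j, A j w].
  rewrite boxE; apply/seteqP; split => w.
    by move=> [h1 h2] j; rewrite /A; case: eqP => _; [split|]; [exact: h1|exact: h2|exact: h1].
  move=> h; split => [j|]; first by have := h j; rewrite /A; case: eqP => // _ [].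
  by have := h i; rewrite /A eqxx => -[].
rewrite (independent_prod fB); last 2 first.
- move=> j; rewrite /A; case: eqP => [->|_]; last exact: aBx.
  by apply: process_setI; [exact: aBx|apply: process_increment; exact: in01].
- by move=> j; rewrite /A; case: eqP => // _; exact: measurableI.
rewrite (bigD1 i)//= {1}/A eqxx.
have dE : d = #|[pred j : 'I_d | j != i]|.+1.
  by rewrite -{1}(card_ord d) (cardD1 i) add1n; congr _.+1; apply: eq_card => j; rewrite !inE andbT.
rewrite [X in _ ^+ X]dE exprS mulrAC; apply: ler_pM.
- exact: fine_probability_ge0.
- by apply: prodr_ge0 => j _; exact: fine_probability_ge0.
- apply: (@le_trans _ _ (C3 * dl * q)); last by rewrite ler_wpM2r// ler_wpM2r ?(ltW d0).
  rewrite -lee_fin -probability_fineE; last exact: measurableI.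
  exact: (bt _ _ _ _ _ _ _ (x i) _ _ (fB.1 i) pa1 (in01 uab) (in01 vab) (xL i) d0 d1 l0).
rewrite -prodr_const; apply: ler_prod => j /negPf ji.
by rewrite fine_probability_ge0/= /A ji bj.
Qed.

End box_increment.

Section bad_increments.
Context {R : realType}.
Variables (H a b M K : R) (d m : nat).
Hypotheses (H0 : 0 < H) (H1 : H < 1) (a0 : 0 < a) (ab : a < b) (b1 : b <= 1).
Hypotheses (M0 : 0 <= M) (K0 : 0 <= K) (Hm : 2 <= H * m%:R).
Context {dT : measure_display} {T : measurableType dT} (P : probability T R).
Variables (B : 'I_d -> R -> T -> R) (f : R -> 'rV[R]_d).
Hypotheses (fB : fbm_vec P H B) (hf : drift H a b K f).
Variables (p l : R).
Hypotheses (l0 : 0 < l) (ap : a <= p) (plb : p + l <= b).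

(* Increments over l 2^(-n) have standard deviation l^H 2^(-n H); allowing
   la 2^(-n H / 2) at level n keeps the thresholds summable and leaves a gain of
   2^(-n H / 2) to beat the 2^n increments of that level. *)
Definition chain_rate : R := 2 `^ (- (H / 2)).

Lemma chain_rate_bounds : 0 < chain_rate < 1.
Proof.
rewrite /chain_rate powR_gt0//= powRN invf_lt1 ?powR_gt0//.
rewrite -[ltLHS](_ : 1 `^ (H / 2) = 1); last by rewrite powR1.
by apply: gt0_ltr_powR; rewrite ?nnegrE ?divr_gt0 ?ltr1n.
Qed.

Definition bad_level la n : set T := [set w | exists ki : 'I_(2 ^ n) * 'I_d, xpredT ki /\
  increment_event B (dyadic p l n ki.1.+1) (dyadic p l n ki.1) (la * chain_rate ^+ n) ki.2 w].

Let dyab n k : (k <= 2 ^ n)%N -> a <= dyadic p l n k <= b.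
Proof.
move=> kn; have e : k%:R / 2 ^+ n <= 1 :> R by rewrite ler_pdivrMr ?exprn_gt0// mul1r -natrX ler_nat.
have e0 : 0 <= k%:R / 2 ^+ n :> R by rewrite divr_ge0 ?exprn_ge0.
rewrite /dyadic (le_trans ap) ?lerDl ?mulr_ge0 ?(ltW l0)//=.
by apply: (le_trans _ plb); rewrite lerD2l ler_piMr ?(ltW l0).
Qed.

Let mI n la (ki : 'I_(2 ^ n) * 'I_d) :
  measurable (increment_event B (dyadic p l n ki.1.+1) (dyadic p l n ki.1) la ki.2).
Proof. by apply: (measurable_increment_event a0 b1 _ _ fB); apply: dyab => //; exact: ltnW. Qed.

Lemma measurable_bad_level la n : measurable (bad_level la n).
Proof. by apply: measurable_exists_fin => ki _; exact: mI. Qed.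

(** At level n, standard deviation over threshold is l^H / la times 2^(-n H / 2); its power 2m gains
    2^(-n H m) <= 4^(-n) by [Hm]. *)
Lemma increment_ratio la n k : 0 < la ->
  ((`|dyadic p l n k.+1 - dyadic p l n k| `^ H) ^+ 2 / (la * chain_rate ^+ n) ^+ 2) ^+ m <=
  ((l `^ H / la) ^+ 2) ^+ m * (4^-1) ^+ n.
Proof.
move=> la0; have /andP[r0 r1] := chain_rate_bounds.
have e2 : (0 : R) < 2 ^+ n by rewrite exprn_gt0.
have -> : dyadic p l n k.+1 - dyadic p l n k = l / 2 ^+ n.
  by rewrite /dyadic -natr1; field; rewrite gt_eqF.
rewrite ger0_norm ?divr_ge0 ?(ltW l0) ?(ltW e2)// powRM ?invr_ge0 ?(ltW l0) ?(ltW e2)//.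
have rE : (2 ^+ n)^-1 `^ H = (chain_rate ^+ n) ^+ 2.
  rewrite /chain_rate -powR_inv1 ?(ltW e2)// -powRrM -[2 ^+ n]powR_mulrn// -powRrM.
  by rewrite -!powR_mulrn ?powR_ge0// -!powRrM; congr (_ `^ _); field.
rewrite rE (_ : (l `^ H * (chain_rate ^+ n) ^+ 2) ^+ 2 / (la * chain_rate ^+ n) ^+ 2 =
    (l `^ H / la) ^+ 2 * (chain_rate ^+ n) ^+ 2); last first.
  by field; rewrite ?expf_neq0 ?(gt_eqF la0) ?(gt_eqF r0).
rewrite exprMn ler_wpM2l ?exprn_ge0 ?divr_ge0 ?powR_ge0 ?(ltW la0)//.
rewrite (_ : ((chain_rate ^+ n) ^+ 2) ^+ m = ((chain_rate ^+ 2) ^+ m) ^+ n); last first.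
  by rewrite -!exprM; congr (_ ^+ _); rewrite mulnC -mulnA.
rewrite lerXn2r ?nnegrE ?exprn_ge0 ?(ltW r0)//.
rewrite /chain_rate -powR_mulrn ?exprn_ge0 ?powR_ge0// -powR_mulrn ?powR_ge0// -!powRrM.
apply: (@le_trans _ _ (2 `^ (- (2 : R)))).
  rewrite ler_powR ?ler1n// (_ : - (H / 2) * (2 * m%:R) = - (H * m%:R)); last by field.
  by rewrite lerN2.
by rewrite powRN powR_mulrn// lef_pV2 ?posrE// expr2 -natrM.
Qed.

(** There are 2^n d increments at level n, so the gain 4^(-n) leaves 2^(-n). The factor c is C for
    increments alone and (C dl)^d when a box is added. *)
Lemma increment_ratio_sum la n (c : R) : 0 <= c -> 0 < la ->
  \sum_(ki : 'I_(2 ^ n) * 'I_d) c * ((`|dyadic p l n ki.1.+1 - dyadic p l n ki.1| `^ H) ^+ 2 /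
     (la * chain_rate ^+ n) ^+ 2) ^+ m <=
  c * d%:R * ((l `^ H / la) ^+ 2) ^+ m * 2^-1 ^+ n.
Proof.
move=> c0 la0.
apply: (@le_trans _ _ (\sum_(ki : 'I_(2 ^ n) * 'I_d) c * (((l `^ H / la) ^+ 2) ^+ m * (4^-1) ^+ n))).
  by apply: ler_sum => ki _; rewrite ler_wpM2l// increment_ratio.
rewrite sumr_const card_prod !card_ord -[leLHS]mulr_natr natrM natrX.
have e4 : 4^-1 ^+ n * 2 ^+ n = 2^-1 ^+ n :> R by rewrite -exprMn; congr (_ ^+ _); field.
by rewrite -e4 le_eqVlt; apply/orP; left; apply/eqP; ring.
Qed.

Lemma chain_good (w : T) la :
  (forall i t, a <= t <= b -> forall e, 0 < e -> exists2 dl, 0 < dl &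
    forall s, a <= s <= b -> `|s - t| < dl -> `|B i s w - B i t w| < e) ->
  0 <= la -> ~ (\bigcup_n bad_level la n) w ->
  forall i t, p <= t <= p + l -> `|B i t w - B i p w| <= la / (1 - chain_rate).
Proof.
move=> cB la0 nb i; have /andP[r0 r1] := chain_rate_bounds.
have pab t : p <= t <= p + l -> a <= t <= b.
  by move=> /andP[h1 h2]; rewrite (le_trans ap)//= (le_trans h2).
apply: (chaining_bound l0 la0 r0 r1).
  move=> t tp e e0; have [dl d0 Hd] := cB i t (pab t tp) e e0.
  by exists dl => // s sp; apply: Hd; exact: pab.
move=> n k kn; rewrite leNgt; apply/negP => h; apply: nb; exists n => //.
by exists (Ordinal kn, i).
Qed.

Section bounds.
Variable C : R.
Hypothesis C0 : 0 < C.
Hypothesis BI : forall (ep p u v dl la : R) (z : {ffun 'I_d -> 'I_(gridN M ep)}) (i : 'I_d),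
  a <= p <= b -> a <= u <= b -> a <= v <= b ->
  0 < ep -> 0 < dl -> dl <= 1 -> 0 < la ->
  [/\ fine (P (box_event B f p dl z)) <= (C * dl) ^+ d,
      fine (P (increment_event B u v la i)) <= C * ((`|u - v| `^ H) ^+ 2 / la ^+ 2) ^+ m &
      fine (P (box_event B f p dl z `&` increment_event B u v la i)) <=
      (C * dl) ^+ d * ((`|u - v| `^ H) ^+ 2 / la ^+ 2) ^+ m].

Let pab : a <= p <= b.
Proof. by rewrite ap/= (le_trans _ plb)// lerDl ltW. Qed.

Let lac la n : 0 < la -> 0 < la * chain_rate ^+ n.
Proof. by move=> la0; have /andP[r0 _] := chain_rate_bounds; rewrite mulr_gt0 ?exprn_gt0. Qed.

Lemma bad_le la : 0 < la ->
  fine (P (\bigcup_n bad_level la n)) <= C * d%:R * ((l `^ H / la) ^+ 2) ^+ m * 2.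
Proof.
move=> la0; apply: fine_probability_bigcup_half => n; first exact: measurable_bad_level.
apply: (le_trans _ (increment_ratio_sum n (ltW C0) la0)).
have h := fine_probability_exists P xpredT (@mI n (la * chain_rate ^+ n)).
apply: (le_trans h).
apply: ler_sum => -[k i] _ /=.
have z : {ffun 'I_d -> 'I_(gridN M 1)} by exact: [ffun=> ord0].
by have [] := @BI 1 p _ _ 1 _ z i pab (dyab (ltn_ord k)) (dyab (ltnW (ltn_ord k))) ltr01 ltr01 (lexx _) (lac n la0).
Qed.

Lemma bad_box_le la ep dl (z : {ffun 'I_d -> 'I_(gridN M ep)}) :
  0 < la -> 0 < ep -> 0 < dl -> dl <= 1 ->
  fine (P (box_event B f p dl z `&` \bigcup_n bad_level la n)) <=
  (C * dl) ^+ d * d%:R * ((l `^ H / la) ^+ 2) ^+ m * 2.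
Proof.
move=> la0 e0 d0 d1; rewrite setI_bigcupr.
have mb : measurable (box_event B f p dl z) by exact: (measurable_box_event a0 b1 f dl z fB pab).
have c0 : 0 <= (C * dl) ^+ d by rewrite exprn_ge0 ?mulr_ge0 ?ltW.
apply: fine_probability_bigcup_half => n.
  by apply: measurableI => //; exact: measurable_bad_level.
apply: (le_trans _ (increment_ratio_sum n c0 la0)).
pose A (ki : 'I_(2 ^ n) * 'I_d) := box_event B f p dl z `&`
  increment_event B (dyadic p l n ki.1.+1) (dyadic p l n ki.1) (la * chain_rate ^+ n) ki.2.
have mA ki : measurable (A ki) by apply: measurableI => //; exact: mI.
have -> : box_event B f p dl z `&` bad_level la n = [set w | exists i, xpredT i /\ A i w].
  apply/seteqP; split => w; first by move=> [h [ki [_ h']]]; exists ki.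
  by move=> [ki [_ [h h']]]; split => //; exists ki.
apply: (le_trans (fine_probability_exists P xpredT mA)).
apply: ler_sum => -[k i] _; rewrite /A/=.
by have [] := @BI ep p _ _ dl _ z i pab (dyab (ltn_ord k)) (dyab (ltnW (ltn_ord k))) e0 d0 d1 (lac n la0).
Qed.

End bounds.

End bad_increments.

(** * Hitting probability of a single time interval *)

Section interval_cover.
Context {R : realType}.
Variables (H a b M K gam : R) (d : nat) (F : set 'rV[R]_d).
Hypotheses (H0 : 0 < H) (H1 : H < 1) (a0 : 0 < a) (ab : a < b) (b1 : b <= 1).
Hypotheses (M0 : 0 <= M) (K0 : 0 <= K) (g0 : 0 < gam) (gd : gam <= d%:R).
Hypotheses (FM : forall x, F x -> forall i, - M <= x 0 i <= M) (aF : ahlfors_regular gam F).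

(** What a hit forces on the starting point when the increments are not bad. *)
Definition cover_event {T : Type} (B : 'I_d -> R -> T -> R) (f : R -> 'rV[R]_d) (p ep dl : R) : set T :=
  [set w | exists z : {ffun 'I_d -> 'I_(gridN M ep)},
     [pred z | `[< exists x, F x /\ cube z x >]] z /\ box_event B f p dl z w].

Lemma cover_event_sum {dT} {T : measurableType dT} (P : probability T R)
    (B : 'I_d -> R -> T -> R) f p (S : set T) ep dl Cg (c : R) :
  fbm_vec P H B -> a <= p <= b -> measurable S -> 0 <= c ->
  #|[pred z : {ffun 'I_d -> 'I_(gridN M ep)} | `[< exists x, F x /\ cube z x >]]|%:R <= Cg ->
  (forall z : {ffun 'I_d -> 'I_(gridN M ep)}, fine (P (box_event B f p dl z `&` S)) <= c) ->
  fine (P (cover_event B f p ep dl `&` S)) <= Cg * c.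
Proof.
move=> fB pab mS c0 cg bc; set Q := [pred z | _] in cg.
have mA (z : {ffun 'I_d -> 'I_(gridN M ep)}) : measurable (box_event B f p dl z `&` S).
  by apply: measurableI => //; exact: (measurable_box_event a0 b1 f dl z fB pab).
have -> : cover_event B f p ep dl `&` S =
    [set w | exists z, Q z /\ (box_event B f p dl z `&` S) w].
  apply/seteqP; split => w; first by move=> [[z [Qz h]] h']; exists z.
  by move=> [z [Qz [h h']]]; split => //; exists z.
apply: (le_trans (fine_probability_exists P Q mA)).
apply: (@le_trans _ _ (\sum_(z | Q z) c)); first by apply: ler_sum => z _; exact: bc.
by rewrite sumr_const -[leLHS]mulr_natl ler_wpM2r.
Qed.

Lemma measurable_cover_event {dT} {T : measurableType dT} (P : probability T R)
    (B : 'I_d -> R -> T -> R) f p ep dl : fbm_vec P H B -> a <= p <= b ->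
  measurable (cover_event B f p ep dl).
Proof.
by move=> fB pab; apply: measurable_exists_fin => z _; exact: (measurable_box_event a0 b1 f dl z fB pab).
Qed.

(** Write s = l^H, g = d - gam and ep_j = 2^j s. Starting near F at scale ep_j has probability
    O(2^(jd) s^g), bad increments at a comparable scale contribute a factor O(2^(-2mj)), so the
    layers add up to O(s^g). The box estimates need half-widths at most 1, so the layers stop at a J
    with ep_J of order 1, where bad increments alone have probability O(s^(2m)). *)
Lemma interval_cover : exists2 C : R, 0 < C &
  forall dT (T : measurableType dT) (P : probability T R) (B : 'I_d -> R -> T -> R) f (p l : R),
  fbm_vec P H B -> drift H a b K f ->
  (forall w i t, a <= t <= b -> forall e, 0 < e -> exists2 dl, 0 < dl &
    forall s, a <= s <= b -> `|s - t| < dl -> `|B i s w - B i t w| < e) ->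
  0 < l -> a <= p -> p + l <= b ->
  exists G : set T, [/\ measurable G, fine (P G) <= C * l `^ (H * (d%:R - gam)) &
    forall w t x, p <= t <= p + l -> F x -> (forall i, B i t w + f t 0 i = x 0 i) -> G w].
Proof.
have [m0 [Cg [_ Cg0 grid]]] := ahlfors_grid FM g0 aF.
(* 2 <= H m makes the increments of all levels summable, d + 1 <= 2 m the
   dyadic values 2^j of lam. *)
pose m := (d + (Num.truncn (2 / H)).+1)%N.
have m_gt0 : (0 < m)%N by rewrite /m addnS.
have Hm : 2 <= H * m%:R.
  rewrite mulrC -ler_pdivrMr//.
  have q0 : 0 <= 2 / H by rewrite divr_ge0 ?ltW.
  have /andP[_ /ltW h] := truncn_itv q0; apply: (le_trans h).
  by rewrite ler_nat leq_addl.
have m2d : (d.+1 <= 2 * m)%N.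
  by rewrite mul2n -addnn /m -addnA -[X in (X <= _)%N]addn1 leq_add// addSn ltnS.
have [C C0 BI'] := @box_increment_le R H a b M K d H0 a0 b1 M0 K0 m m_gt0.
have /andP[r0 r1] := chain_rate_bounds H0.
(* Distance from the start to the corner in units of ep_j: chaining gives the first term, the drift
   gives K and the side of the cube gives 1. *)
pose D := (1 - chain_rate H)^-1 + K + 1.
have r10 : 0 < (1 - chain_rate H)^-1 by rewrite invr_gt0 subr_gt0.
have D1 : 1 <= D by rewrite /D lerDr addr_ge0 ?(ltW r10).
have D0 : 0 < D by exact: lt_le_trans ltr01 D1.
have C'0 := ltW C0; have D'0 := ltW D0; have Cg'0 := ltW Cg0.
pose V := Cg * (C * D) ^+ d.
have V0 : 0 <= V by rewrite mulr_ge0 ?exprn_ge0 ?mulr_ge0.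
pose g := d%:R - gam.
have gg0 : 0 <= g by rewrite subr_ge0.
pose V1 := V * 2 ^+ d * d%:R * 2 * 2.
have V10 : 0 <= V1.
  by do 3 (apply: mulr_ge0 => //); apply: mulr_ge0 => //; exact: exprn_ge0.
pose V2 := C * d%:R * 2 * (2 * D) ^+ (2 * m).
have V20 : 0 <= V2.
  by apply: mulr_ge0; [rewrite !mulr_ge0|rewrite exprn_ge0 ?mulr_ge0].
have Dd0 : 0 < D ^+ d by rewrite exprn_gt0.
exists (D ^+ d + V + V1 + V2); first by rewrite ltr_wpDr// ltr_wpDr// ltr_wpDr.
move=> dT T P B f p l fB hf cB l0 ap plb.
have pab : a <= p <= b by rewrite ap/= (le_trans _ plb)// lerDl ltW.
set s := l `^ H; have s0 : 0 < s by rewrite powR_gt0.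
have l1 : l <= 1 by have := a0; have := b1; lra.
have s1 : s <= 1.
  rewrite -[leRHS](_ : 1 `^ H = 1); last by rewrite powR1.
  by apply: ge0_ler_powR; rewrite ?nnegrE ?(ltW H0) ?(ltW l0).
have lg : l `^ (H * (d%:R - gam)) = s `^ g by rewrite powRrM.
rewrite lg; have sg0 : 0 < s `^ g by rewrite powR_gt0.
have s'0 := ltW sg0.
(* If D s > 1 the claimed bound is at least 1 and the whole space will do. *)
have [sD|Ds] := ltP 1 (D * s).
  exists setT; split => //; rewrite probability_setT/=.
  apply: (@le_trans _ _ (D ^+ d * s `^ g)); last first.
    by rewrite ler_wpM2r// -!addrA lerDl !addr_ge0.
  apply: (@le_trans _ _ ((D * s) `^ g)).
    rewrite -[leLHS](_ : 1 `^ g = 1); last by rewrite powR1.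
    by apply: ge0_ler_powR; rewrite ?nnegrE ?mulr_ge0 ?(ltW s0) ?(ltW sD).
  rewrite powRM ?(ltW s0)// ler_wpM2r// -powR_mulrn//; apply: ler_powR => //.
  by rewrite /g gerBl ltW.
have BI ep p' u v dl la (z : {ffun 'I_d -> 'I_(gridN M ep)}) i :
    a <= p' <= b -> a <= u <= b -> a <= v <= b -> 0 < ep -> 0 < dl -> dl <= 1 -> 0 < la ->
    [/\ fine (P (box_event B f p' dl z)) <= (C * dl) ^+ d,
      fine (P (increment_event B u v la i)) <= C * ((`|u - v| `^ H) ^+ 2 / la ^+ 2) ^+ m &
      fine (P (box_event B f p' dl z `&` increment_event B u v la i)) <=
      (C * dl) ^+ d * ((`|u - v| `^ H) ^+ 2 / la ^+ 2) ^+ m].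
  exact: (BI' _ _ _ _ _ _ _ _ _ _ _ _ _ fB hf).
pose ep j : R := 2 ^+ j * s.
have ep0 j : 0 < ep j by rewrite mulr_gt0 ?exprn_gt0.
pose bad j := \bigcup_n bad_level H B p l (ep j) n.
have mbad j : measurable (bad j).
  by apply: bigcup_measurable => n _; exact: (measurable_bad_level a0 b1 fB l0 ap plb).
pose G j := cover_event B f p (ep j) (D * ep j).
have mG j : measurable (G j) by exact: measurable_cover_event fB pab.
have card_ep j : D * ep j <= 1 ->
    #|[pred z : {ffun 'I_d -> 'I_(gridN M (ep j))} | `[< exists x, F x /\ cube z x >]]|%:R <=
    Cg * (ep j `^ gam)^-1.
  move=> De; have [||w []//] := grid (ep j) => //.
  by apply: le_trans De; rewrite ler_peMl ?(ltW (ep0 j)).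
(* Number of cubes times probability of a box: this is of order ep_j^(d - gam), where 2^(j (d -
   gam)) is enlarged to 2^(jd). *)
have epg j : Cg * (ep j `^ gam)^-1 * (C * (D * ep j)) ^+ d <= V * (2 ^+ j) ^+ d * s `^ g.
  rewrite mulrA exprMn (_ : _ * _ = V * (ep j ^+ d / ep j `^ gam)); last by rewrite /V; ring.
  rewrite -[leRHS]mulrA ler_wpM2l//.
  rewrite -powR_mulrn ?(ltW (ep0 j))// -powRN -powRD; last by apply/implyP => _; rewrite gt_eqF.
  rewrite -/g /ep powRM ?exprn_ge0 ?(ltW s0)// ler_wpM2r//.
  rewrite -[leRHS]powR_mulrn ?exprn_ge0// ler_powR ?exprn_ege1 ?ler1n// /g gerBl ltW//.
have cD j : 0 <= (C * (D * ep j)) ^+ d by apply: exprn_ge0; do 2 (apply: mulr_ge0 => //); exact: ltW (ep0 j).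
have PG : fine (P (G 0%N)) <= V * s `^ g.
  have De : D * ep 0%N <= 1 by rewrite /ep expr0 mul1r.
  have h := @cover_event_sum _ _ P B f p setT (ep 0%N) (D * ep 0%N) _ _ fB pab measurableT (cD 0%N) (card_ep 0%N De).
  rewrite setIT in h; apply: (le_trans (h _)) => [z|].
    rewrite setIT.
    (* [BI] takes a coordinate, and 0 < gam <= d rules out d = 0. *)
    have [i] : {i : 'I_d | True}.
      case: (d) gd => [|n _]; last by exists ord0.
      by rewrite leNgt g0.
    by have [] := @BI (ep 0%N) p p p (D * ep 0%N) 1 z i pab pab pab (ep0 _) (mulr_gt0 D0 (ep0 _)) De ltr01.
  by apply: (le_trans (epg 0%N)); rewrite expr0 expr1n mulr1.
have PGb j : D * ep j.+1 <= 1 -> fine (P (G j.+1 `&` bad j)) <= V * 2 ^+ d * d%:R * 2 * s `^ g * 2^-1 ^+ j.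
  move=> De.
  have c1 : 0 <= (C * (D * ep j.+1)) ^+ d * d%:R * ((s / ep j) ^+ 2) ^+ m * 2.
    by rewrite !mulr_ge0// exprn_ge0// sqr_ge0.
  apply: (le_trans (@cover_event_sum _ _ P B f p (bad j) (ep j.+1) (D * ep j.+1) _ _ fB pab (mbad j) c1 (card_ep _ De) _)) => [z|].
    exact: (bad_box_le H0 a0 b1 Hm fB l0 ap plb C0 BI z (ep0 j) (ep0 _) (mulr_gt0 D0 (ep0 _)) De).
  rewrite (_ : s / ep j = 2^-1 ^+ j); last by rewrite /ep exprVn; field; rewrite ?expf_neq0 ?(gt_eqF s0).
  rewrite [leLHS](_ : _ = Cg * (ep j.+1 `^ gam)^-1 * (C * (D * ep j.+1)) ^+ d * (d%:R * ((2^-1 ^+ j) ^+ 2) ^+ m * 2)); last by ring.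
  apply: (@le_trans _ _ (V * (2 ^+ j.+1) ^+ d * s `^ g * (d%:R * ((2^-1 ^+ j) ^+ 2) ^+ m * 2))).
    by rewrite ler_wpM2r ?epg// !mulr_ge0// exprn_ge0// sqr_ge0.
  rewrite (_ : V * _ * _ * _ = V * 2 ^+ d * d%:R * 2 * s `^ g * ((2 ^+ j) ^+ d * ((2^-1 ^+ j) ^+ 2) ^+ m)); last first.
    by rewrite exprS exprMn; ring.
  have W0 : 0 <= V * 2 ^+ d * d%:R * 2 * s `^ g.
    by do 4 (apply: mulr_ge0 => //); exact: exprn_ge0.
  apply: ler_wpM2l => //.
  have u1 : 0 <= (2^-1 : R) ^+ j <= 1.
    by rewrite exprn_ge0//= exprn_ile1// invf_le1// ler1n.
  (* Here 2 m >= d + 1 is used; one factor 2^(-j) remains. *)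
  apply: (@le_trans _ _ ((2 ^+ j) ^+ d * (2^-1 ^+ j) ^+ d.+1)).
    rewrite ler_wpM2l ?exprn_ge0// -exprM.
    by have /andP[u2 u3] := u1; apply: ler_wiXn2l.
  by rewrite exprSr mulrA -exprMn -exprMn mulfV ?expr1n ?mul1r.
(* The last level with half-width at most 1. There 1 / ep_J < 2 D, which turns s / ep_J into a
   multiple of s. *)
have [J /andP[DJ JD]] : exists J : nat, (D * ep J <= 1) && (1 < D * ep J.+1).
  have exj : exists j, 1 < D * ep j.
    exists (Num.truncn (D * s)^-1).+1.
    have Ds0 : 0 <= (D * s)^-1 by rewrite invr_ge0 mulr_ge0 ?(ltW s0).
    have /andP[_ h] := truncn_itv Ds0; set k := (Num.truncn _).+1 in h *.
    rewrite /ep mulrCA -ltr_pdivrMr ?mulr_gt0// mul1r; apply: (lt_trans h).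
    by rewrite -natrX ltr_nat ltn_expl.
  have [[|j] Hj jmin] := ex_minnP exj.
    by move: Hj; rewrite /ep expr0 mul1r ltNge Ds.
  by exists j; rewrite Hj andbT leNgt; apply/negP => /jmin; rewrite ltnn.
have PbJ : fine (P (bad J)) <= V2 * s `^ g.
  apply: (le_trans (bad_le H0 a0 b1 Hm fB l0 ap plb C0 BI (ep0 J))).
  rewrite -/s /V2 (_ : C * d%:R * _ * 2 = C * d%:R * 2 * ((s / ep J) ^+ 2) ^+ m); last by ring.
  rewrite -[leRHS]mulrA ler_wpM2l ?mulr_ge0// -exprM.
  have q1 : s / ep J <= 2 * D * s.
    rewrite ler_pdivrMr// (_ : 2 * D * s * ep J = s * (D * ep J.+1)); last by rewrite /ep exprS; ring.
    by rewrite ler_peMr ?(ltW s0) ?(ltW JD).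
  apply: (@le_trans _ _ ((2 * D * s) ^+ (2 * m))).
    by rewrite lerXn2r ?nnegrE// ?divr_ge0 ?mulr_ge0 ?(ltW s0) ?(ltW (ep0 J)).
  rewrite exprMn ler_wpM2l ?exprn_ge0 ?mulr_ge0// -powR_mulrn ?(ltW s0)//.
  apply: ger_powR; first by rewrite s0 s1.
  by rewrite /g lerBlDr (@le_trans _ _ (2 * m)%:R) ?ler_nat ?(ltnW m2d)// lerDl ltW.
have Gbad j w t x : ~ bad j w -> p <= t <= p + l -> F x ->
    (forall i, B i t w + f t 0 i = x 0 i) -> G j w.
  move=> nb tp Fx Bx; have [z zx] := cube_cover (ep0 j) (FM Fx).
  exists z; split; first by apply/asboolP; exists x.
  move=> i; have h := chain_good H0 l0 ap plb (cB w) (ltW (ep0 j)) nb i tp.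
  have tab : a <= t <= b by have /andP[h1 h2] := tp; rewrite (le_trans ap)//= (le_trans h2).
  have hf2 := hf.2 p t pab tab i.
  have tl : `|t - p| `^ H <= s.
    have /andP[h1 h2] := tp.
    apply: ge0_ler_powR; rewrite ?nnegrE ?(ltW H0) ?(ltW l0)// ger0_norm ?subr_ge0//; lra.
  have sj : s <= ep j by rewrite ler_peMl ?(ltW s0)// exprn_ege1// ler1n.
  have hf3 : `|f t 0 i - f p 0 i| <= K * ep j.
    by apply: (le_trans hf2); rewrite ler_wpM2l// (le_trans tl).
  have /andP[z1 z2] := zx i; have bx := Bx i.
  move: h hf3; rewrite /D !mulrDl mul1r [_^-1 * _]mulrC !ler_norml.
  by move=> /andP[h1 h2] /andP[h3 h4]; apply/andP; split; lra.
pose mid := [set w | exists j : 'I_J, xpredT j /\ (G j.+1 `&` bad j) w].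
have mmid : measurable mid by apply: measurable_exists_fin => j _; exact: measurableI.
(* A hit is covered by the first j such that the path is not bad at level
   2^j l^H, the previous level being bad. *)
exists (G 0%N `|` mid `|` bad J); split.
- by apply: measurableU => //; exact: measurableU.
- apply: (le_trans (fine_probabilityU P (measurableU _ _ (mG 0%N) mmid) (mbad J))).
  rewrite mulrDl; apply: lerD => //.
  apply: (le_trans (fine_probabilityU P (mG 0%N) mmid)).
  rewrite mulrDl; apply: lerD.
    by apply: (le_trans PG); rewrite ler_wpM2r// lerDr ltW.
  apply: (le_trans (fine_probability_exists P xpredT (fun j : 'I_J => measurableI _ _ (mG j.+1) (mbad j)))).
  apply: (@le_trans _ _ (\sum_(j < J) V * 2 ^+ d * d%:R * 2 * s `^ g * 2^-1 ^+ j)).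
    apply: ler_sum => j _; apply: PGb; apply: le_trans DJ.
    by rewrite ler_wpM2l// /ep ler_wpM2r ?(ltW s0)// ler_weXn2l// ler1n.
  rewrite -mulr_sumr /V1 [leRHS]mulrAC ler_wpM2l ?geometric_half_sum//.
  by do 4 (apply: mulr_ge0 => //); exact: exprn_ge0.
move=> w t x tp Fx Bx.
have [bJ|nbJ] := pselect (bad J w); first by right.
left; have exj : exists j, `[< ~ bad j w >] by exists J; apply/asboolP.
have [[|j] /asboolP nbj jmin] := ex_minnP exj; first by left; exact: (Gbad _ _ _ _ nbj tp Fx).
right; have jJ : (j < J)%N by apply: jmin; apply/asboolP.
exists (Ordinal jJ); split => //; split => /=; first exact: (Gbad _ _ _ _ nbj tp Fx).
apply: contrapT => nb; have : (j < j)%N by apply: jmin; apply/asboolP.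
by rewrite ltnn.
Qed.

End interval_cover.

(** * Capacity, Hausdorff measure and the final bounds *)

Section capacity_hausdorff.
Context {R : realType}.

(** Only measures of finite energy matter. If p = 0 there are none, the infimum is infinite and the
    capacity is 0; otherwise every energy is at least c / p. *)
Lemma capacity_le (al c p : R) (E : set R) : 0 <= al -> 0 < c -> 0 <= p ->
  (forall (mu : probability R R) e, mu.-negligible (~` E) -> energy al mu = e%:E -> c <= p * e) ->
  (c%:E * capacity al E <= p%:E)%E.
Proof.
move=> al0 c0 p0 h; rewrite /capacity; set S := [set _ | _ in _].
have S0 x : S x -> x = +oo%E \/ exists2 e, x = e%:E & c <= p * e.
  move=> [mu muE <-]; have : (0 <= energy al mu)%E.
    by apply: integral_ge0 => v _; apply: integral_ge0 => u _; exact: riesz_kernel_ge0.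
  case en : (energy al mu) => [e| |] // _; last by left.
  by right; exists e => //; exact: h en.
have [p00|pn0] := eqVneq p 0.
  have -> : ereal_inf S = +oo%E.
    apply/eqP; rewrite -leye_eq; apply: le_ereal_inf_tmp => x /S0[->//|[e _]].
    by rewrite p00 mul0r leNgt c0.
  by rewrite invey mule0 lee_fin.
have pp : 0 < p by rewrite lt_neqAle eq_sym pn0.
have : ((c / p)%:E <= ereal_inf S)%E.
  apply: le_ereal_inf_tmp => x /S0[->|[e -> pe]]; first exact: leey.
  by rewrite lee_fin ler_pdivrMr// mulrC.
have cp : 0 < c / p by rewrite divr_gt0.
case: (ereal_inf S) => [r| |] //; last by rewrite invey mule0 lee_fin.
rewrite lee_fin => cr; have r0 : 0 < r by exact: lt_le_trans cr.
rewrite inver gt_eqF// -EFinM lee_fin ler_pdivrMr// mulrC -ler_pdivrMr//.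
Qed.

(** The premeasure grows as delta decreases, so the limit at 0 exists; only then does [lim] carry
    information. *)
Lemma hausdorff_measure_ge (al : R) (E : set R) (x : \bar R) : 0 < al ->
  (forall dl, 0 < dl -> (x <= hausdorff_premeasure al dl E)%E) ->
  (x <= hausdorff_measure al E)%E.
Proof.
move=> al0 h; rewrite /hausdorff_measure (lt_geF al0).
have ni : {in Interval (BRight (0 : R)) +oo%O &, nonincreasing_fun (hausdorff_premeasure al ^~ E)}.
  move=> r s _ _ rs; apply: ereal_inf_le_tmp => _ [xr [hr Exr] <-]; exists xr => //; split => //.
  by move=> n; have /andP[-> h'] := hr n; exact: le_trans rs.
have ltoo : (BRight (0 : R) < +oo%O)%O by [].
have cv := @nonincreasing_at_right_cvge R (hausdorff_premeasure al ^~ E) 0 +oo%O ltoo ni.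
apply: lime_ge; first exact: (cvgP _ cv).
near=> dl; apply: h; near: dl; exact: nbhs_right_gt.
Unshelve. all: by end_near. Qed.

(** As a < b, both suprema run over nonempty sets of nonnegative numbers, so each is at most their
    sum K. The absolute value supplies a nonnegative constant whatever the sign of K. *)
Lemma hoelder_drift (H a b K : R) (d : nat) (f : R -> 'rV[R]_d) : a < b ->
  hoelder_norm H `[a, b] f = K%:E -> drift H a b `|K| f.
Proof.
move=> ab; rewrite /hoelder_norm.
set S1 := [set _ | _ in _]; set S2 := [set _ | _ in _] => hK.
have S1le s : a <= s <= b -> ((enorm (f s))%:E <= ereal_sup S1)%E.
  by move=> sab; apply: ereal_sup_ubound; exists s => //; rewrite /= in_itv.
have S2le s t : a <= s <= b -> a <= t <= b -> s != t ->
    ((enorm (f t - f s) / `|t - s| `^ H)%:E <= ereal_sup S2)%E.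
  by move=> sab tab st; apply: ereal_sup_ubound; exists (s, t) => //; split; rewrite /= ?in_itv.
have aab : a <= a <= b by rewrite lexx ltW.
have bab : a <= b <= b by rewrite lexx ltW.
have en0 (x : 'rV[R]_d) : 0 <= enorm x by exact: sqrtr_ge0.
have p1 : (0 <= ereal_sup S1)%E by apply: (le_trans _ (S1le a aab)); rewrite lee_fin.
have p2 : (0 <= ereal_sup S2)%E.
  by apply: (le_trans _ (S2le a b aab bab _)); rewrite ?lt_eqF// lee_fin divr_ge0 ?powR_ge0.
have q1 : (ereal_sup S1 <= `|K|%:E)%E.
  by apply: (@le_trans _ _ K%:E); [rewrite -hK leeDl|rewrite lee_fin ler_norm].
have q2 : (ereal_sup S2 <= `|K|%:E)%E.
  by apply: (@le_trans _ _ K%:E); [rewrite -hK leeDr|rewrite lee_fin ler_norm].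
split => [t tab i|s t sab tab i].
  by apply: (le_trans (coord_le_enorm _ i)); rewrite -lee_fin; apply: le_trans q1; exact: S1le.
have [->|st] := eqVneq s t; first by rewrite !subrr normr0 mulr_ge0 ?powR_ge0.
have -> : f t 0 i - f s 0 i = (f t - f s) 0 i by rewrite !mxE.
apply: (le_trans (coord_le_enorm _ i)).
have := le_trans (S2le s t sab tab st) q2; rewrite lee_fin ler_pdivrMr//.
by rewrite powR_gt0// normr_gt0 subr_eq0 eq_sym.
Qed.

Lemma fbm_continuous {dT} {T : measurableType dT} (P : probability T R) (H : R) (X : R -> T -> R) w t e :
  fbm P H X -> 0 <= t <= 1 -> 0 < e ->
  exists2 dl, 0 < dl & forall s, 0 <= s <= 1 -> `|s - t| < dl -> `|X s w - X t w| < e.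
Proof.
move=> [_ _ _ _ cX] t01 e0; have /subspace_continuousP := cX w.
have t01' : `[0, 1]%classic t by rewrite /= in_itv.
move=> /(_ t t01')/cvgrPdist_lt/(_ e e0).
rewrite /within/= => /nbhs_ballP[dl d0 h]; exists dl => // s s01 st.
by rewrite distrC; apply: h; [rewrite /ball/= distrC|rewrite /= in_itv].
Qed.

End capacity_hausdorff.

(** Each ball of a covering is cut down to [a, b], leaving an interval of length at most 2 r_n to
    which [cover] applies; countable subadditivity adds up the events. *)
Lemma exact_hit_le_premeasure {R : realType} {dT} {T : measurableType dT} (P : probability T R)
    (a b al C dl : R) (d : nat) (g : 'I_d -> R -> T -> R) (E : set R) (F : set 'rV[R]_d) :
  a < b -> 0 <= al -> 0 < C -> E `<=` `[a, b] -> measurable (exact_hit g E F) ->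
  (forall p l, 0 < l -> a <= p -> p + l <= b -> exists G : set T,
    [/\ measurable G, fine (P G) <= C * l `^ al &
      forall w t x, p <= t <= p + l -> F x -> (forall i, g i t w = x 0 i) -> G w]) ->
  (P (exact_hit g E F) <= C%:E * hausdorff_premeasure al dl E)%E.
Proof.
move=> ab al0 C0 Eab mhit cover; rewrite -lee_pdivrMl//.
apply: le_ereal_inf_tmp => _ [[x r] [/= rd Ecov] <-]; rewrite lee_pdivrMl//=.
have /choice[G HG] n : exists G : set T, [/\ measurable G,
    (P G <= (C * (2 * r n) `^ al)%:E)%E &
    forall w t y, E t -> ball (x n) (r n) t -> F y -> (forall i, g i t w = y 0 i) -> G w].
  have C2 : 0 <= C * (2 * r n) `^ al by rewrite mulr_ge0 ?powR_ge0 ?(ltW C0).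
  pose p := Num.max a (x n - r n); pose q := Num.min b (x n + r n).
  have inpq t : E t -> ball (x n) (r n) t -> p <= t <= q /\ p < q.
    move=> /Eab; rewrite /= in_itv/= => /andP[at_ tb].
    rewrite /ball/= ltr_distl => /andP[h1 h2].
    have pt : p <= t by rewrite /p ge_max at_/=; lra.
    have tq : t <= q by rewrite /q le_min tb/=; lra.
    split; first by rewrite pt.
    by rewrite /p /q gt_max !lt_min ab/=; apply/andP; split; [|apply/andP; split]; lra.
  (* When q <= p the ball contains no point of E, since such a point gives p < q by [inpq]. *)
  have [pq|qp] := ltP p q; last first.
    exists set0; split => //; first by rewrite measure0 lee_fin.
    by move=> w t y Et bt; have [_] := inpq t Et bt; rewrite ltNge qp.
  have l0 : 0 < q - p by rewrite subr_gt0.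
  have ap : a <= p by rewrite /p le_max lexx.
  have pqb : p + (q - p) <= b by rewrite addrC subrK /q ge_min lexx.
  have [G [mG PG GH]] := cover p (q - p) l0 ap pqb.
  exists G; split => //.
    rewrite probability_fineE// lee_fin; apply: (le_trans PG).
    rewrite ler_wpM2l ?(ltW C0)//; apply: ge0_ler_powR; rewrite ?nnegrE ?(ltW l0)//.
      by have /andP[r0 _] := rd n; rewrite mulr_ge0.
    have h1 : q <= x n + r n by rewrite /q ge_min lexx orbT.
    have h2 : x n - r n <= p by rewrite /p le_max lexx orbT.
    lra.
  move=> w t y Et bt Fy gy; apply: (GH w t y) => //.
  by rewrite addrC subrK; have [] := inpq t Et bt.
have mG n : measurable (G n) by have [] := HG n.
have sub : exact_hit g E F `<=` \bigcup_n G n.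
  move=> w [t [y [Et Fy gy]]]; have [n _ bt] := Ecov t Et.
  by exists n => //; have [_ _] := HG n; apply; [exact: Et|exact: bt|exact: Fy|exact: gy].
apply: (le_trans (measure_sigma_subadditive P mG mhit sub)).
rewrite -nneseriesZl; last by move=> n _; rewrite lee_fin powR_ge0.
apply: lee_nneseries => n _; first by move=> _; exact: measure_ge0.
by rewrite -EFinM; have [] := HG n.
Qed.

Unset Implicit Arguments.

Theorem proposition3p7 (R : realType) (d : nat) (a b H gam M K : R)
    (E : set R) (F : set 'rV[R]_d) :
  0 < a -> a < b -> b <= 1 ->
  0 < H -> H < 1 ->
  E `<=` `[a, b] -> compact E ->
  0 < gam -> gam <= d%:R ->
  compact F -> ahlfors_regular gam F ->
  0 < M -> (forall x, F x -> forall i, - M <= x 0 i <= M) ->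
  exists2 c5 : R, 0 < c5 &
    forall (dT : measure_display) (T : measurableType dT)
      (P : probability T R) (B : 'I_d -> R -> T -> R) (f : R -> 'rV[R]_d),
    measure_is_complete P ->
    fbm_vec P H B ->
    hoelder_space H `[a, b] f -> hoelder_norm H `[a, b] f = K%:E ->
    ((c5^-1)%R%:E * capacity (H * (d%:R - gam)) E <= P (hitting_event B f E F)
       <= c5%:E * hausdorff_measure (H * (d%:R - gam)) E)%E.
Proof.
move=> a0 ab b1 H0 H1 Eab cE g0 gd cF aF M0 FM.
have M'0 := ltW M0; have K0 : 0 <= `|K| by [].
have [c c0 lower] := near_hit_energy H0 H1 a0 ab b1 M'0 K0 g0 gd FM aF.
have [C C0 upper] := interval_cover H0 a0 b1 M'0 K0 g0 gd FM aF.
set al := H * (d%:R - gam) in lower upper *.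
have al0 : 0 <= al by rewrite mulr_ge0 ?subr_ge0 ?(ltW H0).
(* The term 1 serves al = 0, where the Hausdorff measure is 1 by convention; c^-1 serves the lower
   bound and C the upper one. *)
exists (1 + c^-1 + C); first by rewrite !addr_gt0 ?invr_gt0.
set c5 := 1 + c^-1 + C => dT T P B f _ fB _ fK.
have ci0 : 0 < c^-1 by rewrite invr_gt0.
have c50 : 0 < c5 by rewrite /c5; lra.
have hf := hoelder_drift ab fK.
pose g i t w := B i t w + f t 0 i.
have -> : hitting_event B f E F = exact_hit g E F.
  apply/seteqP; split => w.
    by move=> [_ [[t Et <-] Fx]]; exists t, (\row_i B i t w + f t); split => // i; rewrite !mxE.
  move=> [t [x [Et Fx gx]]]; exists x; split => //; exists t => //.
  by apply/rowP => i; rewrite !mxE -gx.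
have E01 t : E t -> a <= t <= b by move=> /Eab; rewrite /= in_itv.
have t01 t : a <= t <= b -> 0 <= t <= 1.
  by move=> /andP[h1 h2]; rewrite (le_trans (ltW a0))//= (le_trans h2).
have mg i t : E t -> measurable_fun setT (g i t).
  by move=> /E01/t01 ht; apply: measurable_funD => //; exact: measurable_fbm (fB.1 i) ht.
have cB w i t : a <= t <= b -> forall e, 0 < e -> exists2 dl, 0 < dl &
    forall s, a <= s <= b -> `|s - t| < dl -> `|B i s w - B i t w| < e.
  move=> /t01 ht e e0; have [dl d0 h] := fbm_continuous w (fB.1 i) ht e0.
  by exists dl => // s /t01; exact: h.
have cg w i t : E t -> forall e, 0 < e -> exists2 dl, 0 < dl &
    forall s, E s -> `|s - t| < dl -> `|g i s w - g i t w| < e.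
  move=> /E01 ht e e0; have e2 : 0 < e / 2 by rewrite divr_gt0.
  have [dl d0 h] := cB w i t ht (e / 2) e2.
  have K1 : 0 < `|K| + 1 by rewrite ltr_wpDl.
  have q0 : 0 < e / 2 / (`|K| + 1) by rewrite divr_gt0.
  (* The second distance makes |K| |s - t|^H < e / 2; adding 1 to |K| keeps the quotient meaningful
     when K = 0. *)
  exists (Num.min dl ((e / 2 / (`|K| + 1)) `^ H^-1)); first by rewrite lt_min d0 powR_gt0.
  move=> s /E01 hs; rewrite lt_min => /andP[h1 h2].
  have h3 : `|f s 0 i - f t 0 i| < e / 2.
    apply: (le_lt_trans (hf.2 t s ht hs i)).
    have : `|s - t| `^ H <= e / 2 / (`|K| + 1).
      move: h2; set q := _ / (_ + 1) => h2.
      have -> : q = (q `^ H^-1) `^ H by rewrite -powRrM mulVf ?powRr1 ?(ltW q0)// gt_eqF.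
      by apply: ge0_ler_powR; rewrite ?nnegrE ?powR_ge0 ?(ltW H0) ?(ltW h2).
    rewrite ler_pdivlMr// mulrDr mulr1 mulrC => h4.
    by have := powR_ge0 `|s - t| H; have := normr_ge0 K; nra.
  rewrite /g opprD addrACA; apply: (le_lt_trans (ler_normD _ _)).
  by have := h s hs h1; lra.
have mhit : measurable (exact_hit g E F) by exact: (measurable_exact_hit Eab cE cF a0 FM mg cg).
have P1 : (P (exact_hit g E F) <= 1)%E by exact: probability_le1.
apply/andP; split.
  rewrite lee_pdivrMl//; apply: (@le_trans _ _ (c^-1%:E * P (exact_hit g E F))%E); last first.
    by rewrite lee_wpmul2r//; rewrite lee_fin /c5; lra.
  rewrite lee_pdivlMl// [P _]probability_fineE//.
  apply: capacity_le => //; first exact: fine_probability_ge0.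
  move=> mu e muE en.
  have near n : c <= fine (P (near_hit g E F n.+1%:R^-1)) * e.
    have n0 : 0 < n.+1%:R^-1 :> R by rewrite invr_gt0 ltr0n.
    apply: (lower _ _ _ _ _ _ _ _ _ fB hf Eab muE en n0).
    exact: (measurable_near_hit Eab a0 FM mg cg).
  have e0 : 0 < e.
    rewrite ltNge; apply/negP => e0; have := near 0%N; rewrite leNgt => /negP; apply.
    by apply: le_lt_trans c0; rewrite mulr_ge0_le0 ?fine_probability_ge0.
  rewrite -ler_pdivrMr// -lee_fin -probability_fineE//.
  apply: (exact_hit_ge Eab cE cF a0 FM mg cg) => n.
  rewrite probability_fineE ?lee_fin ?ler_pdivrMr//.
  by apply: (measurable_near_hit Eab a0 FM mg cg); rewrite invr_gt0 ltr0n.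
have [alle|algt] := leP al 0.
  rewrite /hausdorff_measure alle mule1; apply: (le_trans P1).
  by rewrite lee_fin /c5; lra.
rewrite -lee_pdivrMl//; apply: hausdorff_measure_ge => // dl _; rewrite lee_pdivrMl//.
apply: (@le_trans _ _ (C%:E * hausdorff_premeasure al dl E)%E).
  apply: (exact_hit_le_premeasure _ ab al0 C0 Eab mhit) => p l l0 ap plb.
  exact: (upper _ _ _ _ _ _ _ fB hf cB l0 ap plb).
rewrite lee_wpmul2r//; last by rewrite lee_fin /c5; lra.
apply: le_ereal_inf_tmp => _ [xr _ <-]; apply: nneseries_ge0 => n _ _.
by rewrite lee_fin powR_ge0.
Qed.
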